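(* Let $(\Omega,\mathcal{F},\mathbb{P})$ support a standard two-dimensional Brownian motion $W=(W^0,W^1)=\{W_x\}_{x\in\mathbb{R}_+}$ with natural filtration $\{\mathcal{F}_x\}_{x\in\mathbb{R}_+}$. Let $\vartheta$ be any bijection in $C_0(\mathbb{R}_+,\mathbb{R}_+)$, let $\sigma,\kappa,v>0$, $\alpha\in(0,\tfrac12)$, $\rho\in[-1,1]$, and let $W^\alpha:=D^\alpha(W^1)$ be the Riemann-Liouville fractional derivative of $W^1$ of order $\alpha$. Let $Y_{t,x}:=\sigma W^\alpha_x+\kappa(\vartheta(t)-x)+v$, let $X=\{X_t\}_{t\in\mathbb{R}_+}$ be the solution of the random initial value problem $x'=Y_{t,x}$, $x_0=0$, and let the Riemann-Liouville-Heston (RLH) price process be $S:=\exp(W^\rho_X-\tfrac12X)$, where $W^\rho:=\sqrt{1-\rho^2}\,W^0+\rho W^1$. Then $S$ is a martingale on the filtered space $(\Omega,\mathcal{F},\{\mathcal{G}_t\}_{t\in\mathbb{R}_+},\mathbb{P})$, where $\mathcal{G}_t:=\mathcal{F}_{X_t}$.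
   Context: $\mathbb{R}_+=[0,\infty)$; $C_0$ denotes continuous paths starting from $0$ at $0$. For a path $w$ with $w(0)=0$ that is locally Hölder continuous of order $\lambda\in(0,1)$ on $\mathbb{R}_+$ and $\alpha\in(0,\lambda)$, $$D^\alpha(w)(x):=\frac{1}{\Gamma(1-\alpha)}\frac{\mathrm{d}}{\mathrm{d}x}\int_0^x\frac{w(u)}{(x-u)^\alpha}\,\mathrm{d}u,$$ which is a well-defined locally $(\lambda-\alpha)$-Hölder path starting from $0$; it is applied pathwise to $W^1$. A process $X$ is the solution of the random initial value problem $x'=Y_{t,x}$, $x_0=0$ if almost surely $X_0=0$ and $X'_t=Y_{t,X_t}$ for all $t\in\mathbb{R}_+$. Here it exists, is unique up to indistinguishability, and a.s. has paths that are bijections in $C^1_0(\mathbb{R}_+,\mathbb{R}_+)$. The notation $W^\alpha$ (fractional derivative) and $W^\rho$ (correlated Brownian motion) denote different processes. $\mathcal{F}_{X_t}$ denotes the $\sigma$-algebra of events prior to the stopping time $X_t$ of $\{\mathcal{F}_x\}_{x\in\mathbb{R}_+}$. *)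

(* Defs.v *)
(* Written against MathComp-Analysis, over an arbitrary [R : realType].
   The time set [0, +oo) is rendered by indices in [R] restricted to
   nonnegative values; values at negative indices are never constrained. *)
From mathcomp Require Import all_boot all_order all_algebra.
From mathcomp Require Import all_classical all_reals all_analysis.

Set Implicit Arguments.
Unset Strict Implicit.
Unset Printing Implicit Defensive.

Import Order.TTheory GRing.Theory Num.Theory.
Import numFieldNormedType.Exports.

Local Open Scope classical_set_scope.
Local Open Scope ring_scope.

Section paths.
Context {R : realType}.

(* The bijections in C_0(R_+, R_+). *)
Definition bijection_in_C0 (theta : R -> R) : Prop :=
  [/\ theta 0 = 0,
      {within `[0, +oo[%classic, continuous theta} &
      set_bij `[0, +oo[%classic `[0, +oo[%classic theta].

(* Derivative of a path on [0, +oo): it is one-sided at [t = 0]. *)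
Definition has_derivative_on_Rplus (x : R -> R) (t l : R) : Prop :=
  (x s - x t) / (s - t) @[s --> within [set s | 0 <= s] t^'] --> l.

Definition Gamma (a : R) : R :=
  (\int[lebesgue_measure]_(u in `]0, +oo[) (u `^ (a - 1) * expR (- u)))%R.

(* For [x < 0] the integral is over the empty set. Hence, for a locally
   [lambda]-Hoelder path [w] with [w 0 = 0] and [a < lambda], the two-sided
   derivative at [x = 0] exists and is [0], as required of a path starting
   from [0]. *)
Definition frac_derivative (a : R) (w : R -> R) (x : R) : R :=
  (Gamma (1 - a))^-1 *
  derive1 (fun y : R =>
    (\int[lebesgue_measure]_(u in `[0, y]) (w u / (y - u) `^ a))%R) x.

End paths.

Section processes.
Context {d : measure_display} {T : measurableType d} {R : realType}.
Variable P : probability T R.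

Definition measurable_wrt {d'} {T' : measurableType d'}
    (G : set_system T) (f : T -> T') : Prop :=
  preimage_set_system setT f measurable `<=` G.

Definition independent_systems (G H : set_system T) : Prop :=
  forall A B, G A -> H B -> (P (A `&` B) = P A * P B)%E.

Definition sigma_past (W : R -> T -> R * R) (x : R) : set_system T :=
  <<s \bigcup_(u in `[0, x]) preimage_set_system setT (W u) measurable >>.

(* [normal_prob m s] has standard deviation [s], so the increments have law
   N(0, (t - s) I_2). Every path is continuous, so that composing with a random
   time preserves measurability although [P] need not be complete. *)
Definition brownian_motion2 (W : R -> {RV P >-> (R * R)%type}) : Prop :=
  [/\ {ae P, forall w, W 0 w = (0, 0)},
      forall w, {within `[0, +oo[%classic, continuous (fun x => W x w)},
      forall s t, 0 <= s -> s < t -> forall B : set (R * R), measurable B ->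
        P [set w | B (W t w - W s w)] =
        (normal_prob 0 (Num.sqrt (t - s)) \x
         normal_prob 0 (Num.sqrt (t - s)))%E B &
      forall s t, 0 <= s -> s < t ->
        independent_systems (sigma_past W s)
          (preimage_set_system setT (fun w => W t w - W s w) measurable)].

(* The natural filtration is augmented with the null events. This is needed:
   solutions of the random initial value problem below are characterized only
   almost surely, and stopping times of the raw filtration are not stable
   under modification on null events. *)
Definition natural_filtration (W : R -> T -> R * R) (x : R) : set_system T :=
  <<s sigma_past W x `|` [set N | measurable N /\ P N = 0%E] >>.

(* The sigma-algebra of events prior to a finite stopping time [tau]. *)
Definition events_prior (F : R -> set_system T) (tau : T -> R) :
    set_system T :=
  [set A | measurable A /\
           forall x, 0 <= x -> F x (A `&` [set w | tau w <= x])].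

Definition filtration (G : R -> set_system T) : Prop :=
  [/\ forall t, 0 <= t -> sigma_algebra setT (G t),
      forall t, 0 <= t -> G t `<=` measurable &
      forall s t, 0 <= s -> s <= t -> G s `<=` G t].

(* [Z] is a version of the conditional expectation E[Y | G]. *)
Definition conditional_expectation (G : set_system T) (Y Z : T -> R) : Prop :=
  [/\ measurable_wrt G Z,
      P.-integrable setT (EFin \o Z) &
      forall A, G A ->
        (\int[P]_(w in A) (Z w)%:E = \int[P]_(w in A) (Y w)%:E)%E].

Definition martingale (G : R -> set_system T) (M : R -> T -> R) : Prop :=
  [/\ filtration G,
      forall t, 0 <= t -> measurable_wrt (G t) (M t),
      forall t, 0 <= t -> P.-integrable setT (EFin \o M t) &
      forall s t, 0 <= s -> s <= t -> conditional_expectation (G s) (M t) (M s)].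

(* x' = Y_{t,x}, x_0 = 0, almost surely, for a process with values in
   [0, +oo). *)
Definition random_ivp_solution (Y : R -> R -> T -> R)
    (X : R -> {RV P >-> R}) : Prop :=
  (forall t w, 0 <= t -> 0 <= X t w) /\
  {ae P, forall w, X 0 w = 0 /\
    forall t, 0 <= t ->
      has_derivative_on_Rplus (fun s => X s w) t (Y t (X t w) w)}.

(* The pair [W x w] is (W^0_x, W^1_x). *)
Definition correlated_bm (rho : R) (W : R -> T -> R * R) (x : R) (w : T) : R :=
  Num.sqrt (1 - rho ^+ 2) * (W x w).1 + rho * (W x w).2.

Definition RLH_field (sigma kappa v alpha : R) (theta : R -> R)
    (W : R -> T -> R * R) (t x : R) (w : T) : R :=
  sigma * frac_derivative alpha (fun u => (W u w).2) x
  + kappa * (theta t - x) + v.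

Definition RLH_price (rho : R) (W : R -> T -> R * R) (X : R -> T -> R)
    (t : R) (w : T) : R :=
  expR (correlated_bm rho W (X t w) w - X t w / 2).

End processes.

(* Main.v *)
(* On an event of full measure the fractional derivative of [W^1] is a
   continuous path (the Marchaud representation of a Hoelder path), and since
   [theta] increases, so does the solution [X]. The event [X_t > y] can then be
   written with countably many conditions on the field restricted to [0, y],
   which makes [X_t] a stopping time of the augmented filtration. With
   [M_x := exp (W^rho_x - x / 2)], optional stopping at the bounded time
   [min (X_t, n)] gives E[S_t; A, X_t <= n] = E[M_n; A, X_t <= n] for every
   [A] in [G_t], and E[S_s; A] = E[S_t; A] for [A] in [G_s] follows from
   [X_s <= X_t] as soon as E[M_n; X_t > n] tends to [0].

   This last point excludes a loss of mass at infinity. On [X_t > n] the field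
   at time [t] is nonnegative along [0, n]; integrating it over [0, n] yields
   [sigma I(n) + m n >= kappa n ^ 2 / 2], where [I] is the fractional integral
   of [W^1] of order [1 - alpha], normalized, and [m] is a constant. As [I(n)]
   is at most of order [n ^ (1 - alpha) max |W^1|], the path [W^1] must exceed
   [5 n] in absolute value before [n], and the maximal inequality makes this
   too rare for [M_n] to carry mass there. *)

(* The delicate step is the stopping time. The moment at which the level [y] is passed solves the
   inverse equation [dt/dy = 1 / (g y + kappa * theta t)], which involves the field only up to [y].
   But the speed may vanish along the path, where this equation is singular, so inequalities replace
   it: rational times are chosen so late that, with [theta] frozen at the start of each cell of a
   grid on [0, y], the cell is crossed within the time allotted to it. As [theta] increases
   strictly, a delay gains speed, and on a fine grid this gain absorbs the oscillation of the rough
   path.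

   The constant 5 comes from a second moment estimate: [M_n ^ 2] has expectation [exp n], while the
   maximal inequality at the heights [5 n] and [- 5 n] gives a probability of at most
   [2 exp (- 25 n / 8)], hence [2 exp (- 3 n)]; the mass of [M_n] on that event is then of order
   [exp (- n)]. The square of an exponential martingale is, up to a deterministic factor, the
   exponential martingale with doubled coefficients; the same identity supplies the uniform
   integrability behind optional stopping. *)
From HB Require Import structures.
Require Import Defs.
From mathcomp Require Import all_boot all_order all_algebra.
From mathcomp Require Import all_classical all_reals all_analysis.
From mathcomp Require Import measurable_realfun ring lra.

Set Implicit Arguments.
Unset Strict Implicit.
Unset Printing Implicit Defensive.

Import Order.TTheory GRing.Theory Num.Theory.
Import numFieldNormedType.Exports.

Local Open Scope classical_set_scope.
Local Open Scope ring_scope.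

(** * Fractional derivatives of Hölder paths *)

Section power_integrals.
Context {R : realType}.
Local Notation mu := (@lebesgue_measure R).

Lemma continuous_powR (p x : R) : 0 < x -> {for x, continuous (@powR R ^~ p)}.
Proof.
move=> x0; apply: differentiable_continuous; apply/derivable1_diffP.
by apply: derivable_powR; rewrite in_itv/= x0.
Qed.

Lemma integral_powR_itvcc (p a b : R) : p != 0 -> 0 < a -> a <= b ->
  (\int[mu]_(s in `[a, b]) (s `^ (p - 1))%:E =
   ((b `^ p - a `^ p) / p)%:E)%E.
Proof.
move=> p0 a0; rewrite le_eqVlt => /predU1P[<-|ab].
  by rewrite set_itv1 integral_set1 subrr mul0r.
have dF (x : R) : 0 < x -> is_derive x 1 (fun s : R => p^-1 * s `^ p) (x `^ (p - 1)).
  move=> x0; have := is_deriveZ p^-1 (is_derive1_powR p x0).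
  by rewrite [X in is_derive _ _ _ X](_ : _ = x `^ (p - 1))// [LHS]mulrA mulVf// mul1r.
have cF (x : R) : 0 < x -> {for x, continuous (fun s : R => p^-1 * s `^ p)}.
  move=> x0; apply: differentiable_continuous; apply/derivable1_diffP.
  by have [] := dF _ x0.
rewrite (@continuous_FTC2 _ _ (fun s : R => p^-1 * s `^ p))//.
- by rewrite -EFinD -mulrBr mulrC.
- apply: continuous_in_subspaceT => x; rewrite inE/= in_itv/= => /andP[ax _].
  by apply: continuous_powR; exact: lt_le_trans ax.
- split.
  + move=> x; rewrite in_itv/= => /andP[ax _].
    by have [] := dF _ (lt_trans a0 ax).
  + by apply: cvg_at_right_filter; exact: cF.
  + by apply: cvg_at_left_filter; exact: cF (lt_trans a0 ab).
- move=> x; rewrite in_itv/= => /andP[ax _]; rewrite derive1E.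
  by have [_ ->] := dF _ (lt_trans a0 ax).
Qed.

(** For [p < 1] the integrand is unbounded at 0, so the value is obtained as the monotone limit of
    the integrals over [[b / (i + 1), b]]. *)
Lemma integral_powR_itvoc (p b : R) : 0 < p -> 0 < b ->
  (\int[mu]_(s in `]0%R, b]) (s `^ (p - 1))%:E = (b `^ p / p)%:E)%E.
Proof.
move=> p0 b0.
pose F i := `[b / i.+1%:R, b]%classic.
have bi i : 0 < b / i.+1%:R by rewrite divr_gt0.
have -> : `]0, b]%classic = \bigcup_i F i.
  apply/seteqP; split => [x|x [i _]] /=; rewrite /F/= !in_itv/=.
    move=> /andP[x0 xb]; exists (Num.truncn (b / x)) => //=; rewrite in_itv/= xb andbT.
    rewrite ler_pdivrMr// mulrC -ler_pdivrMr//.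
    exact/ltW/truncnS_gt.
  by move=> /andP[ix ->]; rewrite (lt_le_trans _ ix).
have h1 : (\int[mu]_(s in F i) (s `^ (p - 1))%:E @[i --> \oo] -->
    \int[mu]_(s in \bigcup_i F i) (s `^ (p - 1))%:E)%E.
  apply: ge0_nondecreasing_set_cvg_integral => //.
  - move=> i j ij; rewrite subsetEset => x; rewrite /F/= !in_itv/= => /andP[ix ->].
    rewrite andbT (le_trans _ ix)// ler_pM2l// lef_pV2 ?posrE//.
    by rewrite ler_nat.
  - by move=> i; exact: measurable_itv.
  - move=> i; apply/measurable_EFinP.
    by apply: measurable_funTS; exact: measurable_powR.
  - by move=> i x _; rewrite lee_fin powR_ge0.
apply: (cvg_unique _ h1) => //.
rewrite (_ : (fun i => _) = (fun i => ((b `^ p - (b / i.+1%:R) `^ p) / p)%:E)); last first.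
  apply/funext => i; rewrite integral_powR_itvcc ?gt_eqF//.
  by rewrite ler_pdivrMr// ler_peMr ?ler1n// ltW.
apply: cvg_EFin; first exact: nearW.
rewrite (_ : b `^ p / p = (b `^ p - 0) / p); last by rewrite subr0.
apply: cvgMl; apply: cvgB; first exact: cvg_cst.
apply: (@cvg_comp _ _ _ (fun i : nat => b / i.+1%:R) (fun x : R => x `^ p) _ (0 : R)^'+).
  move=> A/= [e/= e0 eA].
  have : (b / i.+1%:R) @[i --> \oo] --> (0 : R).
    rewrite -[X in _ --> X](mulr0 b); apply: cvgMr.
    exact: cvg_harmonic.
  move=> /cvgrPdist_lt/(_ _ e0) [N _ NA]; exists N => //= i Ni.
  by apply: eA => //=; apply: NA.
exact: powR_cvg0.
Qed.

Lemma integrable_powR_itvoc (p b : R) : 0 < p -> 0 < b ->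
  mu.-integrable `]0, b] (EFin \o (fun s : R => s `^ (p - 1))).
Proof.
move=> p0 b0; apply/integrableP; split.
  by apply/measurable_EFinP; apply: measurable_funTS; exact: measurable_powR.
under eq_integral do rewrite /= ger0_norm ?powR_ge0//.
by rewrite integral_powR_itvoc// ltry.
Qed.

End power_integrals.

(** * Marchaud form of the fractional integral *)

Section fractional_integral.
Context {R : realType}.
Local Notation mu := (@lebesgue_measure R).
Variable w : R -> R.
Hypothesis cw : continuous w.
Hypothesis w0 : forall u, u <= 0 -> w u = 0.

Definition primitive0 (y : R) : R := (\int[mu]_(u in `[0, y]) w u)%R.

Lemma integrable_continuous_itv (i : interval R) (a b : R) :
  [set` i] `<=` `[a, b] -> mu.-integrable [set` i] (EFin \o w).
Proof.
move=> iab; have := @continuous_compact_integrable R w `[a, b]%classic.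
move=> /(_ (@segment_compact _ _ _)) /(_ (continuous_subspaceT cw)).
by apply: integrableS => //; exact: measurable_itv.
Qed.

Lemma primitive0_le0 (y : R) : y <= 0 -> primitive0 y = 0.
Proof.
move=> y0; rewrite /primitive0 /Rintegral integral0_eq// => u /=.
by rewrite in_itv/= => /andP[_ uy]; rewrite w0// (le_trans uy).
Qed.

(** Moving the lower end to the left of 0 places [y] in the interior of an interval of integration,
    also for [y <= 0]; this gives two-sided derivatives at 0. *)
Lemma primitive0_widen (a y : R) : a <= 0 ->
  (\int[mu]_(u in `[a, y]) w u)%R = primitive0 y.
Proof.
move=> a0; rewrite /primitive0 Rintegral_mkcond [RHS]Rintegral_mkcond.
apply: eq_Rintegral => u _; rewrite !patchE !mem_setE !in_itv/=.
have [uy|] := leP u y; last by rewrite !andbF.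
rewrite !andbT; have [u0|u0] := leP 0 u; first by rewrite (le_trans a0).
by rewrite w0 ?if_same// ltW.
Qed.

Lemma primitive0B (z y : R) : z <= y ->
  primitive0 y - primitive0 z = (\int[mu]_(u in `]z, y]) w u)%R.
Proof.
move=> zy; pose a := Num.min 0 z.
have a0 : a <= 0 by rewrite ge_min lexx.
have az : a <= z by rewrite ge_min lexx orbT.
rewrite -(primitive0_widen y a0) -(primitive0_widen z a0).
apply: Rintegral_itvB; rewrite ?bnd_simp//.
exact: (@integrable_continuous_itv _ a y).
Qed.

Lemma is_derive_primitive0 (y : R) : is_derive y 1 primitive0 (w y).
Proof.
pose a := Num.min 0 y - 1.
have a0 : a <= 0 by rewrite /a lerBlDr add0r ge_min ler01.
have ay : a < y by rewrite /a ltrBlDr gt_min ltrDl ltr01 orbT.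
have -> : primitive0 = (fun x => (\int[mu]_(u in `[a, x]) w u)%R).
  by apply/funext => x; rewrite primitive0_widen.
have [||d <-] := @continuous_FTC1_closed R w a y (y + 1) _ _ ay (@cw y).
- by rewrite ltrDl.
- exact: (@integrable_continuous_itv _ a (y + 1)).
by split; [exact: d|rewrite derive1E].
Qed.

Lemma le_primitive0B (y A s : R) : (forall u, u <= y -> `|w u| <= A) -> 0 <= s -> `|primitive0 y - primitive0 (y - s)| <= A * s.
Proof.
move=> wA s0; rewrite primitive0B; last by rewrite gerBl.
have ig : mu.-integrable `]y - s, y] (EFin \o w).
  by apply: (@integrable_continuous_itv _ (y - s) y); exact: subset_itv_oc_cc.
apply: le_trans (le_normr_Rintegral _ _) _ => //.
have -> : A * s = (\int[mu]_(u in `](y - s)%R, y]) A)%R.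
  rewrite Rintegral_cst//= lebesgue_measure_itv/= lte_fin; case: ifPn => [_|].
    by rewrite -EFinB/= opprB addrC subrK.
  by rewrite ltrBlDr ltrDl -leNgt => s0'; rewrite (@le_anti _ _ s 0) ?s0 ?s0'// mulr0.
apply: le_Rintegral => //.
- by move: ig => /integrable_norm.
- apply/integrableP; split; first exact: measurable_cst.
  under eq_integral do rewrite /=.
  rewrite integral_cst//= lebesgue_measure_itv/=; case: ifP => _; last by rewrite mule0 ltry.
  by rewrite -EFinB -EFinM ltry.
- by move=> u /=; rewrite in_itv/= => /andP[_ uy]; exact: wA.
Qed.

Lemma continuous_primitive0 : continuous primitive0.
Proof.
move=> y; apply: differentiable_continuous; apply/derivable1_diffP.
by have [] := is_derive_primitive0 y.
Qed.

(** Increments of the primitive are at most [A * s], so the integrand is of order [s ^ (- al)],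
    which is integrable at 0 because [al < 1]. *)
Lemma integrable_primitive0_increment (al L y A : R) : al < 1 -> 0 < L ->
  (forall u, u <= y -> `|w u| <= A) ->
  mu.-integrable `]0, L] (EFin \o
   (fun s => s `^ (- al - 1) * (primitive0 y - primitive0 (y - s)))).
Proof.
move=> al1 L0 wA.
have i1 : mu.-integrable `]0, L] (fun s => A%:E * (s `^ ((1 - al) - 1))%:E)%E.
  apply: integrableZl => //; apply: integrable_powR_itvoc => //.
  by rewrite subr_gt0.
apply: le_integrable i1 => //.
  apply/measurable_EFinP; apply: measurable_funM.
    by apply: measurable_funTS; exact: measurable_powR.
  apply: measurable_funTS; apply: measurable_funB => //.
  apply: continuous_measurable_fun => s.
  apply: (@continuous_comp _ _ _ (fun s => y - s) primitive0).
    by apply: cvgB; [exact: cvg_cst|exact: cvg_id].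
  exact: continuous_primitive0.
move=> s /=; rewrite in_itv/= => /andP[s0 sL].
rewrite lee_fin normrM ger0_norm ?powR_ge0//.
have -> : 1 - al - 1 = (- al - 1) + 1 :> R by ring.
rewrite (@powRD _ s (- al - 1) 1); last by rewrite (gt_eqF s0) implybT.
rewrite powRr1 ?(ltW s0)// [leRHS]ger0_norm; last first.
  apply: mulr_ge0; first exact: le_trans (wA _ (lexx _)).
  by rewrite mulr_ge0 ?powR_ge0// ltW.
by rewrite mulrCA ler_wpM2l ?powR_ge0// le_primitive0B// ltW.
Qed.

Section representation.
Variables (al L y A : R).
Hypothesis al0 : 0 < al.
Hypothesis al1 : al < 1.
Hypothesis y0 : 0 < y.
Hypothesis yL : y <= L.
Hypothesis wA : forall u, u <= y -> `|w u| <= A.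

Let L0 : 0 < L. Proof. exact: lt_le_trans yL. Qed.

(** The kernel for Fubini, supported where [y - u < s <= L]. Integrating in [s] produces
    [(y - u) ^ (- al) - L ^ (- al)] up to the factor [al]; integrating in [u] produces an increment
    of the primitive. *)
Let k (z : R * R) : R := w z.1 * z.2 `^ (- al - 1) *
  (\1_`[0, y[ z.1 * \1_`]0, L] z.2 * \1_`]y, +oo[ (z.1 + z.2)).

Let mk : measurable_fun setT (EFin \o k).
Proof.
have mI (i : interval R) : measurable_fun setT (\1_[set` i] : R -> R).
  by apply: measurable_indic; exact: measurable_itv.
apply/measurable_EFinP; apply: measurable_funM.
  apply: measurable_funM.
    exact: (measurableT_comp (continuous_measurable_fun cw) measurable_fst).
  exact: (measurableT_comp (measurable_powR (- al - 1)) measurable_snd).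
apply: measurable_funM; first apply: measurable_funM.
- exact: (measurableT_comp (mI _) measurable_fst).
- exact: (measurableT_comp (mI _) measurable_snd).
- exact: (measurableT_comp (mI _) (measurable_funD measurable_fst measurable_snd)).
Qed.

Let kE1 (u : R) : (\int[mu]_s (k (u, s))%:E =
  (al^-1 * (w u / (y - u) `^ al - L `^ (- al) * w u) * \1_`[0, y[ u)%:E)%E.
Proof.
rewrite indicE; have [|uy] := boolP (u \in `[0, y[%classic); last first.
  rewrite mulr0 integral0_eq// => s _.
  by rewrite /k/= !indicE (negbTE uy) !mul0r mulr0.
rewrite inE/= in_itv/= => /andP[u0 uy]; rewrite mulr1.
transitivity (\int[mu]_(s in `](y - u)%R, L]) ((w u)%:E * (s `^ (- al - 1))%:E))%E.
  rewrite [RHS]integral_mkcond; apply: eq_integral => s _.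
  rewrite patchE /k/= !indicE !mem_setE !in_itv/= u0 uy/= ltrBlDl andbT mul1r.
  have [yus|yus] := ltP y (u + s); last by rewrite !mulr0.
  have -> : 0 < s by rewrite -(ltrD2l u) addr0 (lt_trans uy).
  by case: ifP; rewrite ?mulr1 ?mulr0.
have yu0 : 0 < y - u by rewrite subr_gt0.
have yuL : y - u <= L by rewrite (le_trans _ yL)// gerBl.
have mp (B : set R) : measurable_fun B (fun s : R => (s `^ (- al - 1))%:E).
  by apply/measurable_EFinP; apply: measurable_funTS; exact: measurable_powR.
rewrite integral_itv_obnd_cbnd; last by apply: emeasurable_funM.
rewrite integralZl//; last first.
  apply: continuous_compact_integrable; first exact: segment_compact.
  apply: continuous_in_subspaceT => s; rewrite inE/= in_itv/= => /andP[ys _].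
  by apply: continuous_powR; exact: lt_le_trans ys.
rewrite integral_powR_itvcc// ?oppr_eq0 ?gt_eqF//.
rewrite -EFinM (powRN (y - u)); congr EFin.
by field; rewrite !gt_eqF ?powR_gt0//.
Qed.

Let kE2 (s : R) : (\int[mu]_u (k (u, s))%:E =
  ((s `^ (- al - 1) * (primitive0 y - primitive0 (y - s))) * \1_`]0, L] s)%:E)%E.
Proof.
rewrite indicE; have [|sL] := boolP (s \in `]0, L]%classic); last first.
  rewrite mulr0 integral0_eq// => u _.
  by rewrite /k/= !indicE (negbTE sL) mulr0 mul0r mulr0.
rewrite inE/= in_itv/= => /andP[s0 sL]; rewrite mulr1.
rewrite primitive0B; last by rewrite gerBl ltW.
have ig : mu.-integrable `]y - s, y] (EFin \o w).
  by apply: (@integrable_continuous_itv _ (y - s) y); exact: subset_itv_oc_cc.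
transitivity (\int[mu]_(u in `](y - s)%R, y[) ((s `^ (- al - 1))%:E * (w u)%:E))%E.
  rewrite [RHS]integral_mkcond; apply: eq_integral => u _.
  rewrite patchE /k/= !indicE !mem_setE !in_itv/= s0 sL/= ltrBlDr andbT mulr1.
  rewrite (mulrC (w u)).
  have [uy|uy] := ltP u y; last by rewrite !(andbF, mul0r, mulr0).
  have [yus|yus] := ltP y (u + s); last by rewrite !mulr0.
  have [u0|u0] := leP 0 u; first by rewrite !mulr1.
  by rewrite w0 ?ltW// !(mulr0, mul0r) mule0.
rewrite integral_itv_bndo_bndc; last first.
  apply: emeasurable_funM => //; apply/measurable_EFinP/measurable_funTS.
  exact: continuous_measurable_fun.
rewrite integralZl// EFinM /Rintegral fineK//.
exact: integrable_fin_num.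
Qed.

Let A0 : 0 <= A.
Proof. by apply: le_trans (wA (lexx _)). Qed.

(** For fixed [s] the kernel lives on [u] in []y - s, y]], of length [s], so the inner integral of
    its absolute value is at most [A * s ^ (- al)]. *)
Let ik : (mu \x mu)%E.-integrable setT (EFin \o k).
Proof.
apply/integrable21ltyP; first exact: mk.
apply: (@le_lt_trans _ _
    (\int[mu]_(s in `]0%R, L]) (A%:E * (s `^ ((1 - al) - 1))%:E))%E); last first.
  rewrite ge0_integralZl//; last 2 first.
  - by apply/measurable_EFinP; apply: measurable_funTS; exact: measurable_powR.
  - by move=> s _; rewrite lee_fin powR_ge0.
  by rewrite integral_powR_itvoc ?subr_gt0// -EFinM ltry.
rewrite [leRHS]integral_mkcond; apply: ge0_le_integral => //.
- by move=> s _; exact: integral_ge0.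
- apply: (measurable_fun_fubini_tonelli_G (m1 := mu) (abse \o (EFin \o k))) => //.
    exact: measurableT_comp.
  by move=> x; exact: abse_ge0.
- apply: (measurable_restrictT _ _).1 => //.
  apply: emeasurable_funM => //; apply/measurable_EFinP/measurable_funTS.
  exact: measurable_powR.
move=> s _; rewrite patchE; case: ifPn => [|sL]; last first.
  rewrite integral0_eq// => u _.
  by rewrite /k/= !indicE (negbTE sL) mulr0 mul0r mulr0 normr0.
rewrite inE/= in_itv/= => /andP[s0 sL].
apply: (@le_trans _ _ (\int[mu]_(u in `](y - s)%R, y]) (A * s `^ (- al - 1))%:E)%E).
  rewrite [leRHS]integral_mkcond; apply: ge0_le_integral => //.
  - have mks : measurable_fun [set: R] (fun u => (k (u, s))%:E).
      exact: (measurableT_comp mk (pair2_measurable s)).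
    exact: (measurableT_comp (@abse_measurable R setT) mks).
  - by apply: (measurable_restrictT _ _).1 => //.
  move=> u _; rewrite patchE mem_setE in_itv/= ltrBlDr /k/= !indicE !mem_setE !in_itv/=.
  rewrite s0 sL/= mulr1 andbT.
  have [yus|yus] := ltP y (u + s); last by rewrite !mulr0 normr0.
  have [uy|uy] := ltP u y; last first.
    rewrite andbF mul0r mulr0 normr0; case: ifP => //.
    by rewrite lee_fin mulr_ge0// powR_ge0.
  rewrite (ltW uy)/= lee_fin mulr1 andbT.
  rewrite normrM; case: (leP 0 u) => _; rewrite ?normr1 ?normr0 ?mulr1 ?mulr0.
    rewrite normrM (ger0_norm (powR_ge0 _ _)).
    by rewrite ler_wpM2r ?powR_ge0// wA// ltW.
  by rewrite mulr_ge0// powR_ge0.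
rewrite integral_cst//= lebesgue_measure_itv/= lte_fin ltrBlDr ltrDl s0.
rewrite -EFinB -!EFinM lee_fin subKr -mulrA ler_wpM2l//.
have -> : 1 - al - 1 = (- al - 1) + 1 :> R by ring.
rewrite (@powRD _ s (- al - 1) 1); first by rewrite powRr1// ltW.
by rewrite (gt_eqF s0) implybT.
Qed.

(** By Fubini the first marginal of [k] is integrable; up to the factor [al] it differs from the
    claimed integrand by a multiple of the continuous path [w]. *)
Lemma integrable_frac_kernel :
  mu.-integrable `[0, y[ (EFin \o (fun u => w u / (y - u) `^ al)).
Proof.
have h : mu.-integrable [set: R] (fun u : R =>
    (al^-1 * (w u / (y - u) `^ al - L `^ (- al) * w u) * \1_`[0, y[ u)%:E).
  have := integrable_fubini_F ik; rewrite /fubini_F.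
  by under eq_fun do rewrite kE1.
have iw : mu.-integrable `[0, y[ (EFin \o w).
  by apply: (@integrable_continuous_itv _ 0 y); exact: subset_itv_co_cc.
have h1 : mu.-integrable `[0, y[ (EFin \o
    (fun u => al^-1 * (w u / (y - u) `^ al - L `^ (- al) * w u))).
  have : mu.-integrable `[0, y[ (fun u : R =>
      (al^-1 * (w u / (y - u) `^ al - L `^ (- al) * w u) * \1_`[0, y[ u)%:E).
    by apply: integrableS h.
  apply: eq_integrable => // u uy.
  by rewrite indicE uy mulr1.
have : mu.-integrable `[0, y[ (fun u =>
    (al%:E * (al^-1 * (w u / (y - u) `^ al - L `^ (- al) * w u))%:E
     + (L `^ (- al))%:E * (w u)%:E)%E).
  by apply: integrableD => //; apply: integrableZl.
apply: eq_integrable => // u _ /=.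
by rewrite -!EFinM -EFinD mulrA mulfV ?gt_eqF// mul1r subrK.
Qed.

(** The two iterated integrals of [k] agree. On the left the singularity moves with [y]; on the
    right the range is fixed and [y] enters only through the differentiable primitive, so that one
    can differentiate under the integral. *)
Lemma frac_integralE :
  (\int[mu]_(u in `[0%R, y]) (w u / (y - u) `^ al))%R =
  L `^ (- al) * primitive0 y + al *
  (\int[mu]_(s in `]0%R, L]) (s `^ (- al - 1) * (primitive0 y - primitive0 (y - s))))%R.
Proof.
have ih := integrable_frac_kernel.
have iw : mu.-integrable `[0, y[ (EFin \o w).
  by apply: (@integrable_continuous_itv _ 0 y); exact: subset_itv_co_cc.
have indE (D : set R) (f : R -> R) :
    (\int[mu]_u (f u * \1_D u)%:E = \int[mu]_(u in D) (f u)%:E)%E.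
  rewrite [RHS]integral_mkcond; apply: eq_integral => u _.
  by rewrite patchE indicE; case: ifP; rewrite ?mulr1 ?mulr0.
have := Fubini ik.
under eq_integral do rewrite kE1.
under [in X in _ = X -> _]eq_integral do rewrite kE2.
rewrite (indE _ (fun u => al^-1 * (w u / (y - u) `^ al - L `^ (- al) * w u))).
rewrite (indE _ (fun s => s `^ (- al - 1) * (primitive0 y - primitive0 (y - s)))).
move=> /(congr1 fine); rewrite -!/(Rintegral _ _ _).
have iZ : mu.-integrable `[0, y[ (EFin \o (fun u => L `^ (- al) * w u)).
  have : mu.-integrable `[0, y[ (fun u => (L `^ (- al))%:E * (w u)%:E)%E.
    by apply: integrableZl.
  by apply: eq_integrable.
rewrite RintegralZl//; last first.
  have : mu.-integrable `[0, y[ (fun u => (w u / (y - u) `^ al)%:E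
      - (L `^ (- al) * w u)%:E)%E by apply: integrableB.
  by apply: eq_integrable.
rewrite RintegralB// RintegralZl// => <-.
rewrite mulrA mulfV ?gt_eqF// mul1r -Rintegral_itv_bndo_bndc//.
by rewrite /primitive0 -(Rintegral_itv_bndo_bndc iw) addrC subrK.
Qed.
End representation.
End fractional_integral.

(** * Differentiation under the integral sign *)

Section fractional_derivative.
Context {R : realType}.
Local Notation mu := (@lebesgue_measure R).
Variables (w : R -> R) (al la L C : R).
Hypothesis cw : continuous w.
Hypothesis w0 : forall u, u <= 0 -> w u = 0.
Hypothesis al0 : 0 < al.
Hypothesis al1 : al < 1.
Hypothesis alla : al < la.
Hypothesis L0 : 0 < L.
Hypothesis holder_w :
  forall y s, y <= L -> 0 < s -> s <= L -> `|w y - w (y - s)| <= C * s `^ la.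

(** The Marchaud derivative without its Gamma factor, for [y <= L]. For [s > L] one has
    [w (y - s) = 0], and [al] times the integral of [s ^ (- al - 1)] over [s > L] is [L ^ (- al)],
    whence the first term. *)
Definition marchaud (y : R) : R := L `^ (- al) * w y +
  al * (\int[mu]_(s in `]0%R, L]) (s `^ (- al - 1) * (w y - w (y - s))))%R.

(** Compare with the point [u - L <= 0], where [w] vanishes. *)
Lemma holder_bound u : u <= L -> `|w u| <= C * L `^ la.
Proof.
move=> uL; have := holder_w uL L0 (lexx L).
by rewrite (w0 (u := u - L)) ?subr_le0// subr0.
Qed.

Let f (y s : R) := s `^ (- al - 1) * (primitive0 w y - primitive0 w (y - s)).
Let g (y s : R) := s `^ (- al - 1) * (w y - w (y - s)).

Let mB : measurable (`]0, L]%classic : set (measurableTypeR R)).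
Proof. exact: measurable_itv. Qed.

Let is_derive_f (y s : R) : is_derive y 1 (f ^~ s) (g y s).
Proof.
rewrite /f /g.
have h1 := is_derive_primitive0 cw w0 y.
have h2 : is_derive y 1 (fun y => primitive0 w (y - s)) (w (y - s)).
  have h3 : is_derive y 1 (fun y : R => y - s) 1.
    exact: (is_derive_shift y 1 (- s)).
  by have := @is_derive1_comp R _ (fun y : R => y - s) y _ _ (is_derive_primitive0 cw w0 (y - s)) h3; rewrite mulr1.
exact: (is_deriveZ (s `^ (- al - 1)) (is_deriveB h1 h2)).
Qed.

Let G (s : R) := C * s `^ ((la - al) - 1).

Let C0 : 0 <= C.
Proof.
have := holder_bound (lexx L); rewrite -(pmulr_lge0 _ (powR_gt0 la L0)).
by apply: le_trans.
Qed.

Let g_ub (y s : R) : y \in `]-1, L[ -> s \in `]0, L] -> `|g y s| <= G s.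
Proof.
rewrite !in_itv/= => /andP[_ yL] /andP[s0 sL].
rewrite /g /G normrM ger0_norm ?powR_ge0//.
have -> : la - al - 1 = la + (- al - 1) by ring.
rewrite (@powRD _ s la); last by rewrite (gt_eqF s0) implybT.
rewrite [leRHS]mulrA [leRHS]mulrC ler_wpM2l ?powR_ge0//.
by apply: holder_w => //; exact: ltW.
Qed.

Let intG : mu.-integrable `]0, L] (EFin \o G).
Proof.
have : mu.-integrable `]0, L] (fun s => C%:E * (s `^ ((la - al) - 1))%:E)%E.
  apply: integrableZl => //; apply: integrable_powR_itvoc => //.
  by rewrite subr_gt0.
exact: eq_integrable.
Qed.

Let mg (y : R) : measurable_fun (`]0, L] : set R) (g y).
Proof.
apply: measurable_funM.
  by apply: measurable_funTS; exact: measurable_powR.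
apply: measurable_funTS; apply: measurable_funB => //.
apply: continuous_measurable_fun => s.
apply: (@continuous_comp _ _ _ (fun s => y - s) w); last exact: cw.
by apply: cvgB; [exact: cvg_cst|exact: cvg_id].
Qed.

Let intg (y : R) : y \in `]-1, L[ -> mu.-integrable `]0, L] (EFin \o g y).
Proof.
move=> yL; apply: le_integrable intG => //; first by apply/measurable_EFinP; exact: mg.
move=> s /= sL; rewrite lee_fin; exact: le_trans (g_ub yL sL) (ler_norm _).
Qed.

(** The Hölder bound dominates the integrand by [C * s ^ (la - al - 1)], uniformly in [y]; this is
    integrable since [al < la]. *)
Lemma continuous_marchaud : {in `]-1, L[, continuous marchaud}.
Proof.
move=> y yL; rewrite /marchaud.
apply: cvgD; first by apply: cvgM; [exact: cvg_cst|exact: cw].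
apply: cvgM; first exact: cvg_cst.
have cg (s : R) : `]0, L]%classic s -> {in `]-1, L[%classic, continuous (g ^~ s)}.
  move=> sL x xL; rewrite /g.
  apply: cvgM; first exact: cvg_cst.
  apply: cvgB; first exact: cw.
  apply: (@continuous_comp _ _ _ (fun x => x - s) w); last exact: cw.
  by apply: cvgB; [exact: cvg_id|exact: cvg_cst].
have gG (x : R) : `]-1, L[%classic x ->
    {ae mu, forall s, `]0, L]%classic s -> `|g x s| <= G s}.
  by move=> xL; apply/aeW => s sL; exact: g_ub.
have intg' (x : R) : `]-1, L[%classic x -> mu.-integrable `]0, L] (EFin \o g x).
  by move=> xL; exact: intg.
have yL' : y \in `]-1, L[%classic by rewrite inE.
exact: (continuity_under_integral mB intg' (aeW mu cg) intG gG yL').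
Qed.

(** Termwise derivative of [frac_integralE]. The interval reaches below 0 so that the derivative at
    0 is two-sided, as [derive1] requires. *)
Lemma is_derive_frac_integral (y : R) : y \in `]-1, L[ ->
  is_derive y 1 (fun y => \int[mu]_(u in `[0, y]) (w u / (y - u) `^ al))%R
    (marchaud y).
Proof.
move=> yL.
have intf (x : R) : `]-1, L[%classic x -> mu.-integrable `]0, L] (EFin \o f x).
  rewrite /= in_itv/= => /andP[_ xL].
  apply: (integrable_primitive0_increment cw w0 al1 L0 (A := C * L `^ la)).
  by move=> u ux; apply: holder_bound; rewrite (le_trans ux)// ltW.
have d1f (x s : R) : partial1of2 f x s = g x s.
  by rewrite partial1of2E; have [_ ->] := is_derive_f x s.
have G0 (s : R) : 0 <= G s by rewrite mulr_ge0 ?powR_ge0.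
have yL' : `]-1, L[%classic y by [].
have df (x s : R) : `]-1, L[%classic x -> `]0, L]%classic s -> derivable (f ^~ s) x 1.
  by move=> _ _; have [] := is_derive_f x s.
have Gub (x s : R) : `]-1, L[%classic x -> `]0, L]%classic s ->
    `|partial1of2 f x s| <= G s.
  by move=> xL sL; rewrite d1f; exact: g_ub.
have dF := derivable_under_integral mB yL' intf df G0 intG Gub.
have dFE := differentiation_under_integral mB yL' intf df G0 intG Gub.
have hF : is_derive y 1 (fun x => L `^ (- al) * primitive0 w x +
    al * (\int[mu]_(s in `]0%R, L]) f x s)%R) (marchaud y).
  apply: (@is_deriveD _ _ _ (L `^ (- al) \*: primitive0 w)
    (al \*: (fun x => \int[mu]_(s in `]0%R, L]) f x s)%R)).
    exact: is_deriveZ (is_derive_primitive0 cw w0 y).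
  apply: is_deriveZ; apply: DeriveDef => //.
  by rewrite -derive1E dFE; apply: eq_Rintegral => s _; exact: d1f.
apply: near_eq_is_derive hF.
near=> x.
have xL : x \in `]-1, L[ by near: x; exact: near_in_itvoo.
(* [frac_integralE] holds for positive arguments; at [x <= 0] both sides vanish. *)
have [x0|x0] := ltP 0 x; last first.
  have -> : (\int[mu]_(s in `]0%R, L]) f x s = 0)%R.
    rewrite /Rintegral integral0_eq// => s; rewrite /= in_itv/= => /andP[s0 _].
    rewrite /f !primitive0_le0// ?subrr ?mulr0//.
    by rewrite lerBlDr add0r (le_trans x0)// ltW.
  rewrite primitive0_le0// !mulr0 addr0 /Rintegral integral0_eq// => s.
  by rewrite /= in_itv/= => /andP[_ sx]; rewrite w0 ?mul0r// (le_trans sx).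
have xL' : x < L by move: xL; rewrite in_itv/= => /andP[].
rewrite (@frac_integralE _ w cw w0 al L x (C * L `^ la))// ?(ltW xL')//.
by move=> u ux; apply: holder_bound; rewrite (le_trans ux)// ltW.
Unshelve. all: by end_near. Qed.

End fractional_derivative.

(** In the representation with [L = y] the two terms are at most [A * y ^ (1 - al)] and
    [al / (1 - al)] times that; [1 + al / (1 - al) = 1 / (1 - al)]. *)
Lemma frac_integral_bound {R : realType} (w : R -> R) (al y A : R) :
  continuous w -> (forall u, u <= 0 -> w u = 0) ->
  0 < al -> al < 1 -> 0 < y -> (forall u, u <= y -> `|w u| <= A) ->
  `|\int[lebesgue_measure]_(u in `[0, y]) (w u / (y - u) `^ al)|%R
  <= A * y `^ (1 - al) / (1 - al).
Proof.
move=> cw w0 al0 al1 y0 wA.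
have A0 : 0 <= A by apply: le_trans (wA _ (lexx y)).
rewrite (frac_integralE cw w0 al0 al1 y0 (lexx y) wA).
have P1 : `|primitive0 w y| <= A * y.
  have := le_primitive0B cw w0 wA (ltW y0).
  by rewrite subrr (@primitive0_le0 _ _ w0 0)// subr0.
have ii := integrable_primitive0_increment cw w0 al1 y0 wA.
have sE (s : R) : 0 < s -> s `^ (1 - al - 1) = s `^ (- al - 1) * s.
  move=> s0; have -> : 1 - al - 1 = (- al - 1) + 1 :> R by ring.
  rewrite (@powRD _ s (- al - 1) 1); first by rewrite powRr1// ltW.
  by rewrite (gt_eqF s0) implybT.
have I1 : `|(\int[lebesgue_measure]_(s in `]0%R, y]) (s `^ (- al - 1) *
    (primitive0 w y - primitive0 w (y - s))))%R| <= A * (y `^ (1 - al) / (1 - al)).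
  apply: le_trans (le_normr_Rintegral _ ii) _ => //.
  have ip := integrable_powR_itvoc (p := 1 - al) (b := y).
  rewrite subr_gt0 in ip; have {}ip := ip al1 y0.
  have -> : A * (y `^ (1 - al) / (1 - al)) =
      (\int[lebesgue_measure]_(s in `]0%R, y]) (A * s `^ (1 - al - 1)))%R.
    by rewrite RintegralZl// /Rintegral integral_powR_itvoc ?subr_gt0.
  apply: le_Rintegral => //.
  - by move: ii => /integrable_norm.
  - have : lebesgue_measure.-integrable `]0, y]
      (fun s => A%:E * (s `^ (1 - al - 1))%:E)%E by apply: integrableZl.
    exact: eq_integrable.
  move=> s /=; rewrite in_itv/= => /andP[s0 sy].
  rewrite normrM ger0_norm ?powR_ge0// sE//.
  by rewrite [leRHS]mulrCA ler_wpM2l ?powR_ge0// le_primitive0B// ltW.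
apply: le_trans (ler_normD _ _) _.
rewrite !normrM (ger0_norm (powR_ge0 _ _)) (gtr0_norm al0).
apply: (@le_trans _ _ (y `^ (- al) * (A * y) + al * (A * (y `^ (1 - al) / (1 - al))))).
  by apply: lerD; rewrite ler_wpM2l ?powR_ge0// ltW.
have -> : y `^ (- al) * (A * y) = A * y `^ (1 - al).
  have -> : 1 - al = (- al) + 1 by ring.
  rewrite (@powRD _ y (- al) 1); first by rewrite powRr1 ?(ltW y0)// mulrCA.
  by rewrite (gt_eqF y0) implybT.
rewrite le_eqVlt; apply/orP; left; apply/eqP.
by field; rewrite subr_eq0 gt_eqF.
Qed.

(** * The initial value problem along one path *)

Section continuity_tools.
Context {R : realType}.

Lemma within_continuous_ballP (A : set R) (f : R -> R) :
  {within A, continuous f} <->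
  (forall x, A x -> forall e, 0 < e -> exists2 r, 0 < r &
    forall z, A z -> `|z - x| < r -> `|f z - f x| < e).
Proof.
split.
  move=> /subspace_continuousP cf x Ax e e0.
  have /cvgrPdist_lt/(_ _ e0) := cf x Ax.
  rewrite near_withinE => -[r /= r0 rP]; exists r => // z Az zx.
  by rewrite distrC; apply: rP => //=; rewrite distrC.
move=> cf; apply/subspace_continuousP => x Ax; apply/cvgrPdist_lt => e e0.
have [r r0 rP] := cf x Ax e e0.
rewrite near_withinE; exists r => //= z; rewrite /= distrC => zx Az.
by rewrite distrC; exact: rP.
Qed.

Lemma uniform_continuous_itv (a b e : R) (f : R -> R) :
  {within `[a, b], continuous f} -> 0 < e ->
  exists2 r, 0 < r & forall z z', z \in `[a, b] -> z' \in `[a, b] ->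
    `|z' - z| < r -> `|f z' - f z| < e.
Proof.
move=> /within_continuous_ballP cf e0.
pose P (r z : R) := z \in `[a, b] -> forall z', z' \in `[a, b] ->
  `|z' - z| < r -> `|f z' - f z| < e.
have /compact_near_coveringP : compact `[a, b]%classic by exact: segment_compact.
move=> /(_ R (0 : R)^'+ P _) [|r /= r0 rP].
  move=> z zab; have [r r0 rP] := cf z zab (e / 2) (divr_gt0 e0 (ltr0Sn _ 1)).
  near=> x i => xab z' z'ab z'x.
  have ir : i <= r / 2 by near: i; apply: nbhs_right_le; rewrite divr_gt0.
  have xz : `|x - z| < r / 2.
    near: x; exists (r / 2); first by rewrite /= divr_gt0.
    by move=> x /=; rewrite distrC.
  have r2 : r / 2 < r by rewrite gtr_pMr// invf_lt1// ltr1n.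
  have -> : f z' - f x = (f z' - f z) + (f z - f x) by rewrite addrA subrK.
  rewrite (le_lt_trans (ler_normD _ _))// (splitr e) ltrD//.
    apply: rP => //; have -> : z' - z = (z' - x) + (x - z) by rewrite addrA subrK.
    by rewrite (le_lt_trans (ler_normD _ _))// (splitr r) ltrD// (lt_le_trans z'x).
  by rewrite distrC; apply: rP => //; exact: lt_trans r2.
exists (r / 2); first by rewrite divr_gt0.
move=> z z' zab z'ab zz'; apply: (rP (r / 2)) => //=.
- by rewrite sub0r normrN gtr0_norm ?divr_gt0// gtr_pMr// invf_lt1// ltr1n.
- by rewrite divr_gt0.
Unshelve. all: by end_near. Qed.

Lemma first_hitting (f : R -> R) (a b c : R) : a <= b ->
  {within `[a, b], continuous f} -> f a < c -> c <= f b ->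
  exists s, [/\ a < s, s <= b, f s = c & forall u, a <= u -> u < s -> f u < c].
Proof.
move=> ab /within_continuous_ballP cf fac cfb.
pose S := [set u | u \in `[a, b] /\ c <= f u].
have Sb : S b by split => //; rewrite in_itv/= ab lexx.
have hS : has_inf S.
  by split; [exists b|exists a => u [] /=; rewrite in_itv/= => /andP[]].
pose s := inf S.
have sb : s <= b by apply: ge_inf => //; exact: (proj2 hS).
have as_ : a <= s.
  apply: lb_le_inf; first by exists b.
  by move=> u []; rewrite in_itv/= => /andP[].
have sab : s \in `[a, b] by rewrite in_itv/= as_ sb.
have ltsc u : a <= u -> u < s -> f u < c.
  move=> au us; rewrite ltNge; apply/negP => cu.
  suff : s <= u by rewrite leNgt us.
  apply: ge_inf; first exact: (proj2 hS).
  by split => //; rewrite in_itv/= au (le_trans (ltW us)).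
have cfs : c <= f s.
  rewrite leNgt; apply/negP => fsc.
  have [r r0 rP] : exists2 r, 0 < r & forall z, z \in `[a, b] -> `|z - s| < r ->
      `|f z - f s| < c - f s by apply: cf => //; rewrite subr_gt0.
  have [u [uab cu] us] := inf_adherent r0 hS.
  have su : s <= u by apply: ge_inf => //; exact: (proj2 hS).
  have : `|f u - f s| < c - f s.
    by apply: rP => //; rewrite ger0_norm ?subr_ge0// ltrBlDr addrC.
  by rewrite real_ltr_norml ?num_real// => /andP[_]; rewrite ltrD2r ltNge cu.
have lt_as : a < s.
  by rewrite lt_neqAle as_ andbT; apply/eqP => as'; move: cfs; rewrite -as' leNgt fac.
exists s; split => //; apply/eqP; rewrite eq_le cfs andbT leNgt; apply/negP => cfs'.
have [r r0 rP] : exists2 r, 0 < r & forall z, z \in `[a, b] -> `|z - s| < r ->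
    `|f z - f s| < f s - c by apply: cf => //; rewrite subr_gt0.
pose u := Num.max a (s - r / 2).
have us : u < s by rewrite gt_max lt_as/= gtrBl divr_gt0.
have au : a <= u by rewrite le_max lexx.
have : `|f u - f s| < f s - c.
  apply: rP; first by rewrite in_itv/= au (le_trans (ltW us)).
  rewrite distrC gtr0_norm ?subr_gt0// ltrBlDr -ltrBlDl lt_max; apply/orP; right.
  by rewrite ltrD2l ltrN2 gtr_pMr// invf_lt1// ltr1n.
rewrite distrC real_ltr_norml ?num_real// => /andP[_]; rewrite ltrD2l ltrN2.
by rewrite ltNge (ltW (ltsc _ au us)).
Qed.

(** The increment is a continuous positive function of [u] and attains its minimum on the compact
    interval [[0, B]]. *)
Lemma increment_lower_bound (f : R -> R) (B e : R) : 0 <= B -> 0 < e ->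
  {within `[0, +oo[%classic, continuous f} ->
  (forall s t, 0 <= s -> s < t -> f s < f t) ->
  exists2 eta, 0 < eta & forall u, 0 <= u -> u <= B -> eta <= f (u + e) - f u.
Proof.
move=> B0 e0 /within_continuous_ballP cf incf.
have [|c cB cP] := @EVT_min R (fun u => f (u + e) - f u) 0 B B0.
  apply/within_continuous_ballP => x; rewrite /= in_itv/= => /andP[x0 xB] z z0.
  have z20 : 0 < z / 2 by rewrite divr_gt0.
  have xI : `[0, +oo[%classic x by rewrite /= in_itv/= x0.
  have xeI : `[0, +oo[%classic (x + e) by rewrite /= in_itv/= andbT addr_ge0// ltW.
  have [r1 r10 r1P] := cf x xI _ z20.
  have [r2 r20 r2P] := cf (x + e) xeI _ z20.
  exists (Num.min r1 r2); first by rewrite lt_min r10.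
  move=> u; rewrite /= in_itv/= => /andP[u0 uB]; rewrite lt_min => /andP[ur1 ur2].
  have -> : f (u + e) - f u - (f (x + e) - f x) =
    (f (u + e) - f (x + e)) + (- (f u - f x)) by ring.
  rewrite (le_lt_trans (ler_normD _ _))// (splitr z) ltrD//.
    apply: r2P; first by rewrite /= in_itv/= andbT addr_ge0// ltW.
    by rewrite opprD addrACA subrr addr0.
  by rewrite normrN; apply: r1P => //; rewrite /= in_itv/= andbT.
exists (f (c + e) - f c).
  move: cB; rewrite in_itv/= => /andP[c0 _].
  by rewrite subr_gt0 incf// ltrDl.
by move=> u u0 uB; apply: cP; rewrite in_itv/= u0.
Qed.

End continuity_tools.

(** * Derivatives on the half-line *)

Section one_sided_derivative.
Context {R : realType}.
Implicit Types (x : R -> R) (t l : R).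

Lemma has_derivative_on_RplusP x t l : has_derivative_on_Rplus x t l ->
  forall e, 0 < e -> exists2 r, 0 < r & forall s, 0 <= s -> s != t ->
    `|s - t| < r -> `|l - (x s - x t) / (s - t)| < e.
Proof.
move=> /cvgrPdist_lt h e e0; have := h e e0.
rewrite near_withinE => -[r /= r0 rP]; exists r => // s s0 st str.
by apply: rP => //=; rewrite distrC.
Qed.

Lemma has_derivative_on_Rplus_ge0 x t l : has_derivative_on_Rplus x t l ->
  (forall r, 0 < r -> exists s, [/\ 0 <= s, s != t, `|s - t| < r &
    0 <= (x s - x t) / (s - t)]) -> 0 <= l.
Proof.
move=> /has_derivative_on_RplusP h hq; rewrite leNgt; apply/negP => l0.
have [|r r0 rP] := h (- l); first by rewrite oppr_gt0.
have [s [s0 st str sq]] := hq _ r0.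
have := rP s s0 st str; rewrite distrC gtr0_norm; last first.
  by rewrite subr_gt0 (lt_le_trans l0).
by rewrite ltrBlDr addNr ltNge sq.
Qed.

Lemma has_derivative_on_RplusN x t l : has_derivative_on_Rplus x t l ->
  has_derivative_on_Rplus (fun s => - x s) t (- l).
Proof.
rewrite /has_derivative_on_Rplus => h.
rewrite (_ : (fun s => _) = (fun s => - ((x s - x t) / (s - t)))).
  exact: cvgN.
by apply/funext => s; rewrite -mulNr opprB opprK addrC.
Qed.

Lemma has_derivative_on_Rplus_le0 x t l : has_derivative_on_Rplus x t l ->
  (forall r, 0 < r -> exists s, [/\ 0 <= s, s != t, `|s - t| < r &
    (x s - x t) / (s - t) <= 0]) -> l <= 0.
Proof.
move=> /has_derivative_on_RplusN h hq; rewrite -oppr_ge0.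
apply: has_derivative_on_Rplus_ge0 h _ => r r0.
have [s [s0 st str sq]] := hq _ r0; exists s; split => //.
by rewrite opprK [- x s + _]addrC -[x t - _]opprB mulNr oppr_ge0.
Qed.

Lemma is_derive_of_Rplus x t l : 0 < t -> has_derivative_on_Rplus x t l ->
  is_derive t 1 x l.
Proof.
move=> t0 /has_derivative_on_RplusP h.
have cx : h^-1 *: ((x \o shift t) (h *: 1) - x t) @[h --> 0^'] --> l.
  apply/cvgrPdist_lt => e e0; have [r r0 rP] := h e e0.
  exists (Num.min r t); first by rewrite /= lt_min r0.
  move=> k /=; rewrite sub0r normrN lt_min => /andP[kr kt] k0.
  have kt0 : 0 <= k + t.
    move: kt; rewrite real_ltr_norml ?num_real// => /andP[kt _].
    by rewrite -lerBlDr sub0r ltW.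
  have := rP (k + t) kt0; rewrite addrK -subr_eq0 addrK => /(_ k0 kr).
  by rewrite /= [k *: 1]mulr1 mulrC.
apply: DeriveDef; first by apply/cvg_ex; exists l.
by apply/cvg_lim.
Qed.

Lemma continuous_of_Rplus x t l : 0 <= t -> has_derivative_on_Rplus x t l ->
  forall e, 0 < e -> exists2 r, 0 < r & forall s, 0 <= s -> `|s - t| < r ->
    `|x s - x t| < e.
Proof.
move=> t0 /has_derivative_on_RplusP h e e0.
have [r r0 rP] := h 1 ltr01.
have l1 : 0 < `|l| + 1 by rewrite ltr_wpDl.
exists (Num.min r (e / (`|l| + 1))); first by rewrite lt_min r0 divr_gt0.
move=> s s0; rewrite lt_min => /andP[sr se].
have [->|st] := eqVneq s t; first by rewrite subrr normr0.
have := rP s s0 st sr; have st0 : s - t != 0 by rewrite subr_eq0.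
set q := _ / _ => ql.
have -> : x s - x t = q * (s - t) by rewrite /q divfK.
have q1 : `|q| <= `|l| + 1.
  have -> : q = l - (l - q) by rewrite subKr.
  by rewrite (le_trans (ler_normB _ _))// lerD2l ltW.
rewrite normrM (le_lt_trans (ler_wpM2r _ q1))//.
by rewrite mulrC -ltr_pdivlMr.
Qed.

End one_sided_derivative.

(** * Monotonicity of solutions *)

Section random_ode.
Context {R : realType}.
Variables (x g th : R -> R) (ka : R).
Hypothesis x0 : x 0 = 0.
Hypothesis x_ge0 : forall t, 0 <= t -> 0 <= x t.
Hypothesis dx : forall t, 0 <= t -> has_derivative_on_Rplus x t (g (x t) + ka * th t).
Hypothesis ka0 : 0 < ka.
Hypothesis th_incr : forall s t, 0 <= s -> s < t -> th s < th t.

Let dxlt s t c : 0 <= s -> s < t -> g c + ka * th s < g c + ka * th t.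
Proof. by move=> s0 st; rewrite ltrD2l ltr_pM2l// th_incr. Qed.

Lemma ode_continuous : {within `[0, +oo[%classic, continuous x}.
Proof.
apply/within_continuous_ballP => t; rewrite /= in_itv/= andbT => t0 e e0.
have [r r0 rP] := continuous_of_Rplus t0 (dx t0) e0.
by exists r => // s; rewrite in_itv/= andbT => s0; exact: rP.
Qed.

Lemma ode_continuous_itv (a b : R) : 0 <= a -> {within `[a, b], continuous x}.
Proof.
move=> a0; apply: continuous_subspaceW ode_continuous => u /=.
by rewrite !in_itv/= andbT => /andP[au _]; rewrite (le_trans a0).
Qed.

(* A level reached upwards at time [s] and downwards at a later time [t] would
   give [x' s >= 0 >= x' t], while [x' t > x' s] since [th] increases. *)
Lemma ode_nondecreasing (a b : R) : 0 <= a -> a <= b -> x a <= x b.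
Proof.
move=> a0; rewrite le_eqVlt => /predU1P[->//|ab].
rewrite leNgt; apply/negP => xba.
pose c := (x a + x b) / 2.
have cb : x b < c by rewrite /c ltr_pdivlMr// mulr_natr mulr2n ltrD2r.
have ca : c < x a by rewrite /c ltr_pdivrMr// mulr_natr mulr2n ltrD2l.
have b0 : 0 <= b by rewrite (le_trans a0)// ltW.
have c0 : x 0 < c by rewrite x0 (le_lt_trans (x_ge0 b0)).
have [s [s0 sa xs sP]] := first_hitting a0 (ode_continuous_itv (lexx 0)) c0 (ltW ca).
have cxN : {within `[a, b], continuous (fun u => - x u)}.
  by move=> u; apply: cvgN; exact: ode_continuous_itv.
have [||t [at_ tb xt tP]] := @first_hitting _ _ a b (- c) (ltW ab) cxN.
- by rewrite ltrN2.
- by rewrite lerN2 ltW.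
have xt' : x t = c by rewrite -[LHS]opprK xt opprK.
have t0 : 0 < t by apply: le_lt_trans at_.
have near_left (r m v : R) : m < v -> 0 < r -> exists u, [/\ m <= u, u < v & `|u - v| < r].
  move=> mv r0; exists (Num.max m (v - r / 2)); split.
  - by rewrite le_max lexx.
  - by rewrite gt_max mv/= gtrBl divr_gt0.
  - rewrite distrC ger0_norm; last by rewrite subr_ge0 ge_max ltW//= gerBl ltW// divr_gt0.
    rewrite ltrBlDr -ltrBlDl lt_max; apply/orP; right.
    by rewrite ltrD2l ltrN2 gtr_pMr// invf_lt1// ltr1n.
have ds : 0 <= g (x s) + ka * th s.
  apply: has_derivative_on_Rplus_ge0 (dx (ltW s0)) _ => r r0.
  have [u [u0 us ur]] := near_left r _ _ s0 r0.
  exists u; split => //; first by rewrite lt_eqF.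
  rewrite -mulrNN -invrN mulr_ge0//; first by rewrite oppr_ge0 subr_le0 xs ltW// sP.
  by rewrite invr_ge0 opprB subr_ge0 ltW.
have dt : g (x t) + ka * th t <= 0.
  apply: has_derivative_on_Rplus_le0 (dx (ltW t0)) _ => r r0.
  have [u [au ut ur]] := near_left r _ _ at_ r0.
  exists u; split => //; [exact: le_trans au|by rewrite lt_eqF|].
  apply: mulr_ge0_le0; last by rewrite invr_le0 subr_le0 ltW.
  by rewrite subr_ge0 -lerN2 xt ltW// tP.
have st : s < t by exact: le_lt_trans at_.
have := dxlt c (ltW s0) st; move: ds dt; rewrite xs xt' => ds dt.
by rewrite ltNge (le_trans dt).
Qed.

Lemma ode_derive_ge0 (t : R) : 0 <= t -> 0 <= g (x t) + ka * th t.
Proof.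
move=> t0; apply: has_derivative_on_Rplus_ge0 (dx t0) _ => r r0.
exists (t + r / 2); split.
- by rewrite addr_ge0// divr_ge0// ltW.
- by rewrite gt_eqF// ltrDl divr_gt0.
- by rewrite addrC addKr gtr0_norm ?divr_gt0// gtr_pMr// invf_lt1// ltr1n.
- rewrite divr_ge0// subr_ge0; last by rewrite lerDl divr_ge0// ltW.
  by rewrite ode_nondecreasing// lerDl divr_ge0// ltW.
Qed.

(** On a flat stretch the derivative vanishes, although [g (x a) + ka * th u] increases strictly
    with [u] there: it is nonnegative at [a] and nonpositive at the midpoint. *)
Lemma ode_increasing (a b : R) : 0 <= a -> a < b -> x a < x b.
Proof.
move=> a0 ab; rewrite lt_neqAle ode_nondecreasing// ?ltW// andbT.
apply/eqP => xab.
have xc u : a <= u -> u <= b -> x u = x a.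
  move=> au ub; apply/eqP; rewrite eq_le.
  by rewrite {1}xab !ode_nondecreasing// (le_trans a0).
have d0 u : a <= u -> u < b -> g (x a) + ka * th u <= 0.
  move=> au ub; rewrite -(xc u au (ltW ub)).
  apply: has_derivative_on_Rplus_le0 (dx (le_trans a0 au)) _ => r r0.
  pose v := Num.min b (u + r / 2).
  have uv : u < v by rewrite lt_min ub ltrDl divr_gt0.
  have vb : v <= b by rewrite ge_min lexx.
  exists v; split.
  - by rewrite (le_trans a0)// (le_trans au)// ltW.
  - by rewrite gt_eqF.
  - rewrite gtr0_norm ?subr_gt0// ltrBlDl gt_min; apply/orP; right.
    by rewrite ltrD2l gtr_pMr// invf_lt1// ltr1n.
  - by rewrite !xc// ?(ltW ub)// ?subrr ?mul0r// (le_trans au)// ltW.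
have m : a < (a + b) / 2 by rewrite midf_lt.
have mb : (a + b) / 2 < b by rewrite midf_lt.
have := dxlt (x a) a0 m.
by rewrite ltNge (le_trans (d0 _ (ltW m) mb))// ode_derive_ge0.
Qed.

(** The level [y] was passed at some time [s <= t] with nonnegative derivative, and
    [th s <= th t]. *)
Lemma ode_speed_ge0 (t y : R) : 0 <= t -> 0 <= y -> y <= x t ->
  0 <= g y + ka * th t.
Proof.
move=> t0 y0 yt.
have [||s] := @IVT R x 0 t y t0; first exact: ode_continuous_itv.
  by rewrite x0 ge_min le_max y0 yt orbT.
rewrite in_itv/= => /andP[s0 st] <-.
apply: le_trans (ode_derive_ge0 s0) _; rewrite lerD2l ler_pM2l//.
by move: st; rewrite le_eqVlt => /predU1P[->//|st]; exact/ltW/th_incr.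
Qed.

Lemma ode_MVT (a b : R) : 0 <= a -> a < b -> exists2 c, a < c < b &
  x b - x a = (g (x c) + ka * th c) * (b - a).
Proof.
move=> a0 ab.
have [||c] := @MVT R x (fun c => g (x c) + ka * th c) a b ab.
- move=> c; rewrite in_itv/= => /andP[ac _].
  by apply: is_derive_of_Rplus; [exact: le_lt_trans ac|apply: dx; rewrite (le_trans a0)// ltW].
- exact: ode_continuous_itv.
by rewrite in_itv/= => cab; exists c.
Qed.

End random_ode.

(* [reach N k q]: an upper bound, through rational times, for the moments at
   which the levels [j y / N] are passed. On each cell the times satisfy a
   discrete supersolution inequality of the inverse equation, so [reach] only
   looks at [g] on [0, k y / N]. *)
Fixpoint reach {R : realType} (g th : R -> R) (ka y : R) (N k : nat) (q : rat)
    : Prop :=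
  match k with
  | 0 => 0 <= (ratr q : R)
  | k'.+1 => exists p : rat, [/\ p < q, reach g th ka y N k' p &
      forall z, k'%:R * (y / N%:R) <= z -> z <= k'.+1%:R * (y / N%:R) ->
        y / N%:R <= (ratr q - ratr p) * (g z + ka * th (ratr p))]
  end.

(** * Passage times through rational supersolutions *)

Section hitting.
Context {R : realType}.
Variables (x g th : R -> R) (ka : R).
Hypothesis x0 : x 0 = 0.
Hypothesis x_ge0 : forall t, 0 <= t -> 0 <= x t.
Hypothesis dx : forall t, 0 <= t -> has_derivative_on_Rplus x t (g (x t) + ka * th t).
Hypothesis ka0 : 0 < ka.
Hypothesis th_incr : forall s t, 0 <= s -> s < t -> th s < th t.

Let incx := ode_increasing x0 x_ge0 dx ka0 th_incr.
Let ndx := ode_nondecreasing x0 x_ge0 dx ka0 th_incr.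

(** Induction on the cells. If [x] had not left the cell by time [q], it would stay in it during
    [[p, q]]; the mean value theorem and [th p <= th c] would then give an increase of at least
    [y / N], which carries [x] across the cell. *)
Lemma reach_le (y : R) (N k : nat) (q : rat) : reach g th ka y N k q ->
  0 <= (ratr q : R) /\ k%:R * (y / N%:R) <= x (ratr q).
Proof.
elim: k q => [|k IH] q /=.
  by move=> q0; split => //; rewrite mul0r x_ge0.
move=> [p [pq /IH [p0 px] hz]].
have pq' : ratr p < ratr q :> R by rewrite ltr_rat.
have q0 : 0 <= (ratr q : R) by rewrite (le_trans p0)// ltW.
split => //; rewrite leNgt; apply/negP => xq.
have [c /andP[pc cq] xE] := ode_MVT dx p0 pq'.
have c0 : 0 <= c by rewrite (le_trans p0)// ltW.
have := hz (x c).
rewrite (le_trans px) ?ndx// ?(ltW pc)// => /(_ isT).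
rewrite (le_trans _ (ltW xq)) ?ndx// ?(ltW cq)// => /(_ isT) hc.
have : y / N%:R <= x (ratr q) - x (ratr p).
  rewrite xE; apply: le_trans hc _.
  rewrite [leRHS]mulrC ler_wpM2l ?subr_ge0 ?(ltW pq')//.
  by rewrite lerD2l ler_pM2l// ltW// th_incr.
rewrite leNgt => /negP; apply; rewrite ltrBlDr.
apply: lt_le_trans xq _; rewrite -natr1 mulrDl mul1r addrC lerD2l.
exact: px.
Qed.

Variable y : R.
Hypothesis y0 : 0 < y.
Hypothesis cg : {within `[0, y], continuous g}.
Hypothesis cth : {within `[0, +oo[%classic, continuous th}.

Lemma reach_complete (t : R) : 0 <= t -> y < x t ->
  exists N (q : rat), ratr q < t /\ reach g th ka y N.+1 N.+1 q.
Proof.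
move=> t0 yt.
have [||b] := @IVT R x 0 t y t0; first exact: (ode_continuous_itv dx).
  by rewrite x0 ge_min le_max (ltW y0) (ltW yt) orbT.
rewrite in_itv/= => /andP[b0 bt] xb.
have {}bt : b < t.
  by rewrite lt_neqAle bt andbT; apply/eqP => bt'; move: yt; rewrite -xb bt' ltxx.
(* The delays lie between [e] and [2 * e], so the last rational time is still below
   [b + 3 * e = t]. *)
pose e := (t - b) / 3.
have e0 : 0 < e by rewrite divr_gt0// subr_gt0.
have e20 : 0 < e / 2 by rewrite divr_gt0.
have [et et0 etP] := increment_lower_bound b0 e20 (ode_continuous dx) incx.
have be0 : 0 <= b + e by rewrite addr_ge0// ltW.
have [de de0 deP] := increment_lower_bound be0 e20 cth th_incr.
have kd0 : 0 < ka * de by rewrite mulr_gt0.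
have [r r0 rP] := uniform_continuous_itv cg kd0.
(* [h < et] makes each cell crossed within time [e / 2]; [h < r] makes the oscillation of [g] on a
   cell less than [ka * de]. *)
pose m := Num.min et r.
have m0 : 0 < m by rewrite lt_min et0.
pose N := Num.truncn (y / m).
pose h := y / N.+1%:R.
have h0 : 0 < h by rewrite divr_gt0.
have hm : h < m.
  by rewrite /h ltr_pdivrMr// mulrC -ltr_pdivrMr// truncnS_gt.
have [het hr] : h < et /\ h < r.
  by split; apply: lt_le_trans hm _; rewrite ge_min lexx ?orbT.
have Nh : N.+1%:R * h = y by rewrite /h mulrC divfK// pnatr_eq0.
have exs (k : nat) : exists s, (k <= N.+1)%N -> [/\ 0 <= s, s <= b & x s = k%:R * h].
  have [kN|] := leqP k N.+1; last by exists 0.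
  have [||s] := @IVT R x 0 b (k%:R * h) b0; first exact: (ode_continuous_itv dx).
    rewrite x0 ge_min le_max mulr_ge0 ?(ltW h0)//= xb -Nh ler_pM2r// ler_nat kN.
    by rewrite orbT.
  by rewrite in_itv/= => /andP[s0 sb] xs; exists s.
have /choice[s sP] := exs.
have sS k : (k < N.+1)%N -> s k < s k.+1.
  move=> kN; have [s0 sb xs] := sP k (ltnW kN); have [s0' sb' xs'] := sP k.+1 kN.
  rewrite ltNge; apply/negP => /(ndx s0'); rewrite xs xs' ler_pM2r// ler_nat.
  by rewrite ltnn.
have sSe k : (k < N.+1)%N -> s k.+1 < s k + e / 2.
  move=> kN; have [s0 sb xs] := sP k (ltnW kN); have [s0' sb' xs'] := sP k.+1 kN.
  rewrite ltNge; apply/negP => ss.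
  have se0 : 0 <= s k + e / 2 by rewrite addr_ge0// ltW.
  have := ndx se0 ss; rewrite xs' leNgt => /negP; apply.
  have := etP _ s0 sb; rewrite xs => h1.
  rewrite -natr1 mulrDl mul1r addrC -ltrBrDr; exact: lt_le_trans h1.
(* The delays are confined to consecutive disjoint windows, hence increase with [k]: [q k.+1 - q k]
   exceeds [s k.+1 - s k]. There are [N.+2] windows for the indices [0] to [N.+1]. *)
pose lo (k : nat) : R := s k + e * (1 + k%:R / N.+2%:R).
have exq (k : nat) : exists q : rat, lo k < ratr q < s k + e * (1 + k.+1%:R / N.+2%:R).
  have [|q] := @rat_in_itvoo R (lo k) (s k + e * (1 + k.+1%:R / N.+2%:R)).
    by rewrite ltrD2l ltr_pM2l// ltrD2l ltr_pM2r ?invr_gt0// ltr_nat.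
  by rewrite in_itv/= => ?; exists q.
have /choice[q qP] := exq.
have frac1 (k : nat) : (k <= N.+2)%N -> 1 + k%:R / N.+2%:R <= 2 :> R.
  move=> kN; rewrite -[leRHS]/(1 + 1) lerD2l ler_pdivrMr// mul1r ler_nat//.
exists N, (q N.+1); split.
  have /andP[_ h1] := qP N.+1; apply: lt_le_trans h1 _.
  have [s0 sb _] := sP N.+1 (leqnn _).
  apply: (@le_trans _ _ (b + e * 2)).
    by rewrite lerD// ler_pM2l// frac1.
  by rewrite /e; lra.
have loq k : lo k < ratr (q k) by have /andP[] := qP k.
have s0e k : (k <= N.+1)%N -> s k + e <= lo k.
  move=> kN; rewrite /lo lerD2l mulrDr mulr1 lerDl.
  by apply: mulr_ge0; [exact: ltW|exact: divr_ge0].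
suff H k : (k <= N.+1)%N -> reach g th ka y N.+1 k (q k) by exact: (H N.+1 (leqnn _)).
elim: k => [_|k IH kN] /=.
  have [s0 _ _] := sP 0%N isT.
  by rewrite ltW// (le_lt_trans _ (loq 0%N))// (le_trans _ (s0e 0%N isT))// addr_ge0// ltW.
exists (q k).
have [s0 sb xs] := sP k (ltnW kN); have [s0' sb' xs'] := sP k.+1 kN.
have qq : s k.+1 - s k < ratr (q k.+1) - ratr (q k).
  have /andP[_ h1] := qP k; have h2 := loq k.+1.
  by move: h1 h2; rewrite /lo; move: (e * (1 + k.+1%:R / N.+2%:R)) => E; lra.
have ss := sS k kN.
have qq0 : (ratr (q k) : R) < ratr (q k.+1).
  by rewrite -subr_gt0 (lt_trans _ qq)// subr_gt0.
split; [by rewrite -(ltr_rat R)|exact/IH/ltnW|move=> z z1 z2].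
have [c /andP[c1 c2] cE] := ode_MVT dx s0 ss.
have c0 : 0 <= c by rewrite (le_trans s0)// ltW.
have hE : h = (g (x c) + ka * th c) * (s k.+1 - s k).
  by rewrite -cE xs xs' -natr1 mulrDl mul1r addrC addKr.
have v0 : 0 <= g (x c) + ka * th c by apply: (ode_derive_ge0 x0 x_ge0 dx).
rewrite -/h {1}hE mulrC; apply: ler_pM => //; rewrite ?subr_ge0 ?(ltW ss)// ?(ltW qq)//.
(* The point [c] precedes [s k + e / 2], whereas [q k] comes after [s k + e]. *)
have thc : th c + de <= th (ratr (q k)).
  have ce : c + e / 2 < ratr (q k).
    have h1 := loq k; have h2 := s0e k (ltnW kN); have h3 := sSe k kN.
    by move: h1 h2 h3 c2; lra.
  apply: le_trans (ltW (th_incr _ ce)); last by rewrite addr_ge0// ltW.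
  rewrite -lerBrDl; apply: deP => //; move: e0 c2 sb'; lra.
have zy : z \in `[0, y].
  rewrite -/h in z1 z2; rewrite in_itv/=; apply/andP; split.
    by apply: le_trans z1; apply: mulr_ge0 => //; exact: ltW.
  by rewrite (le_trans z2)// -[leRHS]Nh ler_pM2r// ler_nat.
have xc1 : k%:R * h <= x c by rewrite -xs ndx// ltW.
have xc2 : x c <= k.+1%:R * h by rewrite -xs' ndx// ltW.
have xcy : x c \in `[0, y].
  by rewrite in_itv/= x_ge0//= (le_trans xc2)// -[leRHS]Nh ler_pM2r// ler_nat.
have : `|g (x c) - g z| < ka * de.
  apply: rP => //. apply: le_lt_trans _ hr.
  move: z1 z2 xc1 xc2; rewrite -/h -natr1 mulrDl mul1r => z1 z2 xc1 xc2.
  by rewrite ler_norml; apply/andP; split; lra.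
rewrite real_ltr_norml ?num_real// => /andP[_ gg].
have : ka * (th c + de) <= ka * th (ratr (q k)) by rewrite ler_pM2l.
by rewrite mulrDr; move: gg; lra.
Qed.

Lemma lt_hittingP (t : R) : 0 <= t ->
  y < x t <-> exists N (q : rat), ratr q < t /\ reach g th ka y N.+1 N.+1 q.
Proof.
move=> t0; split; first exact: reach_complete.
move=> [N [q [qt /reach_le [q0]]]].
rewrite mulrC divfK ?pnatr_eq0// => /le_lt_trans; apply.
exact: incx.
Qed.

End hitting.

(** * Exponential martingales of planar Brownian motion *)

Section density.
Context d (T : measurableType d) (R : realType).
Variables (mu nu : {measure set T -> \bar R}) (rho : T -> R).
Hypothesis mrho : measurable_fun setT rho.
Hypothesis rho0 : forall x, 0 <= rho x.
Hypothesis nuE : forall A, measurable A ->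
  nu A = (\int[mu]_(x in A) (rho x)%:E)%E.

Import HBNNSimple.

Let integral_density_nnsfun (f : {nnsfun T >-> R}) :
  (\int[nu]_x (f x)%:E = \int[mu]_x ((f x)%:E * (rho x)%:E))%E.
Proof.
under [LHS]eq_integral do rewrite fimfunE -fsumEFin//.
rewrite [LHS]ge0_integral_fsum//; last 2 first.
  - by move=> r; exact/measurable_EFinP/measurableT_comp.
  - by move=> n x _; rewrite EFinM nnfun_muleindic_ge0.
under [RHS]eq_integral.
  move=> x xD; rewrite fimfunE -fsumEFin// ge0_mule_fsuml; last first.
    by move=> r; rewrite EFinM nnfun_muleindic_ge0.
  over.
rewrite [RHS]ge0_integral_fsum//; last 2 first.
  - move=> r; apply: emeasurable_funM; last exact/measurable_EFinP.
    by apply/measurable_EFinP; apply/measurableT_comp.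
  - move=> n x _; rewrite mule_ge0//; last by rewrite lee_fin.
    by rewrite EFinM nnfun_muleindic_ge0.
apply: eq_fsbigr => r; rewrite inE => -[t _ ftr].
have r0 : 0 <= r by rewrite -ftr.
have mA : measurable (f @^-1` [set r]) by rewrite -[X in measurable X]setTI; exact: measurable_funP.
transitivity (r%:E * nu (f @^-1` [set r]))%E.
  under eq_integral do rewrite EFinM.
  rewrite ge0_integralZl//; last by apply/measurable_EFinP; exact: measurable_indic.
  by rewrite integral_indic// setIT.
rewrite nuE// -ge0_integralZl//; last 2 first.
- by apply/measurable_EFinP; exact: measurable_funTS.
- by move=> x _; rewrite lee_fin.
rewrite integral_mkcond; apply: eq_integral => x _.
rewrite patchE indicE; case: ifP => _; first by rewrite mulr1.
by rewrite mulr0 mul0e.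
Qed.

(** Needed for the normal law, whose density is given on events; simple functions and monotone
    convergence carry it over to integrands. *)
Lemma ge0_integral_density (f : T -> \bar R) : measurable_fun setT f ->
  (forall x, 0 <= f x)%E ->
  (\int[nu]_x f x = \int[mu]_x (f x * (rho x)%:E))%E.
Proof.
move=> mf f0.
pose f_ := nnsfun_approx measurableT mf.
transitivity (lim (\int[nu]_x (f_ n x)%:E @[n --> \oo])%E).
  rewrite -monotone_convergence//=.
  - apply: eq_integral => ? /[!inE] xD; apply/esym/cvg_lim => //=.
    exact: cvg_nnsfun_approx.
  - by move=> n; exact/measurable_EFinP/measurable_funTS.
  - by move=> n ? _; rewrite lee_fin.
  - by move=> ? _ ? ? mn; rewrite lee_fin; exact/lefP/nd_nnsfun_approx.
under eq_fun do rewrite integral_density_nnsfun.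
rewrite -monotone_convergence//=.
- apply: eq_integral => x _; apply/cvg_lim => //=.
  by apply: cvgeZr => //; exact: cvg_nnsfun_approx.
- move=> n; apply: emeasurable_funM; exact/measurable_EFinP.
- by move=> n x _; rewrite mule_ge0 ?lee_fin.
- move=> x _ m n mn; rewrite lee_wpmul2r ?lee_fin//.
  exact/lefP/nd_nnsfun_approx.
Qed.

End density.

(** Completing the square turns the exponential times the density into a constant times the normal
    density with mean [a * s ^+ 2]. *)
Lemma normal_mgf {R : realType} (a s : R) : s != 0 ->
  (\int[normal_prob 0 s]_x (expR (a * x))%:E = (expR (a ^+ 2 * s ^+ 2 / 2))%:E)%E.
Proof.
move=> s0.
have me : measurable_fun setT (fun x : R => (expR (a * x))%:E).
  apply/measurable_EFinP; apply: (measurableT_comp (@measurable_expR R)).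
  exact: measurable_funM.
have e0 (x : R) : (0 <= (expR (a * x))%:E)%E by rewrite lee_fin expR_ge0.
have := @ge0_integral_density _ (measurableTypeR R) R lebesgue_measure
  (normal_prob 0 s) (normal_pdf 0 s).
move=> /(_ (measurable_normal_pdf 0 s) (normal_pdf_ge0 0 s) (fun _ _ => erefl)).
move=> /(_ _ me e0) ->.
transitivity (\int[lebesgue_measure]_x ((expR (a ^+ 2 * s ^+ 2 / 2))%:E *
    (normal_pdf (a * s ^+ 2) s x)%:E))%E.
  apply: eq_integral => x _.
  rewrite -!EFinM !normal_pdfE// /normal_fun; congr EFin.
  rewrite !(mulrCA _ (normal_peak s)); congr (_ * _).
  by rewrite -!expRD; congr expR; field.
rewrite ge0_integralZl//.
- by rewrite integral_normal_pdf mule1.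
- by apply/measurable_EFinP; exact: measurable_normal_pdf.
- by move=> x _; rewrite lee_fin normal_pdf_ge0.
Qed.

(** The approximants freeze the time at the grid point [a n u], which takes countably many values;
    continuity in time gives the pointwise limit. *)
Lemma caratheodory_measurable {R : realType} d (T : measurableType d)
    (Z : R -> T -> R) :
  (forall u, measurable_fun setT (Z u)) ->
  (forall w, continuous (fun u => Z u w)) ->
  measurable_fun setT (fun z : R * T => Z z.1 z.2).
Proof.
move=> mZ cZ.
pose a n (u : R) : R := (Num.floor (n.+1%:R * u))%:~R / n.+1%:R.
apply: (@measurable_fun_cvg _ _ _ _ (fun n (z : R * T) => Z (a n z.1) z.2)).
  move=> n _ B mB; rewrite setTI.
  have -> : (fun z : R * T => Z (a n z.1) z.2) @^-1` B =
      \bigcup_(k : int) ([set u | Num.floor (n.+1%:R * u) = k] `*`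
        (Z (k%:~R / n.+1%:R) @^-1` B)).
    apply/seteqP; split => [[u w] /= h|[u w] [k _ [/= uk]]].
      by exists (Num.floor (n.+1%:R * u)).
    by rewrite /a uk.
  apply: countable_bigcupT_measurable => // k.
  apply: measurableX.
    have -> : [set u : R | Num.floor (n.+1%:R * u) = k] =
        `[k%:~R / n.+1%:R, (k + 1)%:~R / n.+1%:R[%classic.
      apply/seteqP; split => u /=; rewrite in_itv/=.
        move=> uk; have := floor_itv (n.+1%:R * u); rewrite uk.
        by rewrite ler_pdivrMr// ltr_pdivlMr// mulrC.
      rewrite ler_pdivrMr// ltr_pdivlMr// mulrC => ?.
      by apply/eqP; rewrite floor_eq.
    exact: measurable_itv.
  by rewrite -[X in measurable X]setTI; exact: mZ.
move=> [u w] _ /=.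
have ha : a n u @[n --> \oo] --> u.
  apply/cvgrPdist_le => e e0; have := @cvg_harmonic R.
  move=> /cvgrPdist_le/(_ e e0); apply: filterS => n /=.
  rewrite sub0r normrN ger0_norm ?invr_ge0// => he.
  have /andP[h1 h2] := floor_itv (n.+1%:R * u).
  rewrite /a ger0_norm; last by rewrite subr_ge0 ler_pdivrMr// (mulrC u).
  apply: le_trans he; rewrite lerBlDr -[X in X + _]mul1r -mulrDl ler_pdivlMr//.
  by rewrite (mulrC u) addrC -[X in _ + X]/(1%:~R) -intrD ltW.
exact: (@cvg_comp _ _ _ (a ^~ u) (Z ^~ w) _ (nbhs u) _ ha (@cZ w u)).
Qed.

Section product_of_independent.
Context d (T : measurableType d) (R : realType) (P : probability T R).
Variables (U V : T -> R).
Hypothesis mU : measurable_fun setT U.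
Hypothesis mV : measurable_fun setT V.
Hypothesis U0 : forall w, 0 <= U w.
Hypothesis V0 : forall w, 0 <= V w.
Hypothesis UV : forall A B : set R, measurable A -> measurable B ->
  (P (U @^-1` A `&` V @^-1` B) = P (U @^-1` A) * P (V @^-1` B))%E.

Lemma ge0_integralM_independent :
  (\int[P]_w (U w * V w)%:E = \int[P]_w (U w)%:E * \int[P]_w (V w)%:E)%E.
Proof.
pose U' : {mfun T >-> R} := HB.pack U (isMeasurableFun.Build _ _ _ _ U mU).
pose V' : {mfun T >-> R} := HB.pack V (isMeasurableFun.Build _ _ _ _ V mV).
have mUV : measurable_fun setT (fun w => (U w, V w)).
  exact: measurable_fun_pair.
pose UV' : {mfun T >-> (R * R)%type} :=
  HB.pack (fun w => (U w, V w)) (isMeasurableFun.Build _ _ _ _ _ mUV).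
have mpos : measurable_fun setT (fun z : R * R => (`|z.1| * `|z.2|)%:E).
  apply/measurable_EFinP; apply: measurable_funM.
    by apply: measurableT_comp => //; exact: measurable_fst.
  by apply: measurableT_comp => //; exact: measurable_snd.
have E1 : (\int[P]_w (U w * V w)%:E =
    \int[distribution P UV']_z (`|z.1| * `|z.2|)%:E)%E.
  rewrite ge0_integral_distribution//.
  by apply: eq_integral => w _ /=; rewrite !ger0_norm.
rewrite E1.
rewrite (@eq_measure_integral _ _ _ _ (distribution P U' \x distribution P V')%E).
  rewrite fubini_tonelli1//.
  have mn : measurable_fun setT (fun x : R => `|x|%:E).
    by apply/measurable_EFinP; exact: normr_measurable.
  rewrite /fubini_F/=.
  under eq_integral.
    move=> x _; under eq_integral do rewrite EFinM.
    rewrite ge0_integralZl//.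
    over.
  rewrite ge0_integralZr//=; last exact: integral_ge0.
  rewrite !ge0_integral_distribution//.
  by congr (_ * _)%E; apply: eq_integral => w _ /=; rewrite ger0_norm.
move=> A mA _; apply/esym; apply: product_measure_unique => //.
Qed.

End product_of_independent.

(** * Martingale property of exponentials *)

Section brownian_exponential.
Context {R : realType} d (T : measurableType d) (P : probability T R).
Variable W : R -> {RV P >-> (R * R)%type}.
Hypothesis hW : brownian_motion2 W.

Definition lin2 (a b : R) (z : R * R) : R := a * z.1 + b * z.2.

Lemma measurable_lin2 a b : measurable_fun setT (lin2 a b).
Proof.
by apply: measurable_funD; apply: measurable_funM => //.
Qed.

Lemma lin2B a b (y z : R * R) : lin2 a b (y - z) = lin2 a b y - lin2 a b z.
Proof. by rewrite /lin2/=; ring. Qed.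

Lemma measurable_incr s t : measurable_fun setT (fun w => W t w - W s w).
Proof.
have m1 u : measurable_fun setT (fun w => (W u w).1).
  exact: (measurableT_comp measurable_fst (measurable_funPT (W u))).
have m2 u : measurable_fun setT (fun w => (W u w).2).
  exact: (measurableT_comp measurable_snd (measurable_funPT (W u))).
exact: (measurable_fun_pair (measurable_funB (m1 t) (m1 s))
  (measurable_funB (m2 t) (m2 s))).
Qed.

Lemma measurable_expR_lin2 a b : measurable_fun setT (fun z => (expR (lin2 a b z))%:E).
Proof.
apply/measurable_EFinP; apply: (measurableT_comp (@measurable_expR R)).
exact: measurable_lin2.
Qed.

Lemma incr_mgf a b s t : 0 <= s -> s < t ->
  (\int[P]_w (expR (lin2 a b (W t w - W s w)))%:E =
   (expR ((a ^+ 2 + b ^+ 2) * (t - s) / 2))%:E)%E.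
Proof.
move=> s0 st.
have [_ _ hlaw _] := hW.
pose RR : measurableType _ := (measurableTypeR R * measurableTypeR R)%type.
have mD : measurable_fun setT ((fun w => W t w - W s w) : T -> RR).
  exact: measurable_incr.
pose D : {mfun T >-> RR} := HB.pack ((fun w => W t w - W s w) : T -> RR)
  (isMeasurableFun.Build _ _ _ _ _ mD).
have me : measurable_fun setT ((fun z => (expR (lin2 a b z))%:E) : RR -> \bar R).
  exact: measurable_expR_lin2.
have sq0 : Num.sqrt (t - s) != 0 by rewrite gt_eqF// sqrtr_gt0 subr_gt0.
have sqE : Num.sqrt (t - s) ^+ 2 = t - s by rewrite sqr_sqrtr// subr_ge0 ltW.
transitivity (\int[distribution P D]_z (expR (lin2 a b z))%:E)%E.
  by rewrite ge0_integral_distribution// => z; rewrite lee_fin expR_ge0.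
rewrite (@eq_measure_integral _ _ _ _
  (normal_prob 0 (Num.sqrt (t - s)) \x normal_prob 0 (Num.sqrt (t - s)))%E); last first.
  by move=> A mA _; exact: hlaw.
rewrite fubini_tonelli1//.
rewrite /fubini_F /lin2/=.
have mE c : measurable_fun (setT : set (measurableTypeR R)) (fun x : R => (expR (c * x))%:E).
  apply/measurable_EFinP; apply: (measurableT_comp (@measurable_expR R)).
  exact: measurable_funM.
under eq_integral.
  move=> x _; under eq_integral do rewrite expRD EFinM.
  rewrite ge0_integralZl//.
  rewrite normal_mgf// sqE.
  over.
rewrite /= ge0_integralZr//=.
by rewrite normal_mgf// sqE -EFinM -expRD; congr ((expR _)%:E); field.
Qed.

Lemma sub_sigma_past s t : s <= t -> sigma_past W s `<=` sigma_past W t.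
Proof.
move=> st; apply: sub_sigma_algebra2 => A [u /= us [B mB <-]].
exists u => //=; first by move: us; rewrite !in_itv/= => /andP[-> /le_trans->].
by exists B.
Qed.

Lemma sigma_past_measurable s : sigma_past W s `<=` measurable.
Proof.
apply: smallest_sub; first exact: sigma_algebra_measurable.
move=> A [u _ [B mB <-]]; exact: measurable_funP.
Qed.

Let past_gen s := \bigcup_(u in `[0%R, s]) preimage_set_system setT (W u) measurable.

Lemma measurable_past s u : 0 <= u -> u <= s ->
  measurable_fun (setT : set (g_sigma_algebraType (past_gen s))) (W u).
Proof.
move=> u0 us _ B mB; apply: sub_sigma_algebra; exists u; first by rewrite /= in_itv/= u0.
by exists B.
Qed.

(** On [A] the exponential factors into [U], measurable with respect to the past at [s], and [V], a
    function of the independent increment. *)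
Lemma exp_step a b s t A : 0 <= s -> s < t -> sigma_past W s A ->
  (\int[P]_(w in A) (expR (lin2 a b (W t w)))%:E =
   (expR ((a ^+ 2 + b ^+ 2) * (t - s) / 2))%:E *
   \int[P]_(w in A) (expR (lin2 a b (W s w)))%:E)%E.
Proof.
move=> s0 st sA.
have [_ _ _ hind] := hW.
pose U w := expR (lin2 a b (W s w)) * \1_A w.
pose V w := expR (lin2 a b (W t w - W s w)).
have mA : measurable A by exact: sigma_past_measurable sA.
have mU' : measurable_fun (setT : set (g_sigma_algebraType (past_gen s))) U.
  apply: measurable_funM; last exact: measurable_indic.
  apply: (measurableT_comp (@measurable_expR R)).
  by apply: (measurableT_comp (measurable_lin2 a b)); exact: measurable_past.
have mU : measurable_fun setT U.
  apply: measurable_funM; last exact: measurable_indic.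
  apply: (measurableT_comp (@measurable_expR R)).
  exact: (measurableT_comp (measurable_lin2 a b)).
have mV : measurable_fun setT V.
  apply: (measurableT_comp (@measurable_expR R)).
  exact: (measurableT_comp (measurable_lin2 a b) (measurable_incr s t)).
have U0 w : 0 <= U w by rewrite mulr_ge0 ?expR_ge0// indicE.
have V0 w : 0 <= V w by exact: expR_ge0.
have UV (B C : set R) : measurable B -> measurable C ->
    (P (U @^-1` B `&` V @^-1` C) = P (U @^-1` B) * P (V @^-1` C))%E.
  move=> mB mC; apply: (hind s t s0 st).
    by have := mU' measurableT B mB; rewrite setTI.
  exists (lin2 a b @^-1` (expR @^-1` C)).
    rewrite -[X in measurable X]setTI; apply: measurable_lin2 => //.
    by rewrite -[X in measurable X]setTI; exact: measurable_expR.
  by rewrite setTI.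
have := ge0_integralM_independent mU mV U0 V0 UV.
rewrite (incr_mgf a b s0 st) muleC => EUV.
transitivity (\int[P]_w (U w * V w)%:E)%E.
  rewrite integral_mkcond; apply: eq_integral => w _.
  rewrite patchE /U /V indicE; case: ifP => _; last by rewrite mulr0 mul0r.
  by rewrite mulr1 -expRD lin2B addrC subrK.
rewrite EUV; congr (_ * _)%E; rewrite [RHS]integral_mkcond.
apply: eq_integral => w _; rewrite patchE /U indicE.
by case: ifP => _; rewrite ?mulr1 ?mulr0.
Qed.

Lemma natural_filtration_measurable s : natural_filtration P W s `<=` measurable.
Proof.
apply: smallest_sub; first exact: sigma_algebra_measurable.
by move=> A [/sigma_past_measurable//|[]].
Qed.

Lemma sub_natural_filtration s t : s <= t ->
  natural_filtration P W s `<=` natural_filtration P W t.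
Proof.
move=> st; apply: sub_sigma_algebra2 => A [sA|nA]; [left|by right].
exact: sub_sigma_past sA.
Qed.

(** Independence of increments is known for the unaugmented past; replacing an event by one that
    agrees with it off a null set carries integral identities over to the augmented filtration. *)
Lemma natural_filtration_modification s A : natural_filtration P W s A ->
  exists A' N, [/\ sigma_past W s A', measurable N, P N = 0%E &
    A `\` N = A' `\` N].
Proof.
pose M := [set A | exists A' N, [/\ sigma_past W s A', measurable N, P N = 0%E &
    A `\` N = A' `\` N]].
suff : natural_filtration P W s `<=` M by exact.
apply: smallest_sub; last first.
  move=> B [sB|[mB B0]]; first by exists B, set0; split.
  exists set0, B; split => //; first exact: sigma_algebra0.
  by rewrite setDv set0D.
split.
- by exists set0, set0; split => //; exact: sigma_algebra0.
- move=> B [B' [N [sB mN N0 BN]]]; exists (setT `\` B'), N; split => //.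
    exact: sigma_algebraCD.
  apply/seteqP; split => w [[_ Bw] Nw]; split => //; split => // Bw'; apply: Bw.
    by have [] : (B `\` N) w by rewrite BN.
  by have [] : (B' `\` N) w by rewrite -BN.
- move=> F hF; have /choice[B' /choice[N hN]] := hF.
  exists (\bigcup_n B' n), (\bigcup_n N n); split.
  + by apply: sigma_algebra_bigcup => n; have [] := hN n.
  + by apply: bigcupT_measurable => n; have [] := hN n.
  + apply/eqP; rewrite -measure_le0.
    have mN n : measurable (N n) by have [] := hN n.
    apply: le_trans (measure_sigma_subadditive _ mN (bigcupT_measurable _ mN) _) _ => //.
    by rewrite eseries0// => n _ _; have [] := hN n.
  + apply/seteqP; split => w [[n _ Fw] Nw]; split => //; exists n => //.
      have [_ _ _ e] := hN n.
      have [] // : (B' n `\` N n) w.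
      by rewrite -e; split => // nw; apply: Nw; exists n.
    have [_ _ _ e] := hN n.
    have [] // : (F n `\` N n) w.
    by rewrite e; split => // nw; apply: Nw; exists n.
Qed.

(** The stochastic exponential of [a W^0 + b W^1], of quadratic variation
    [(a ^+ 2 + b ^+ 2) * x]. *)
Definition exp_bm (a b x : R) (w : T) : R :=
  expR (lin2 a b (W x w) - (a ^+ 2 + b ^+ 2) * x / 2).

Lemma measurable_exp_bm a b x : measurable_fun setT (exp_bm a b x).
Proof.
apply: (measurableT_comp (@measurable_expR R)); apply: measurable_funB => //.
exact: (measurableT_comp (measurable_lin2 a b)).
Qed.

Lemma exp_bm_martingale a b s t A : 0 <= s -> s <= t ->
  natural_filtration P W s A ->
  (\int[P]_(w in A) (exp_bm a b t w)%:E = \int[P]_(w in A) (exp_bm a b s w)%:E)%E.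
Proof.
move=> s0; rewrite le_eqVlt => /predU1P[->//|st] sA.
have mA : measurable A by exact: natural_filtration_measurable sA.
have [A' [N [sA' mN N0 AN]]] := natural_filtration_modification sA.
have mA' : measurable A' by exact: sigma_past_measurable sA'.
have NE (f : T -> \bar R) : measurable_fun setT f -> (forall w, 0 <= f w)%E ->
    (\int[P]_(w in A) f w = \int[P]_(w in A') f w)%E.
  move=> mf f0; rewrite (ge0_negligible_integral mN)//; last exact: measurable_funTS.
  rewrite [RHS](ge0_negligible_integral mN)//; last exact: measurable_funTS.
  by rewrite AN.
have me x : measurable_fun setT (fun w => (exp_bm a b x w)%:E).
  by apply/measurable_EFinP; exact: measurable_exp_bm.
have f0 x w : (0 <= (exp_bm a b x w)%:E)%E by rewrite lee_fin expR_ge0.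
rewrite (NE _ (me t) (f0 t)) (NE _ (me s) (f0 s)).
have mx x : measurable_fun A' (fun w => (expR (lin2 a b (W x w)))%:E).
  apply/measurable_EFinP; apply: measurable_funTS.
  apply: (measurableT_comp (@measurable_expR R)).
  exact: (measurableT_comp (measurable_lin2 a b)).
have E x : (\int[P]_(w in A') (exp_bm a b x w)%:E =
    (expR (- ((a ^+ 2 + b ^+ 2) * x / 2)))%:E *
    \int[P]_(w in A') (expR (lin2 a b (W x w)))%:E)%E.
  rewrite -ge0_integralZl//.
    by apply: eq_integral => w _; rewrite /exp_bm addrC expRD EFinM.
rewrite (E t) (E s) (exp_step a b s0 st sA') muleA -EFinM -expRD.
by congr ((expR _)%:E * _)%E; field.
Qed.

Lemma integral_exp_bm a b x : 0 <= x -> (\int[P]_w (exp_bm a b x w)%:E = 1)%E.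
Proof.
move=> x0; have [W0 _ _ _] := hW.
rewrite (exp_bm_martingale a b (lexx 0) x0); last first.
  rewrite -(setD0 setT); apply: sigma_algebraCD; exact: sigma_algebra0.
transitivity (\int[P]_w (cst 1%E w))%E.
  apply: ae_eq_integral => //.
  - by apply/measurable_EFinP; exact: measurable_exp_bm.
  - apply: filterS W0 => w Ww _; rewrite /exp_bm Ww /lin2/= !mulr0 mul0r addr0 subr0.
    by rewrite expR0.
by rewrite integral_cst// mul1e; exact: probability_setT.
Qed.

End brownian_exponential.

(** * Exponential maximal inequality *)

Section maximal_inequality.
Context {R : realType} d (T : measurableType d) (P : probability T R).
Variable W : R -> {RV P >-> (R * R)%type}.
Hypothesis hW : brownian_motion2 W.

Local Notation FT x := (g_sigma_algebraType
  (sigma_past W x `|` [set N | measurable N /\ P N = 0%E])).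

Lemma natural_filtrationE x : natural_filtration P W x = (measurable : set (set (FT x))).
Proof. by []. Qed.

Lemma adapted_natural_filtration (f : R * R -> R) (x u : R) (B : set R) :
  measurable_fun setT f -> measurable B -> 0 <= u -> u <= x ->
  natural_filtration P W x [set w | B (f (W u w))].
Proof.
move=> mf mB u0 ux; apply: sub_sigma_algebra; left.
apply: sub_sigma_algebra; exists u; first by rewrite /= in_itv/= u0.
exists (f @^-1` B); first by rewrite -[X in measurable X]setTI; exact: mf.
by rewrite setTI.
Qed.

(** Doob's argument; [e] is a sign. [seqDU F k] is the event that the level [c] is first reached at
    the index [k], and there the exponential martingale is at least
    [expR (la * c - la ^+ 2 * x / 2)]. Moving it forward to time [x] on each of these disjoint
    events and summing gives at most its total mass 1. *)
Lemma maximal_inequality_grid (e la c x : R) (u : nat -> R) :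
  e ^+ 2 = 1 -> 0 <= la -> (forall j k, (j <= k)%N -> u j <= u k) ->
  (forall k, 0 <= u k) -> (forall k, u k <= x) ->
  (P (\bigcup_k [set w | (c <= e * (W (u k) w).2)%R]) <=
   (expR (la ^+ 2 * x / 2 - la * c))%:E)%E.
Proof.
move=> e2 la0 ndu u0 ux.
pose F k := [set w | c <= e * (W (u k) w).2].
pose M y w := exp_bm W 0 (e * la) y w.
have b2 : 0 ^+ 2 + (e * la) ^+ 2 = la ^+ 2 by rewrite expr0n/= add0r exprMn e2 mul1r.
have x0 : 0 <= x by apply: le_trans (ux 0%N).
have mc : measurable [set z : R | c <= z].
  have -> : [set z : R | c <= z] = `[c, +oo[%classic.
    by apply/seteqP; split => z /=; rewrite in_itv/= andbT.
  exact: measurable_itv.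
have FF j k : (j <= k)%N -> natural_filtration P W (u k) (F j).
  move=> jk; have mf : measurable_fun setT (fun z : R * R => e * z.2).
    by apply: measurable_funM.
  exact: (@adapted_natural_filtration _ (u k) (u j) [set z | c <= z] mf mc (u0 j) (ndu _ _ jk)).
have mF k : measurable (F k).
  exact: natural_filtration_measurable (FF k k (leqnn k)).
have FD k : natural_filtration P W (u k) (seqDU F k).
  rewrite natural_filtrationE; apply: measurableD; first exact: (FF k k).
  by apply: bigsetU_measurable => j _; exact: (FF j k (ltnW (ltn_ord j))).
have mD k : measurable (seqDU F k) by exact: natural_filtration_measurable (FD k).
have tD : trivIset setT (seqDU F) by exact: trivIset_seqDU.
have mM y : measurable_fun setT (fun w => (M y w)%:E).
  by apply/measurable_EFinP; exact: measurable_exp_bm.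
rewrite seqDU_bigcup_eq.
have mU : measurable (\bigcup_k seqDU F k) by exact: bigcupT_measurable.
have C0 : 0 < expR (la * c - la ^+ 2 * x / 2) by exact: expR_gt0.
have : ((expR (la * c - la ^+ 2 * x / 2))%:E * P (\bigcup_k seqDU F k) <= 1)%E.
  apply: (@le_trans _ _ (\int[P]_(w in \bigcup_k seqDU F k) (M x w)%:E)%E); last first.
    rewrite -(integral_exp_bm hW 0 (e * la) x0).
    by apply: ge0_subset_integral => // w _; rewrite lee_fin expR_ge0.
  rewrite ge0_integral_bigcup//; last 2 first.
  - exact: measurable_funTS.
  - by move=> w _; rewrite lee_fin expR_ge0.
  rewrite measure_bigcup// -nneseriesZl//.
  rewrite (@eq_eseriesl _ _ xpredT); last by move=> k; rewrite in_setT.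
  apply: lee_nneseries => [k _|k _]; first by rewrite mule_ge0// lee_fin ltW.
  rewrite (exp_bm_martingale hW 0 (e * la) (u0 k) (ux k) (FD k)).
  rewrite -integral_cst//; apply: ge0_le_integral => //.
  - by move=> w _; rewrite lee_fin ltW.
  - exact: measurable_funTS.
  move=> w [Fw _]; rewrite lee_fin ler_expR b2 /lin2 mul0r add0r.
  apply: lerB; first by rewrite (mulrC e) -mulrA ler_wpM2l.
  by rewrite ler_pM2r ?invr_gt0// ler_wpM2l// exprn_ge0.
rewrite muleC -lee_pdivlMr// mul1e -expRN => /le_trans; apply.
by rewrite lee_fin ler_expR opprB.
Qed.

End maximal_inequality.

Section brownian_paths.
Context {R : realType} d (T : measurableType d) (P : probability T R).
Variable W : R -> {RV P >-> (R * R)%type}.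
Hypothesis hW : brownian_motion2 W.

Lemma bm_continuous_lin2 a b w :
  {within `[0, +oo[%classic, continuous (fun x => lin2 a b (W x w))}.
Proof.
have [_ cW _ _] := hW.
apply/subspace_continuousP => x x0; have /subspace_continuousP/(_ x x0) cx := cW w.
apply: cvgD; apply: cvgM; [exact: cvg_cst| |exact: cvg_cst|].
- exact: (cvg_comp _ _ cx cvg_fst).
- exact: (cvg_comp _ _ cx cvg_snd).
Qed.

Lemma bm_continuous2 w :
  {within `[0, +oo[%classic, continuous (fun x => (W x w).2)}.
Proof.
rewrite (_ : (fun x => _) = (fun x => lin2 0 1 (W x w))).
  exact: bm_continuous_lin2.
by apply/funext => x; rewrite /lin2 mul0r add0r mul1r.
Qed.

Lemma continuous_Rplus_clamp (f : R -> R) :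
  {within `[0, +oo[%classic, continuous f} -> continuous (fun u : R => f (Num.max 0 u)).
Proof.
move=> /within_continuous_ballP cf u; apply/cvgrPdist_lt => e e0.
have u0 : `[0, +oo[%classic (Num.max 0 u) by rewrite /= in_itv/= andbT le_max lexx.
have [r r0 rP] := cf _ u0 _ e0.
exists r => //= v uv; rewrite distrC; apply: rP.
  by rewrite /= in_itv/= andbT le_max lexx.
apply: le_lt_trans uv; rewrite ler_norml.
have h1 := ler_norm (u - v); have h2 := ler_norm (v - u); rewrite distrC in h2.
by rewrite /Num.max; case: (ltP 0 v) => v0; case: (ltP 0 u) => u0'; apply/andP; split; lra.
Qed.

Lemma dyadic_approx (x r : R) : 0 < x -> 0 < r ->
  exists m : nat, x / 2 ^+ m < r.
Proof.
move=> x0 r0; exists (Num.truncn (x / r)).+1.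
rewrite ltr_pdivrMr ?exprn_gt0// mulrC -ltr_pdivrMr//.
apply: lt_le_trans (truncnS_gt _) _; rewrite -natrX ler_nat.
exact/ltnW/ltn_expl.
Qed.

(** A path reaching [c] is at least [c / 2] at a nearby point of a fine dyadic grid, so the
    increasing union of the grid events with threshold [c / 2] is a measurable set containing all
    such paths. *)
Lemma maximal_inequality (e c x : R) : e ^+ 2 = 1 -> 0 < c -> 0 < x ->
  exists E, [/\ measurable E, (P E <= (expR (- (c ^+ 2 / (8 * x))))%:E)%E &
    forall u w, 0 <= u -> u <= x -> c <= e * (W u w).2 -> E w].
Proof.
move=> e2 c0 x0.
pose u (m k : nat) : R := x * (minn k (2 ^ m))%:R / 2 ^+ m.
have p2 (m : nat) : 0 < 2 ^+ m :> R by exact: exprn_gt0.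
have u0 m k : 0 <= u m k by rewrite /u divr_ge0 ?mulr_ge0 ?(ltW x0) ?(ltW (p2 _)).
have ux m k : u m k <= x.
  by rewrite /u ler_pdivrMr// ler_pM2l// -natrX ler_nat geq_minr.
have ndu m j k : (j <= k)%N -> u m j <= u m k.
  move=> jk; rewrite /u ler_pM2r ?invr_gt0// ler_pM2l// ler_nat.
  by rewrite leq_min geq_minr andbT (leq_trans (geq_minl _ _)).
pose F m := \bigcup_k [set w | c / 2 <= e * (W (u m k) w).2].
have mF m : measurable (F m).
  apply: bigcupT_measurable => k.
  have mf : measurable_fun setT (fun w => e * (W (u m k) w).2).
    apply: measurable_funM => //.
    exact: (measurableT_comp measurable_snd (measurable_funPT (W _))).
  have := mf measurableT `[c / 2, +oo[%classic (measurable_itv _).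
  rewrite setTI; congr measurable; apply/seteqP.
  by split => w /=; rewrite in_itv/= andbT.
have ndF : nondecreasing_seq F.
  apply/nondecreasing_seqP => m; rewrite subsetEset => w [k _ h].
  exists k.*2 => //; rewrite /= /u exprS invfM.
  have -> : x * (minn k.*2 (2 ^ m.+1))%:R * (2^-1 / 2 ^+ m) =
            x * (minn k (2 ^ m))%:R / 2 ^+ m.
    rewrite expnS mul2n -!muln2 -minnMl natrM.
    by field; rewrite gt_eqF.
  exact: h.
have mUF : measurable (\bigcup_m F m) by exact: bigcupT_measurable.
exists (\bigcup_m F m); split => //.
  have cF := nondecreasing_cvg_mu (mu := P) mF mUF ndF.
  rewrite -(cvg_lim _ cF)//; apply: lime_le; first exact: cvgP cF.
  apply: nearW => m /=.
  (* This value minimizes the exponent [la ^+ 2 * x / 2 - la * (c / 2)]; the minimum is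
     [- c ^+ 2 / (8 * x)]. *)
  have la0 : 0 <= c / (2 * x) by rewrite divr_ge0 ?mulr_ge0 ?(ltW c0) ?(ltW x0).
  apply: le_trans (maximal_inequality_grid hW (c / 2) e2 la0 (ndu m) (u0 m) (ux m)) _.
  rewrite lee_fin ler_expR le_eqVlt; apply/orP; left; apply/eqP.
  by field; rewrite gt_eqF.
move=> v w v0 vx cv.
have /within_continuous_ballP cW := @bm_continuous2 w.
have vI : `[0, +oo[%classic v by rewrite /= in_itv/= andbT.
have c20 : 0 < c / 2 by rewrite divr_gt0.
have [r r0 rP] := cW v vI _ c20.
have [m mr] := dyadic_approx x0 r0.
exists m => //; exists (Num.truncn (v * 2 ^+ m / x)) => //=.
have vm0 : 0 <= v * 2 ^+ m / x by rewrite divr_ge0 ?mulr_ge0 ?(ltW x0) ?(ltW (p2 _)).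
have /andP[k1 k2] := truncn_itv vm0.
set k := Num.truncn _ in k1 k2 *.
have km : (k <= 2 ^ m)%N.
  rewrite -(ler_nat R) natrX (le_trans k1)// ler_pdivrMr// mulrC.
  by rewrite ler_pM2l.
have uE : u m k = x * k%:R / 2 ^+ m by rewrite /u (minn_idPl km).
have uv : `|u m k - v| < r.
  apply: le_lt_trans mr; rewrite uE distrC ger0_norm.
    rewrite lerBlDr -mulrDl ler_pdivlMr//.
    by move: k2; rewrite ltr_pdivrMr// -natr1 => k2; lra.
  by rewrite subr_ge0 ler_pdivrMr//; move: k1; rewrite ler_pdivlMr// mulrC.
have := rP (u m k); rewrite /= in_itv/= andbT => /(_ (u0 _ _) uv).
move=> h; have : e * ((W (u m k) w).2 - (W v w).2) >= - (c / 2).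
  have : `|e * ((W (u m k) w).2 - (W v w).2)| < c / 2.
    rewrite normrM; have -> : `|e| = 1; last by rewrite mul1r.
    by apply/eqP; rewrite -(@eqrXn2 _ 2%N)// ?expr1n -?normrX ?e2 ?normr1.
  by rewrite real_ltr_norml ?num_real// => /andP[/ltW].
by rewrite mulrBr; lra.
Qed.

End brownian_paths.

(** A second moment bound gives uniform integrability. One inequality is Fatou's lemma; the other
    truncates at a level [r] and lets [r] grow. *)
Lemma L2_bounded_cvg_integral {R : realType} d (T : measurableType d)
    (P : probability T R) (B : set T) (Z_ : nat -> T -> R) (Z : T -> R) (q K : R) :
  measurable B ->
  (forall m, measurable_fun setT (Z_ m)) -> measurable_fun setT Z ->
  (forall m w, 0 <= Z_ m w) -> (forall w, 0 <= Z w) ->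
  (forall w, B w -> Z_ m w @[m --> \oo] --> Z w) ->
  (forall m, \int[P]_(w in B) (Z_ m w)%:E = q%:E)%E ->
  (forall m, \int[P]_(w in B) (Z_ m w ^+ 2)%:E <= K%:E)%E ->
  (\int[P]_(w in B) (Z w)%:E = q%:E)%E.
Proof.
move=> mB mZ_ mZ Z_0 Z0 cZ Eq EK.
have mEZ_ m : measurable_fun B (fun w => (Z_ m w)%:E).
  by apply/measurable_EFinP; exact: measurable_funTS.
have mEZ : measurable_fun B (fun w => (Z w)%:E).
  by apply/measurable_EFinP; exact: measurable_funTS.
have le1 : (\int[P]_(w in B) (Z w)%:E <= q%:E)%E.
  have := fatou P mB mEZ_ (fun m w _ => Z_0 m w).
  have -> : (\int[P]_(w in B) limn_einf (fun m => (Z_ m w)%:E) =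
            \int[P]_(w in B) (Z w)%:E)%E.
    apply: eq_integral => w; rewrite inE => Bw.
    have cE : (Z_ m w)%:E @[m --> \oo] --> (Z w)%:E.
      by apply: cvg_EFin; [exact: nearW|exact: cZ].
    by rewrite is_cvg_limn_einfE; [exact: cvg_lim|exact: cvgP cE].
  move=> /le_trans; apply.
  rewrite (_ : (fun n => _) = cst q%:E); last by apply/funext => m; rewrite Eq.
  by rewrite is_cvg_limn_einfE; [rewrite lim_cst|exact: is_cvg_cst].
apply/eqP; rewrite eq_le le1/=.
have K0 : 0 <= K.
  rewrite -lee_fin; apply: le_trans (EK 0%N); apply: integral_ge0 => w _.
  by rewrite lee_fin sqr_ge0.
(* Each [Z_ m] is at most [Num.min (Z_ m) r + Z_ m ^+ 2 / r]: the first term converges by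
   domination, the second has integral at most [K / r]. *)
have key (r : R) : 0 < r -> (q%:E <= \int[P]_(w in B) (Z w)%:E + (K / r)%:E)%E.
  move=> r0.
  have mmin (f : T -> R) : measurable_fun setT f ->
      measurable_fun B (fun w => (Num.min (f w) r)%:E).
    move=> mf; apply/measurable_EFinP; apply: measurable_funTS.
    exact: measurable_minr.
  have min0 (f : R) : 0 <= f -> 0 <= Num.min f r by move=> f0; rewrite le_min f0 ltW.
  have cmin : (\int[P]_(w in B) (Num.min (Z_ m w) r)%:E @[m --> \oo] -->
      \int[P]_(w in B) (Num.min (Z w) r)%:E)%E.
    apply: (@dominated_cvg _ _ _ P B mB _ _ (cst r%:E)) => //.
    - by move=> m; exact: mmin.
    - move=> w Bw; apply: cvg_EFin; first exact: nearW.
      apply/cvgrPdist_lt => e e0; have /cvgrPdist_lt/(_ e e0) := cZ w Bw.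
      apply: filterS => m hm; apply: le_lt_trans hm.
      have h1 := ler_norm (Z w - Z_ m w); have h2 := ler_norm (Z_ m w - Z w).
      rewrite distrC in h2; rewrite /= ler_norml /Num.min.
      by case: (ltP (Z w) r) => v0; case: (ltP (Z_ m w) r) => u0'; apply/andP; split; lra.
    - exact: finite_measure_integrable_cst.
    - move=> m w _; rewrite /= lee_fin ger0_norm; last exact: min0.
      by rewrite ge_min lexx orbT.
  have : (\int[P]_(w in B) (Num.min (Z w) r)%:E <= \int[P]_(w in B) (Z w)%:E)%E.
    apply: ge0_le_integral => //.
    - by move=> w _; rewrite lee_fin min0.
    - exact: mmin.
    - by move=> w _; rewrite lee_fin ge_min lexx.
  move=> h; apply: le_trans (leeD h (lexx _)).
  rewrite -leeBlDr//; apply: (cvge_ge _ cmin) => //.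
  apply: nearW => m; rewrite leeBlDr// -(Eq m).
  apply: (@le_trans _ _ (\int[P]_(w in B) ((Num.min (Z_ m w) r)%:E +
      (Z_ m w ^+ 2 / r)%:E))%E).
    apply: ge0_le_integral => //.
    - by move=> w _; rewrite lee_fin.
    - apply: emeasurable_funD; first exact: mmin.
      apply/measurable_EFinP; apply: measurable_funTS; apply: measurable_funM => //.
      exact: measurable_funX.
    - move=> w _; rewrite -EFinD lee_fin /Num.min; case: ltP => rz.
        by rewrite lerDl divr_ge0 ?sqr_ge0// ltW.
      rewrite (@le_trans _ _ (Z_ m w ^+ 2 / r))//; last by rewrite lerDr ltW.
      by rewrite ler_pdivlMr// expr2 ler_wpM2l.
  rewrite ge0_integralD//; last 4 first.
  - by move=> w _; rewrite lee_fin min0.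
  - exact: mmin.
  - by move=> w _; rewrite lee_fin divr_ge0 ?sqr_ge0// ltW.
  - apply/measurable_EFinP; apply: measurable_funTS; apply: measurable_funM => //.
    exact: measurable_funX.
  rewrite leeD2l//.
  under eq_integral do rewrite EFinM muleC.
  rewrite ge0_integralZl//.
  - by rewrite mulrC EFinM lee_wpmul2l// lee_fin invr_ge0 ltW.
  - by apply/measurable_EFinP; apply: measurable_funTS; exact: measurable_funX.
  - by move=> w _; rewrite lee_fin sqr_ge0.
  - by rewrite lee_fin invr_ge0 ltW.
apply/lee_addgt0Pr => e e0.
have r0 : 0 < K / e + 1 by rewrite ltr_wpDl// divr_ge0// ltW.
apply: le_trans (key _ r0) _; rewrite leeD2l// lee_fin.
by rewrite ler_pdivrMr// mulrDr mulr1 mulrC divfK ?gt_eqF// lerDl ltW.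
Qed.

Lemma ler_dist_maxr {R : realType} (x u v : R) :
  `|Num.max x u - Num.max x v| <= `|u - v|.
Proof.
have h1 := ler_norm (u - v); have h2 := ler_norm (v - u); rewrite distrC in h2.
rewrite ler_norml /Num.max.
by case: (ltP x v) => v0; case: (ltP x u) => u0; apply/andP; split; lra.
Qed.

Lemma ler_dist_minr {R : realType} (x u v : R) :
  `|Num.min x u - Num.min x v| <= `|u - v|.
Proof.
have h1 := ler_norm (u - v); have h2 := ler_norm (v - u); rewrite distrC in h2.
rewrite ler_norml /Num.min.
by case: (ltP x v) => v0; case: (ltP x u) => u0; apply/andP; split; lra.
Qed.

(** * Optional stopping at a bounded time *)

Section optional_stopping.
Context {R : realType} d (T : measurableType d) (P : probability T R).
Variable W : R -> {RV P >-> (R * R)%type}.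
Hypothesis hW : brownian_motion2 W.

Local Notation FT x := (g_sigma_algebraType
  (sigma_past W x `|` [set N | measurable N /\ P N = 0%E])).

(** Progressive measurability: the clamp keeps the time inside [[0, x]], so every section in time is
    measurable for the filtration at [x]. *)
Lemma measurable_clamped_bm x : 0 <= x ->
  (forall a b, measurable_fun (setT : set (R * FT x)%type)
    (fun z => lin2 a b (W (Num.min x (Num.max 0 z.1)) z.2))).
Proof.
move=> x0 a b.
apply: (@caratheodory_measurable R _ (FT x)
  (fun u w => lin2 a b (W (Num.min x (Num.max 0 u)) w))).
  move=> u _ B mB; rewrite setTI.
  apply: (adapted_natural_filtration (measurable_lin2 a b) mB).
    by rewrite le_min x0 le_max lexx.
  by rewrite ge_min lexx.
move=> w.
have h : continuous (fun v : R => lin2 a b (W (Num.max 0 v) w)).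
  exact: continuous_Rplus_clamp (@bm_continuous_lin2 _ _ _ _ _ hW a b w).
rewrite (_ : (fun u => _) =
    (fun v => lin2 a b (W (Num.max 0 v) w)) \o (fun u => Num.min x (Num.max 0 u))).
  move=> u; apply: continuous_comp; last exact: h.
  apply/cvgrPdist_lt => e e0; exists e => //= v; apply: le_lt_trans.
  by apply: le_trans (ler_dist_minr _ _ _) _; exact: ler_dist_maxr.
apply/funext => u /=; congr (lin2 a b (W _ w)).
by apply/esym/max_idPr; rewrite le_min x0 le_max lexx.
Qed.

Lemma measurable_exp_bm_comp a b (f : T -> R) : measurable_fun setT f ->
  (forall w, 0 <= f w) -> measurable_fun setT (fun w => exp_bm W a b (f w) w).
Proof.
move=> mf f0.
apply: (measurableT_comp (@measurable_expR R)); apply: measurable_funB; last first.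
  by apply: measurable_funM => //; apply: measurable_funM.
have mj : measurable_fun (setT : set (R * T)%type)
    (fun z => lin2 a b (W (Num.max 0 z.1) z.2)).
  apply: (@caratheodory_measurable R _ T (fun u w => lin2 a b (W (Num.max 0 u) w))).
    by move=> u; exact: (measurableT_comp (measurable_lin2 a b)).
  by move=> w; exact: continuous_Rplus_clamp (@bm_continuous_lin2 _ _ _ _ _ hW a b w).
have := measurableT_comp mj (measurable_fun_pair mf (@measurable_id _ T setT)).
apply: eq_measurable_fun => w _ /=.
by congr (lin2 a b (W _ w)); apply/max_idPr.
Qed.

Variables (tau : T -> R) (A : set T) (x : R).
Hypothesis mtau : measurable_fun setT tau.
Hypothesis tau0 : forall w, 0 <= tau w.
Hypothesis mA : measurable A.
Hypothesis FA : forall y, 0 <= y ->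
  natural_filtration P W y (A `&` [set w | tau w <= y]).
Hypothesis x0 : 0 < x.

Let u (m k : nat) : R := x * (minn k (2 ^ m))%:R / 2 ^+ m.
Let B := A `&` [set w | tau w <= x].
Let F m k := A `&` [set w | tau w <= u m k].
(** For [0 <= v <= x], the index of the first grid point not before [v]. The inner maximum makes it
    monotone on the whole line, hence measurable. As [u] is capped at [x], [taum] equals [x] where
    [tau] exceeds [x]. *)
Let idx (m : nat) (v : R) : nat := `|Num.ceil (Num.max (0:R) v * 2 ^+ m / x)%R|%N.
Let taum m w := u m (idx m (tau w)).

Let p2 (m : nat) : 0 < 2 ^+ m :> R. Proof. exact: exprn_gt0. Qed.

Let u0 m k : 0 <= u m k.
Proof. by rewrite /u divr_ge0 ?mulr_ge0 ?(ltW x0) ?(ltW (p2 _)). Qed.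

Let ux m k : u m k <= x.
Proof. by rewrite /u ler_pdivrMr// ler_pM2l// -natrX ler_nat geq_minr. Qed.

Let ndu m j k : (j <= k)%N -> u m j <= u m k.
Proof.
move=> jk; rewrite /u ler_pM2r ?invr_gt0// ler_pM2l// ler_nat.
by rewrite leq_min geq_minr andbT (leq_trans (geq_minl _ _)).
Qed.

Let idxP m (v : R) : 0 <= v -> ((idx m v)%:R - 1 < v * 2 ^+ m / x <= (idx m v)%:R).
Proof.
move=> v0; rewrite /idx (max_r v0).
have h0 : 0 <= v * 2 ^+ m / x.
  by rewrite divr_ge0 ?mulr_ge0 ?(ltW x0) ?(ltW (p2 _)).
have c0 : 0 <= Num.ceil (v * 2 ^+ m / x).
  by rewrite ceil_ge0 (lt_le_trans _ h0)// ltrN10.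
rewrite natr_absz ger0_norm//.
by have := ceil_itv (v * 2 ^+ m / x); rewrite intrD.
Qed.

Let le_idx m (v : R) k : 0 <= v -> v <= x -> (v <= u m k) = (idx m v <= k)%N.
Proof.
move=> v0 vx; have /andP[h1 h2] := idxP m v0.
rewrite ltr_pdivlMr// in h1; rewrite ler_pdivrMr// in h2.
have i2 : (idx m v <= 2 ^ m)%N.
  rewrite -ltnS -(ltr_nat R) -natr1 natrX -ltrBlDr -(ltr_pM2r x0).
  apply: lt_le_trans h1 _; rewrite mulrC ler_pM2l//.
rewrite /u ler_pdivlMr//; apply/idP/idP => h.
  have : (idx m v)%:R - 1 < (minn k (2 ^ m))%:R :> R.
    by rewrite -(ltr_pM2r x0); apply: lt_le_trans h1 _; rewrite [leRHS]mulrC.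
  rewrite ltrBlDr natr1 ltr_nat ltnS => /leq_trans; apply; exact: geq_minl.
apply: le_trans h2 _; rewrite mulrC ler_pM2l// ler_nat.
by rewrite leq_min h i2.
Qed.

Let BF m : B = \bigcup_k F m k.
Proof.
apply/seteqP; split => [w [Aw tw]|w [k _ [Aw tw]]].
  by exists (idx m (tau w)) => //; split => //=; rewrite le_idx.
by split => //=; apply: le_trans (ux m k).
Qed.

Let seqDU_idx m k w : seqDU (F m) k w -> idx m (tau w) = k.
Proof.
move=> [[Aw tw] nF]; apply/eqP; rewrite eqn_leq -le_idx//; last exact: le_trans (ux m k).
rewrite tw/= leqNgt; apply/negP => ik; apply: nF.
rewrite -bigcup_mkord; exists (idx m (tau w)) => //; split => //=.
by rewrite le_idx// (le_trans tw).
Qed.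

Let mtaum m : measurable_fun setT (taum m).
Proof.
rewrite (_ : taum m = (fun v => u m (idx m v)) \o tau)//.
apply: measurableT_comp => //; apply: nondecreasing_measurable => //.
move=> v v' vv'; apply: ndu; rewrite /idx.
have vv : Num.max 0 v * 2 ^+ m / x <= Num.max 0 v' * 2 ^+ m / x.
  rewrite ler_pM2r ?invr_gt0// ler_pM2r//.
  by rewrite ge_max le_max lexx/= le_max vv' orbT.
have c0 (z : R) : 0 <= z -> 0 <= Num.ceil z :> int.
  by move=> z0; rewrite ceil_ge0 (lt_le_trans _ z0)// ltrN10.
have h0 (z : R) : 0 <= Num.max 0 z * 2 ^+ m / x.
  by rewrite divr_ge0 ?mulr_ge0 ?(ltW x0) ?(ltW (p2 _))// le_max lexx.
by rewrite -lez_nat !gez0_abs ?c0// le_ceil.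
Qed.

Let FB m k : natural_filtration P W (u m k) (seqDU (F m) k).
Proof.
have FF j : (j <= k)%N -> natural_filtration P W (u m k) (F m j).
  by move=> jk; exact: sub_natural_filtration (ndu m jk) _ (FA (u0 m j)).
rewrite natural_filtrationE; apply: measurableD; first exact: FF.
by apply: bigsetU_measurable => j _; exact: (FF j (ltnW (ltn_ord j))).
Qed.

Let mBk m k : measurable (seqDU (F m) k).
Proof. apply: (@natural_filtration_measurable _ _ _ P W (u m k)); exact: FB. Qed.

Let mM a b y : measurable_fun setT (fun w => (exp_bm W a b y w)%:E).
Proof. by apply/measurable_EFinP; exact: measurable_exp_bm. Qed.

Let mMt a b m : measurable_fun setT (fun w => (exp_bm W a b (taum m w) w)%:E).
Proof.
apply/measurable_EFinP; apply: measurable_exp_bm_comp; first exact: mtaum.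
by move=> w; exact: u0.
Qed.

(** [B] splits into the events [seqDU (F m) k], on which [taum] is the constant [u m k]. Each of
    them is known at that time, so the martingale property applies piece by piece. *)
Let optional_stopping_grid a b m :
  (\int[P]_(w in B) (exp_bm W a b (taum m w) w)%:E =
   \int[P]_(w in B) (exp_bm W a b x w)%:E)%E.
Proof.
rewrite (BF m) seqDU_bigcup_eq.
have e0 y w : (0 <= (exp_bm W a b y w)%:E)%E by rewrite lee_fin expR_ge0.
have tD : trivIset setT (seqDU (F m)) by exact: trivIset_seqDU.
have mU : measurable (\bigcup_k seqDU (F m) k).
  by apply: bigcupT_measurable => k; exact: mBk.
have I f : measurable_fun setT f -> (forall w, 0 <= f w)%E ->
    (\int[P]_(w in \bigcup_k seqDU (F m) k) f w =
     \sum_(0 <= k <oo) \int[P]_(w in seqDU (F m) k) f w)%E.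
  move=> mf f0; apply: (ge0_integral_bigcup P (mBk m)) => //.
  exact: measurable_funTS.
rewrite (I _ (mMt a b m)) ?(I _ (mM a b x)); last 2 first.
- by move=> w; exact: e0.
- by move=> w; exact: e0.
apply: eq_eseriesr => k _.
rewrite (exp_bm_martingale hW a b (u0 m k) (ux m k) (@FB m k)).
apply: eq_integral => w; rewrite inE => hw.
by rewrite /taum (seqDU_idx hw).
Qed.

(** On [B] the grid times [taum] decrease to [tau]; continuity of paths gives convergence of the
    integrands, and a second moment bound that of the integrals. *)
Lemma optional_stopping a b :
  (\int[P]_(w in A `&` [set w | (tau w <= x)%R]) (exp_bm W a b (tau w) w)%:E =
   \int[P]_(w in A `&` [set w | (tau w <= x)%R]) (exp_bm W a b x w)%:E)%E.
Proof.
have mB : measurable B by exact: natural_filtration_measurable (FA (ltW x0)).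
have e0 a' b' y w : (0 <= (exp_bm W a' b' y w)%:E)%E by rewrite lee_fin expR_ge0.
have le1 a' b' : (\int[P]_(w in B) (exp_bm W a' b' x w)%:E <= 1)%E.
  rewrite -(integral_exp_bm hW a' b' (ltW x0)).
  exact: ge0_subset_integral.
have qf : (\int[P]_(w in B) (exp_bm W a b x w)%:E \is a fin_num)%E.
  rewrite ge0_fin_numE ?(le_lt_trans (le1 _ _)) ?ltry//.
  exact: integral_ge0.
rewrite -/B -[RHS](fineK qf).
apply: (@L2_bounded_cvg_integral _ _ _ _ _ (fun m w => exp_bm W a b (taum m w) w)
  _ _ (expR ((a ^+ 2 + b ^+ 2) * x))) => //.
- by move=> m; apply: measurable_exp_bm_comp; [exact: mtaum|move=> w; exact: u0].
- exact: measurable_exp_bm_comp.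
- by move=> m w; exact: expR_ge0.
- by move=> w; exact: expR_ge0.
- move=> w [Aw tw].
  have ct : taum m w @[m --> \oo] --> tau w.
    apply/cvgrPdist_lt => e e0'; have [M Me] := dyadic_approx x0 e0'.
    exists M => // m /= Mm.
    have lem : tau w <= taum m w by rewrite /taum le_idx.
    rewrite distrC ger0_norm ?subr_ge0//; apply: le_lt_trans Me.
    apply: (@le_trans _ _ (x / 2 ^+ m)); last first.
      by rewrite ler_pM2l// lef_pV2 ?posrE// ler_weXn2l// ler1n.
    have /andP[h1 _] := idxP m (tau0 w).
    rewrite ltr_pdivlMr// in h1.
    rewrite lerBlDr /taum /u -[leRHS](mulfK (lt0r_neq0 (p2 m))) ler_pM2r ?invr_gt0//.
    rewrite mulrDl divfK ?gt_eqF//.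
    apply: (@le_trans _ _ (x * (idx m (tau w))%:R)); first by rewrite ler_pM2l// ler_nat geq_minl.
    by move: h1; lra.
  have cexp : {within `[0, +oo[%classic, continuous (fun y => exp_bm W a b y w)}.
    apply/subspace_continuousP => y y0'.
    have /subspace_continuousP/(_ y y0') cy := @bm_continuous_lin2 _ _ _ _ _ hW a b w.
    apply: (@cvg_comp _ _ _ _ expR _ _ _ _ (@continuous_expR R _)).
    apply: cvgB => //; apply: cvgM; last exact: cvg_cst.
    by apply: cvgM; [exact: cvg_cst|exact: cvg_within].
  have /within_continuous_ballP cb := cexp.
  have tI : `[0, +oo[%classic (tau w) by rewrite /= in_itv/= andbT.
  apply/cvgrPdist_lt => e e0'; have [r r0 rP] := cb _ tI e e0'.
  have /cvgrPdist_lt/(_ r r0) := ct; apply: filterS => m hm.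
  rewrite distrC; apply: rP; last by rewrite distrC.
  by rewrite /= in_itv/= andbT; exact: u0.
- by move=> m; rewrite optional_stopping_grid fineK.
- move=> m.
  (* Squaring doubles the coefficients, which quadruples the compensator instead of doubling it; the
     difference is the deterministic factor. *)
  have sqE y w : exp_bm W a b y w ^+ 2 =
      expR ((a ^+ 2 + b ^+ 2) * y) * exp_bm W (2 * a) (2 * b) y w.
    rewrite /exp_bm -expRM_natl -expRD /lin2; congr expR.
    by field.
  apply: (@le_trans _ _ (\int[P]_(w in B) ((expR ((a ^+ 2 + b ^+ 2) * x))%:E *
      (exp_bm W (2 * a) (2 * b) (taum m w) w)%:E))%E).
    apply: ge0_le_integral => //.
    - by move=> w _; rewrite lee_fin sqr_ge0.
    - apply/measurable_EFinP; apply: measurable_funTS; apply: measurable_funX.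
      by apply: measurable_exp_bm_comp; [exact: mtaum|move=> w; exact: u0].
    - apply: emeasurable_funM => //; exact: measurable_funTS.
    - move=> w _; rewrite sqE -EFinM lee_fin ler_wpM2r ?expR_ge0// ler_expR.
      by apply: ler_wpM2l; [rewrite addr_ge0 ?sqr_ge0|exact: ux].
  rewrite ge0_integralZl//; last exact: measurable_funTS.
  rewrite optional_stopping_grid -[leRHS]mule1 lee_wpmul2l//.
Qed.

End optional_stopping.

(** * Hölder continuity of Brownian paths *)

Section dyadic_holder.
Context {R : realType}.
Variables (w : R -> R) (L : nat) (la : R) (n0 : nat).
Hypothesis cw : {within `[0, +oo[%classic, continuous w}.
Hypothesis la0 : 0 < la.

Let r : R := 2^-1 `^ la.

Hypothesis incr_w : forall n k, (n0 <= n)%N -> (k < L * 2 ^ n)%N ->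
  `|w (k.+1%:R / 2 ^+ n) - w (k%:R / 2 ^+ n)| <= r ^+ n.

Let r0 : 0 < r. Proof. by rewrite powR_gt0// invr_gt0. Qed.

Let r1 : r < 1.
Proof.
have <- : 1 `^ la = 1 :> R by rewrite powR1.
rewrite /r; apply: gt0_ltr_powR => //; rewrite ?nnegrE ?invr_ge0//.
by rewrite invf_lt1// ltr1n.
Qed.

Let p2 (m : nat) : 0 < 2 ^+ m :> R. Proof. exact: exprn_gt0. Qed.

Let tr (n : nat) (t : R) : nat := Num.truncn (2 ^+ n * t).
Let wn (n : nat) (t : R) : R := w ((tr n t)%:R / 2 ^+ n).

Let trP n (t : R) : 0 <= t -> (tr n t)%:R <= 2 ^+ n * t < (tr n t).+1%:R.
Proof. by move=> t0; apply: truncn_itv; rewrite mulr_ge0// ltW. Qed.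

Let tr_ltL n (t : R) k : t <= L%:R -> (k.+1%:R <= 2 ^+ n * t) -> (k < L * 2 ^ n)%N.
Proof.
move=> tL kt; rewrite -(ler_nat R) (le_trans kt)// natrM natrX mulrC.
by rewrite ler_pM2r.
Qed.

(** The left dyadic approximations of [t] at the levels [n] and [n.+1] coincide or are neighbours at
    level [n.+1]. *)
Let wn_step n (t : R) : (n0 <= n)%N -> 0 <= t -> t <= L%:R ->
  `|wn n.+1 t - wn n t| <= r ^+ n.+1.
Proof.
move=> nn t0 tL; rewrite /wn.
have /andP[a1 a2] := trP n t0; have /andP[b1 b2] := trP n.+1 t0.
have E : (tr n t)%:R / 2 ^+ n = (2 * tr n t)%:R / 2 ^+ n.+1 :> R.
  by rewrite natrM exprS; field; rewrite gt_eqF.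
rewrite E.
have l1 : (2 * tr n t <= tr n.+1 t)%N.
  rewrite -ltnS -(ltr_nat R) natrM; apply: le_lt_trans b2.
  by rewrite exprS -mulrA ler_pM2l.
have l2 : (tr n.+1 t < (2 * tr n t).+2)%N.
  rewrite -(ltr_nat R); apply: le_lt_trans b1 _.
  have -> : (2 * tr n t).+2 = (2 * (tr n t).+1)%N by rewrite mulnS.
  by rewrite natrM exprS -mulrA ltr_pM2l.
have [->|e] : tr n.+1 t = (2 * tr n t)%N \/ tr n.+1 t = (2 * tr n t).+1.
  move: l2; rewrite ltnS leq_eqVlt => /predU1P[->|]; first by right.
  by rewrite ltnS => l2; left; apply/eqP; rewrite eqn_leq l2.
  by rewrite subrr normr0 exprn_ge0// ltW.
rewrite e; apply: incr_w; first exact: leqW.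
by apply: (tr_ltL tL); rewrite -e.
Qed.

Let wn_cauchy n j (t : R) : (n0 <= n)%N -> 0 <= t -> t <= L%:R ->
  `|wn (n + j) t - wn n t| <= r ^+ n * (1 - r ^+ j) / (1 - r).
Proof.
move=> nn t0 tL; have r1' : 1 - r != 0 by rewrite subr_eq0 gt_eqF.
elim: j => [|j IH]; first by rewrite addn0 subrr normr0 expr0 subrr mulr0 mul0r.
have -> : wn (n + j.+1) t - wn n t =
    (wn (n + j).+1 t - wn (n + j) t) + (wn (n + j) t - wn n t).
  by rewrite addnS addrA subrK.
apply: le_trans (ler_normD _ _) _.
apply: le_trans (lerD (wn_step (leq_trans nn (leq_addr j n)) t0 tL) IH) _.
rewrite exprS exprD [r ^+ j.+1]exprS.
have rn : 0 <= r ^+ n * r ^+ j by rewrite mulr_ge0// exprn_ge0// ltW.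
rewrite -subr_ge0.
have -> : r ^+ n * (1 - r * r ^+ j) / (1 - r) - (r * (r ^+ n * r ^+ j) +
    r ^+ n * (1 - r ^+ j) / (1 - r)) = (r ^+ n * r ^+ j) * (1 - r) by field.
by rewrite mulr_ge0// subr_ge0 ltW.
Qed.

Let wn_lim (t : R) : 0 <= t -> wn n t @[n --> \oo] --> w t.
Proof.
move=> t0; have /within_continuous_ballP cb := cw.
have tI : `[0, +oo[%classic t by rewrite /= in_itv/= t0.
apply/cvgrPdist_lt => e e0; have [d d0 dP] := cb t tI e e0.
have [M Mr] := dyadic_approx (@ltr01 R) d0.
exists M => // n /= Mn; rewrite distrC; apply: dP.
  by rewrite /= in_itv/= andbT divr_ge0// ltW.
have /andP[a1 a2] := trP n t0.
apply: le_lt_trans Mr; apply: (@le_trans _ _ (1 / 2 ^+ n)); last first.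
  by rewrite !mul1r lef_pV2 ?posrE// ler_weXn2l// ler1n.
rewrite distrC ger0_norm; last by rewrite subr_ge0 ler_pdivrMr// mulrC.
rewrite lerBlDr -mulrDl ler_pdivlMr// mulrC addrC.
by rewrite natr1 ltW.
Qed.

Let w_wn n (t : R) : (n0 <= n)%N -> 0 <= t -> t <= L%:R ->
  `|w t - wn n t| <= r ^+ n / (1 - r).
Proof.
move=> nn t0 tL.
have r1' : 0 < 1 - r by rewrite subr_gt0.
have h : `|wn (n + j) t - wn n t| @[j --> \oo] --> `|w t - wn n t|.
  apply: cvg_norm; apply: cvgB; last exact: cvg_cst.
  have -> : (fun j => wn (n + j) t) = (fun j => wn (j + n) t).
    by apply/funext => j; rewrite addnC.
  by rewrite (cvg_shiftn n (wn ^~ t)); exact: wn_lim.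
rewrite -(cvg_lim _ h)//; apply: limr_le; first exact: cvgP h.
apply: nearW => j.
apply: le_trans (wn_cauchy j nn t0 tL) _.
rewrite ler_pM2r ?invr_gt0// ler_piMr ?exprn_ge0 ?(ltW r0)//.
by rewrite gerBl exprn_ge0// ltW.
Qed.

(** Points at distance at most [2 ^ (- n)] have equal or neighbouring approximations at level [n];
    each of the two remainders is a geometric tail. *)
Let small n (s t : R) : (n0 <= n)%N -> 0 <= s -> s < t -> t <= L%:R ->
  t - s <= 1 / 2 ^+ n -> `|w t - w s| <= r ^+ n * (1 + 2 / (1 - r)).
Proof.
move=> nn s0 st tL ts.
have t0 : 0 <= t by rewrite (le_trans s0)// ltW.
have sL : s <= L%:R by rewrite (le_trans _ tL)// ltW.
have r1' : 0 < 1 - r by rewrite subr_gt0.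
have hs := w_wn nn s0 sL; have ht := w_wn nn t0 tL.
have /andP[a1 a2] := trP n t0; have /andP[b1 b2] := trP n s0.
have l1 : (tr n s <= tr n t)%N.
  rewrite -ltnS -(ltr_nat R); apply: le_lt_trans b1 _; apply: le_lt_trans a2.
  by rewrite ler_pM2l// ltW.
have l2 : (tr n t < (tr n s).+2)%N.
  rewrite -(ltr_nat R); apply: le_lt_trans a1 _.
  rewrite -natr1; have : 2 ^+ n * (t - s) <= 1 by rewrite mulrC -ler_pdivlMr.
  by rewrite mulrBr; move: b2; lra.
have hts : `|wn n t - wn n s| <= r ^+ n.
  rewrite /wn.
  have [->|e] : tr n t = tr n s \/ tr n t = (tr n s).+1.
    move: l2; rewrite ltnS leq_eqVlt => /predU1P[->|]; first by right.
    by rewrite ltnS => l2; left; apply/eqP; rewrite eqn_leq l2.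
    by rewrite subrr normr0 exprn_ge0// ltW.
  by rewrite e; apply: incr_w => //; apply: (tr_ltL tL); rewrite -e.
have -> : w t - w s = (w t - wn n t) + (wn n t - wn n s) - (w s - wn n s) by ring.
apply: le_trans (ler_normB _ _) _.
apply: le_trans (lerD (ler_normD _ _) (lexx _)) _.
apply: le_trans (lerD (lerD ht hts) hs) _.
by rewrite le_eqVlt; apply/orP; left; apply/eqP; field; rewrite gt_eqF.
Qed.

Lemma holder_of_dyadic : exists2 C, 0 <= C & forall s t, 0 <= s -> s < t ->
  t <= L%:R -> `|w t - w s| <= C * (t - s) `^ la.
Proof.
have cN : {within `[0, L%:R], continuous (fun t => - `|w t|)}.
  move=> t; apply: cvgN; apply: cvg_norm.
  apply: (continuous_subspaceW _ cw) => u /=.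
  by rewrite !in_itv/= => /andP[->].
have [c _ cP] := EVT_min (ler0n _ _) cN.
pose M := `|w c|.
have MP t : 0 <= t -> t <= L%:R -> `|w t| <= M.
  by move=> t0 tL; rewrite -lerN2; apply: cP; rewrite in_itv/= t0.
have r1' : 0 < 1 - r by rewrite subr_gt0.
(* For close points the level [n] has [2 ^ (- n - 1) < t - s <= 2 ^ (- n)]; the factor [r^-1] pays
   for passing from [r ^+ n] to [r ^+ n.+1]. *)
pose C1 := r^-1 * (1 + 2 / (1 - r)).
have C10 : 0 <= C1.
  by rewrite mulr_ge0 ?invr_ge0 ?(ltW r0)// addr_ge0// divr_ge0// ltW.
have rE n : r ^+ n = (1 / 2 ^+ n) `^ la.
  have h2 : 0 <= 2^-1 :> R by rewrite invr_ge0.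
  by rewrite mul1r -exprVn -(powR_mulrn n h2) powRAC powR_mulrn// powR_ge0.
have rn0 : 0 < r ^+ n0 by exact: exprn_gt0.
(* For points further apart than [2 ^ (- n0)] the bound [2 * M] suffices, as [(t - s) ^ la] is at
   least [r ^+ n0]. *)
pose C2 := 2 * M / r ^+ n0.
have C20 : 0 <= C2 by rewrite divr_ge0 ?(ltW rn0)// mulr_ge0// normr_ge0.
exists (C1 + C2); first exact: addr_ge0.
move=> s t s0 st tL.
have ts0 : 0 < t - s by rewrite subr_gt0.
have pw0 : 0 <= (t - s) `^ la by exact: powR_ge0.
have [big|sm] := ltP (1 / 2 ^+ n0) (t - s).
  apply: (@le_trans _ _ (C2 * (t - s) `^ la)); last by rewrite ler_wpM2r// lerDr.
  apply: (@le_trans _ _ (C2 * r ^+ n0)).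
    rewrite /C2 divfK ?gt_eqF// mulr_natl mulr2n (le_trans (ler_normB _ _))// lerD// MP//.
      by rewrite (le_trans s0)// ltW.
    by rewrite (le_trans _ tL)// ltW.
  rewrite ler_wpM2l// rE; apply: ge0_ler_powR; rewrite ?nnegrE ?(ltW la0) ?(ltW ts0) ?(ltW big)//.
have exm : exists m, 1 / 2 ^+ m < t - s by exact: dyadic_approx.
have [n [nn n1 n2]] : exists n, [/\ (n0 <= n)%N, t - s <= 1 / 2 ^+ n & 1 / 2 ^+ n.+1 < t - s].
  have [m' m'P m'min] := ex_minnP exm.
  have m'n0 : (n0 < m')%N.
    rewrite ltnNge; apply/negP => h; have := lt_le_trans m'P sm.
    by rewrite !mul1r ltf_pV2 ?posrE// ltr_eXn2l ?ltr1n// ltnNge h.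
  case: m' m'P m'min m'n0 => // n nP nmin nn; exists n; split => //.
  rewrite leNgt; apply/negP => /nmin; by rewrite ltnn.
apply: le_trans (small nn s0 st tL n1) _.
apply: (@le_trans _ _ (C1 * (t - s) `^ la)); last by rewrite ler_wpM2r// lerDl.
rewrite /C1 mulrAC ler_wpM2r//; first by rewrite addr_ge0// divr_ge0// ltW.
rewrite mulrC -ler_pdivrMr ?invr_gt0// invrK -exprSr rE.
apply: ge0_ler_powR; rewrite ?nnegrE ?(ltW la0) ?(ltW ts0) ?(ltW n2)//.
Qed.

End dyadic_holder.

Lemma expR_gtX {R : realType} (z : R) (j : nat) : 0 <= z -> (0 < j)%N ->
  (z / j%:R) ^+ j <= expR z.
Proof.
move=> z0 j0; have jn : j%:R != 0 :> R by rewrite pnatr_eq0 -lt0n.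
have -> : expR z = expR (z / j%:R) ^+ j.
  by rewrite -expRM_natl mulrC divfK.
apply: lerXn2r; rewrite ?nnegrE ?expR_ge0 ?divr_ge0//.
by apply: le_trans (expR_ge1Dx _); rewrite lerDr.
Qed.

(** * Dyadic increments and Borel-Cantelli *)

Section kolmogorov.
Context {R : realType} d (T : measurableType d) (P : probability T R).
Variable W : R -> {RV P >-> (R * R)%type}.
Hypothesis hW : brownian_motion2 W.

Lemma incr_tail (e c s t : R) : e ^+ 2 = 1 -> 0 < c -> 0 <= s -> s < t ->
  (P [set w | (c <= e * ((W t w).2 - (W s w).2))%R] <=
   (expR (- (c ^+ 2 / (2 * (t - s)))))%:E)%E.
Proof.
move=> e2 c0 s0 st; pose h := t - s; have h0 : 0 < h by rewrite subr_gt0.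
(* The exponent minimizing the Chernoff bound [la ^+ 2 * h / 2 - la * c]. *)
pose la := c / h.
have mD : measurable_fun setT (fun w => e * ((W t w).2 - (W s w).2)).
  apply: measurable_funM => //.
  exact: (measurableT_comp measurable_snd (measurable_incr W s t)).
have mE : measurable [set w | c <= e * ((W t w).2 - (W s w).2)].
  have := mD measurableT `[c, +oo[%classic (measurable_itv _).
  rewrite setTI; congr measurable; apply/seteqP.
  by split => w /=; rewrite in_itv/= andbT.
have la0 : 0 < la by rewrite divr_gt0.
have : ((expR (la * c))%:E * P [set w | (c <= e * ((W t w).2 - (W s w).2))%R] <=
    (expR (la ^+ 2 * h / 2))%:E)%E.
  have -> : la ^+ 2 * h / 2 = (0 ^+ 2 + (la * e) ^+ 2) * (t - s) / 2.
    by rewrite expr0n/= add0r [(la * e) ^+ 2]exprMn e2 mulr1.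
  rewrite -(incr_mgf hW 0 (la * e) s0 st) -integral_cst//.
  apply: (@le_trans _ _ (\int[P]_(w in [set w | (c <= e * ((W t w).2 - (W s w).2))%R])
    (expR (lin2 0 (la * e) (W t w - W s w)))%:E)%E).
    apply: ge0_le_integral => //.
    - by move=> w _; rewrite lee_fin expR_ge0.
    - apply: measurable_funTS.
      exact: (measurableT_comp (measurable_expR_lin2 0 (la * e)) (measurable_incr W s t)).
    - move=> w /= cw; rewrite lee_fin ler_expR /lin2 mul0r add0r -mulrA.
      by rewrite ler_wpM2l// ltW.
  apply: ge0_subset_integral => //.
  exact: (measurableT_comp (measurable_expR_lin2 0 (la * e)) (measurable_incr W s t)).
rewrite muleC -lee_pdivlMr ?expR_gt0// -expRN -EFinM -expRD.
move=> /le_trans; apply; rewrite lee_fin ler_expR le_eqVlt.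
by apply/orP; left; apply/eqP; rewrite /la -/h; field; rewrite gt_eqF.
Qed.

(** Failure at level [n] of the hypothesis [incr_w] of [holder_of_dyadic]. *)
Let bad (la : R) (L n : nat) : set T := \bigcup_(k < L * 2 ^ n)
  [set w | ((2^-1 `^ la) ^+ n <= `|(W (k.+1%:R / 2 ^+ n) w).2 - (W (k%:R / 2 ^+ n) w).2|)%R].

(** Union bound over the increments and both signs. With height [2 ^ (- la n)] and time step
    [2 ^ (- n)] the Gaussian exponent is [2 ^ ((1 - 2 la) n) / 2]. *)
Let bad_le la L n : 0 < la ->
  measurable (bad la L n) /\
  (P (bad la L n) <= ((L * 2 ^ n)%:R * (2 * expR (- ((2 `^ (1 - 2 * la)) ^+ n / 2))))%:E)%E.
Proof.
move=> la0.
have p2 : 0 < 2 ^+ n :> R by exact: exprn_gt0.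
pose c : R := (2^-1 `^ la) ^+ n.
have c0 : 0 < c by rewrite exprn_gt0// powR_gt0// invr_gt0.
pose D k w := (W (k.+1%:R / 2 ^+ n) w).2 - (W (k%:R / 2 ^+ n) w).2.
pose E (k : nat) : set T := [set w | c <= `|D k w|].
have mD k : measurable_fun setT (D k).
  exact: (measurableT_comp measurable_snd (measurable_incr W _ _)).
have mE (e : R) k : measurable [set w | c <= e * D k w].
  have := measurable_funM (measurable_cst (e : R)) (mD k).
  move=> /(_ measurableT `[c, +oo[%classic (measurable_itv _)).
  rewrite setTI; congr measurable; apply/seteqP.
  by split => w /=; rewrite in_itv/= andbT.
have EE k : E k = [set w | c <= 1 * D k w] `|` [set w | c <= -1 * D k w].
  apply/seteqP; split => w; rewrite /E/= mul1r mulN1r ler_normr => /orP//.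
have mEk k : measurable (E k) by rewrite EE; exact: measurableU.
have PE k : (P (E k) <= (2 * expR (- ((2 `^ (1 - 2 * la)) ^+ n / 2)))%:E)%E.
  have kk : (k%:R / 2 ^+ n : R) < k.+1%:R / 2 ^+ n by rewrite ltr_pM2r ?invr_gt0// ltr_nat.
  have k0 : 0 <= (k%:R / 2 ^+ n : R) by rewrite divr_ge0// ltW.
  have hc : c ^+ 2 / (2 * (k.+1%:R / 2 ^+ n - k%:R / 2 ^+ n)) =
      (2 `^ (1 - 2 * la)) ^+ n / 2.
    have -> : k.+1%:R / 2 ^+ n - k%:R / 2 ^+ n = (2 ^+ n)^-1 :> R.
      by rewrite -natr1 mulrDl mul1r addrC addKr.
    have -> : 2 `^ (1 - 2 * la) = 2 * (2^-1 `^ la) ^+ 2 :> R.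
      have t0 : 0 <= 2 :> R by [].
      rewrite powRD; last by rewrite pnatr_eq0 implybT.
      rewrite powRr1// -(powR_mulrn 2 (powR_ge0 _ _)) -powRrM -(powR_inv1 t0) -powRrM.
      by congr (_ * 2 `^ _); ring.
    by rewrite exprMn -exprM mulnC exprM /c; field; rewrite gt_eqF.
  have m1 : (-1) ^+ 2 = 1 :> R by rewrite sqrrN expr1n.
  rewrite EE; apply: le_trans (measureU2 _ (mE _ _) (mE _ _)) _.
  rewrite mulrDl mul1r EFinD; apply: leeD.
    by have := incr_tail (expr1n _ 2) c0 k0 kk; rewrite hc.
  by have := @incr_tail (-1) _ _ _ m1 c0 k0 kk; rewrite hc.
have badE : bad la L n = \big[setU/set0]_(k < L * 2 ^ n) E k.
  by rewrite /bad bigcup_mkord.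
split; first by rewrite badE; apply: bigsetU_measurable.
rewrite badE.
apply: le_trans (Boole_inequality _ _) _ => //.
apply: (@le_trans _ _ (\sum_(k < L * 2 ^ n)
  (2 * expR (- ((2 `^ (1 - 2 * la)) ^+ n / 2)))%:E)%E).
  by apply: lee_sum => k _; exact: PE.
rewrite sumEFin sumr_const card_ord lee_fin.
by move: (_ * expR _) => z; rewrite mulr_natl.
Qed.

(** For [la < 1/2] the base [q] exceeds 1, so the bad events have summable probabilities, and almost
    every path avoids them from some level on. *)
Lemma bm_holder (la : R) (L : nat) : 0 < la -> la < 2^-1 ->
  {ae P, forall w, exists2 C, 0 <= C & forall s t, 0 <= s -> s < t ->
    t <= L%:R -> `|(W t w).2 - (W s w).2| <= C * (t - s) `^ la}.
Proof.
move=> la0 la2.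
have mb n : measurable (bad la L n) by have [] := bad_le L n la0.
pose q : R := 2 `^ (1 - 2 * la).
have q1 : 1 < q.
  rewrite /q /powR pnatr_eq0/= expR_gt1 mulr_gt0 ?ln_gt0 ?ltr1n//.
  by rewrite subr_gt0 mulrC -ltr_pdivlMr// mul1r.
have q0 : 0 < q by exact: lt_trans q1.
have qE (j : nat) : q ^+ j = 2 `^ ((1 - 2 * la) * j%:R).
  by rewrite powRrM powR_mulrn// powR_ge0.
have la12 : 0 < 1 - 2 * la by rewrite subr_gt0 mulrC -ltr_pdivlMr// mul1r.
(* The exponential beats the power [j], leaving at least [4 ^ n] in the denominator; against the
   [L * 2 ^ n] increments this is a geometric bound of ratio 1/2. *)
have [j j0 qj] : exists2 j : nat, (0 < j)%N & 4 <= q ^+ j.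
  exists (Num.truncn (2 / (1 - 2 * la))).+1 => //; rewrite qE.
  apply: (@le_trans _ _ (2 `^ 2%:R)); first by rewrite powR_mulrn// expr2 -natrM.
  apply: ler_powR; first by rewrite ler1n.
  by rewrite mulrC -ler_pdivrMr// ltW// truncnS_gt.
pose K : R := L%:R * 2 * (2 * j%:R) ^+ j.
have K0 : 0 <= K by rewrite mulr_ge0 ?exprn_ge0 ?mulr_ge0.
have bK n : (P (bad la L n) <= (geometric K 2^-1 n)%:E)%E.
  have [_ h] := bad_le L n la0; apply: le_trans h _; rewrite lee_fin -/q.
  have qn : 0 < q ^+ n by exact: exprn_gt0.
  have := expR_gtX (ltW (divr_gt0 qn (ltr0Sn R 1))) j0.
  have z0 : 0 < (q ^+ n / 2 / j%:R) ^+ j.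
    by rewrite exprn_gt0// !divr_gt0// ltr0n.
  rewrite -lef_pV2 ?posrE ?expR_gt0// -expRN => h.
  have h2 : expR (- (q ^+ n / 2)) <= (2 * j%:R) ^+ j / 4 ^+ n.
    apply: le_trans h _.
    have -> : ((q ^+ n / 2 / j%:R) ^+ j)^-1 = (2 * j%:R) ^+ j / (q ^+ j) ^+ n.
      have -> : (q ^+ j) ^+ n = (q ^+ n) ^+ j by rewrite -!exprM mulnC.
      have jn : j%:R != 0 :> R by rewrite pnatr_eq0 -lt0n.
      by rewrite -expr_div_n -exprVn; congr (_ ^+ _); field; rewrite jn gt_eqF.
    rewrite ler_pM2l ?exprn_gt0 ?mulr_gt0 ?ltr0n//.
    rewrite lef_pV2 ?posrE ?exprn_gt0//.
    by apply: lerXn2r; rewrite ?nnegrE ?exprn_ge0 ?(ltW q0).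
  apply: (@le_trans _ _ ((L * 2 ^ n)%:R * (2 * ((2 * j%:R) ^+ j / 4 ^+ n)))).
    by rewrite ler_wpM2l// ler_wpM2l.
  rewrite /geometric /= /K le_eqVlt; apply/orP; left; apply/eqP.
  move: ((2 * j%:R) ^+ j) => J.
  have -> : 4 ^+ n = 2 ^+ n * 2 ^+ n :> R by rewrite -exprMn -natrM.
  by rewrite natrM natrX exprVn; field; rewrite gt_eqF ?exprn_gt0.
have sumbad : (\sum_(n <oo) P (bad la L n) < +oo)%E.
  apply: (@le_lt_trans _ _ (K / (1 - 2^-1))%:E); last exact: ltry.
  apply: lime_le; first by apply: is_cvg_nneseries.
  apply: nearW => n.
  apply: (@le_trans _ _ (\sum_(0 <= i < n) (geometric K 2^-1 i)%:E)%E).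
    by apply: lee_sum => i _; exact: bK.
  rewrite sumEFin lee_fin; apply: (geometric_le_lim n K0) => //.
  by rewrite ger0_norm ?invr_ge0// invf_lt1// ltr1n.
have lim0 := lim_sup_set_cvg0 mb sumbad.
exists (lim_sup_set (bad la L)); split => //.
  by apply: bigcap_measurable => // n _; apply: bigcup_measurable => k _; exact: mb.
move=> w /= hw; apply: contrapT => nw; apply: hw.
have [n0 n0P] : exists n0, forall n, (n0 <= n)%N -> ~ bad la L n w.
  apply: contrapT => /forallNP h; apply: nw => n _.
  have := h n => /existsNP[m] /not_implyP[nm] /contrapT bm.
  by exists m.
apply: (@holder_of_dyadic R (fun t => (W t w).2) L la n0) => //.
  exact: (@bm_continuous2 _ _ _ _ _ hW w).
move=> n k nn kn; rewrite leNgt; apply/negP => hb.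
by apply: (n0P n nn); exists k => //=; exact: ltW.
Qed.

End kolmogorov.

(** * The solution of the random initial value problem *)

Section fractional_path.
Context {R : realType} d (T : measurableType d) (P : probability T R).
Variable W : R -> {RV P >-> (R * R)%type}.
Hypothesis hW : brownian_motion2 W.
Variable al : R.
Hypothesis al0 : 0 < al.
Hypothesis al2 : al < 2^-1.

Local Notation FT x := (g_sigma_algebraType
  (sigma_past W x `|` [set N | measurable N /\ P N = 0%E])).

(** Any exponent strictly between [al], for the Marchaud integral, and 1/2, for Brownian paths,
    would serve. *)
Let la : R := (al + 2^-1) / 2.
Let la0 : 0 < la. Proof. by rewrite divr_gt0// addr_gt0// invr_gt0. Qed.
Let alla : al < la. Proof. by rewrite midf_lt. Qed.
Let la2 : la < 2^-1. Proof. by rewrite midf_lt. Qed.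
Let al1 : al < 1. Proof. by rewrite (lt_trans al2)// invf_lt1// ltr1n. Qed.

(* [W] is unconstrained at negative indices, hence the clamping. *)
Definition path0 (w : T) (u : R) : R := (W (Num.max 0 u) w).2.

Definition regular_path (w : T) : Prop := W 0 w = (0, 0) /\
  forall L : nat, exists2 C, 0 <= C & forall s t, 0 <= s -> s < t ->
    t <= L%:R -> `|(W t w).2 - (W s w).2| <= C * (t - s) `^ la.

Lemma ae_regular_path : {ae P, forall w, regular_path w}.
Proof.
have [W0 _ _ _] := hW.
have h L := bm_holder hW L la0 la2.
have /choice[N hN] : forall L : nat, exists N, [/\ measurable N, P N = 0%E &
    forall w, ~ N w -> exists2 C, 0 <= C & forall s t, 0 <= s -> s < t ->
    t <= L%:R -> `|(W t w).2 - (W s w).2| <= C * (t - s) `^ la].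
  move=> L; have [N [mN N0 sN]] := h L; exists N; split => // w nw.
  by apply: contrapT => hw; exact: nw (sN _ hw).
have [N0 [mN0 N00 sN0]] := W0.
have mN L : measurable (N L) by have [] := hN L.
exists (N0 `|` \bigcup_L N L); split.
- by apply: measurableU => //; exact: bigcupT_measurable.
- apply/eqP; rewrite -measure_le0.
  apply: le_trans (measureU2 _ mN0 (bigcupT_measurable _ mN)) _.
  rewrite [X in (X + _)%E]N00 add0e.
  apply: le_trans (measure_sigma_subadditive _ mN (bigcupT_measurable _ mN) _) _ => //.
  by rewrite eseries0// => n _ _; have [] := hN n.
- move=> w /= hw; apply: contrapT => nw; apply: hw; split.
    by apply: contrapT => hw; apply: nw; left; exact: sN0.
  move=> L; have [_ _] := hN L; apply => NL; apply: nw; right; by exists L.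
Qed.

Lemma continuous_path0 w : continuous (path0 w).
Proof. exact: continuous_Rplus_clamp (@bm_continuous2 _ _ _ _ _ hW w). Qed.

Lemma path0_le0 w u : W 0 w = (0, 0) -> u <= 0 -> path0 w u = 0.
Proof. by move=> W0 u0; rewrite /path0 max_l// W0. Qed.

Lemma holder_path0 w (L : nat) : regular_path w -> exists C,
  forall y s, y <= L%:R -> 0 < s -> s <= L%:R ->
  `|path0 w y - path0 w (y - s)| <= C * s `^ la.
Proof.
move=> [W0 hL]; have [C C0 CP] := hL L; exists C => y s yL s0 sL.
have [y0|y0] := leP y 0.
  rewrite !path0_le0//; first by rewrite subrr normr0 mulr_ge0// powR_ge0.
  by rewrite lerBlDr add0r (le_trans y0)// ltW.
have -> : path0 w y = (W y w).2 by rewrite /path0 max_r// ltW.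
have [ys|ys] := leP (y - s) 0.
  have -> : path0 w (y - s) = (W 0 w).2 by rewrite /path0 max_l.
  apply: le_trans (CP 0 y (lexx 0) y0 yL) _; rewrite subr0 ler_wpM2l//.
  apply: ge0_ler_powR; rewrite ?nnegrE ?(ltW la0) ?(ltW y0) ?(ltW s0)//.
  by rewrite -subr_le0.
have -> : path0 w (y - s) = (W (y - s) w).2 by rewrite /path0 max_r// ltW.
have := CP (y - s) y (ltW ys); rewrite subKr; apply => //.
by rewrite gtrBl.
Qed.

Definition frac_int (w : T) (y : R) : R :=
  (\int[lebesgue_measure]_(u in `[0, y]) ((W u w).2 / (y - u) `^ al))%R.

Lemma frac_int_path0 w y : frac_int w y =
  (\int[lebesgue_measure]_(u in `[0, y]) (path0 w u / (y - u) `^ al))%R.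
Proof.
apply: eq_Rintegral => u; rewrite inE/= in_itv/= => /andP[u0 _].
by rewrite /path0 max_r.
Qed.

Lemma is_derive_frac_int w (L : nat) (y : R) : regular_path w -> (0 < L)%N ->
  y \in `]-1, L%:R[ -> is_derive y 1 (frac_int w) (marchaud (path0 w) al L%:R y).
Proof.
move=> rw L0 yL; have [C CP] := holder_path0 L rw.
rewrite (_ : frac_int w = fun y => \int[lebesgue_measure]_(u in `[0, y])
    (path0 w u / (y - u) `^ al))%R; last by apply/funext => z; exact: frac_int_path0.
apply: (is_derive_frac_integral (@continuous_path0 w) _ al0 al1 alla _ CP yL).
  by move=> u u0; apply: path0_le0 => //; case: rw.
by rewrite ltr0n.
Qed.

Lemma frac_derivativeE w (L : nat) (y : R) : regular_path w -> (0 < L)%N ->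
  0 <= y -> y < L%:R -> frac_derivative al (fun u => (W u w).2) y =
  (Gamma (1 - al))^-1 * marchaud (path0 w) al L%:R y.
Proof.
move=> rw L0 y0 yL; rewrite /frac_derivative; congr (_ * _).
have yI : y \in `]-1, L%:R[ by rewrite in_itv/= yL andbT (lt_le_trans _ y0).
by rewrite derive1E; have [_ <-] := is_derive_frac_int rw L0 yI.
Qed.

Lemma continuous_frac_derivative w (y : R) : regular_path w -> 0 <= y ->
  {within `[0, y], continuous (frac_derivative al (fun u => (W u w).2))}.
Proof.
move=> rw y0; pose L := (Num.truncn y).+1.
have yL : y < L%:R by exact: truncnS_gt.
have [C CP] := holder_path0 L rw.
apply/within_continuous_ballP => z; rewrite /= in_itv/= => /andP[z0 zy] e e0.
have zI : z \in `]-1, L%:R[.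
  by rewrite in_itv/= (lt_le_trans _ z0)//= (le_lt_trans zy).
have cm : {for z, continuous (marchaud (path0 w) al L%:R)}.
  have L0 : 0 < L%:R :> R by rewrite ltr0n.
  exact: (continuous_marchaud (@continuous_path0 w) alla L0 CP zI).
have /cvgrPdist_lt/(_ e e0)[r /= r0 rP] : (Gamma (1 - al))^-1 * marchaud (path0 w) al L%:R u
    @[u --> z] --> (Gamma (1 - al))^-1 * marchaud (path0 w) al L%:R z.
  by apply: cvgM; [exact: cvg_cst|exact: cm].
exists r => // u; rewrite in_itv/= => /andP[u0 uy] uz.
rewrite (@frac_derivativeE w L u)// ?(le_lt_trans uy)//.
rewrite (@frac_derivativeE w L z)// ?(le_lt_trans zy)//.
by rewrite distrC; apply: rP; rewrite /= distrC.
Qed.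

(** Tonelli's theorem, applied to the positive and the negative part. *)
Lemma measurable_Rintegral_param d' (T' : measurableType d') (D : set R)
    (g : R * T' -> R) : measurable D -> measurable_fun setT g ->
  measurable_fun setT (fun w => (\int[lebesgue_measure]_(s in D) g (s, w))%R).
Proof.
move=> mD mg; pose h (z : R * T') : R := g z * \1_D z.1.
have mh : measurable_fun setT h.
  apply: measurable_funM => //.
  exact: (measurableT_comp (measurable_indic mD) measurable_fst).
have hE w : (\int[lebesgue_measure]_(s in D) (g (s, w))%:E =
    \int[lebesgue_measure]_s (h (s, w))%:E)%E.
  rewrite integral_mkcond; apply: eq_integral => s _.
  by rewrite patchE /h indicE /=; case: ifP; rewrite ?mulr1 ?mulr0.
rewrite /Rintegral; under eq_fun do rewrite hE.
apply: (measurableT_comp (fine_measurable measurableT)).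
under eq_fun do rewrite integralE.
have mEh : measurable_fun setT (EFin \o h) by exact/measurable_EFinP.
apply: emeasurable_funB.
  have H := (@measurable_fun_fubini_tonelli_G _ _ (measurableTypeR R) T' R
    lebesgue_measure (EFin \o h)^\+%E (measurable_funepos mEh) (funepos_ge0 _)).
  by apply: eq_measurable_fun H => w _; rewrite /fubini_G; apply: eq_integral => s _; rewrite !funeposE.
have H := (@measurable_fun_fubini_tonelli_G _ _ (measurableTypeR R) T' R
  lebesgue_measure (EFin \o h)^\-%E (measurable_funeneg mEh) (funeneg_ge0 _)).
by apply: eq_measurable_fun H => w _; rewrite /fubini_G; apply: eq_integral => s _; rewrite !funenegE.
Qed.

(** At [y] the Marchaud integral reads the path only at times up to [y], so clamping the times at
    [y] changes nothing and makes this visible. *)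
Lemma measurable_marchaud (L y : R) : 0 <= y ->
  measurable_fun (setT : set (FT y)) (fun w => marchaud (path0 w) al L y).
Proof.
move=> y0.
have mW : measurable_fun (setT : set (R * FT y)%type)
    (fun z => (W (Num.min y (Num.max 0 z.1)) z.2).2).
  have := measurable_clamped_bm hW y0 0 1; apply: eq_measurable_fun => z _.
  by rewrite /lin2 mul0r add0r mul1r.
have mWy : measurable_fun (setT : set (FT y)) (fun w => path0 w y).
  have := measurableT_comp mW (@pair1_measurable _ _ R (FT y) y).
  apply: eq_measurable_fun => w _ /=; rewrite /path0 max_r// min_l//.
apply: measurable_funD; first exact: measurable_funM.
apply: measurable_funM => //.
pose g (z : R * FT y) : R := z.1 `^ (- al - 1) *
   (path0 z.2 y - (W (Num.min y (Num.max 0 (y - z.1))) z.2).2).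
have mg : measurable_fun setT g.
  apply: measurable_funM.
    exact: (measurableT_comp (measurable_powR (- al - 1)) measurable_fst).
  apply: measurable_funB; first exact: (measurableT_comp mWy measurable_snd).
  have m1 : measurable_fun setT (fun z : R * FT y => (y - z.1, z.2)).
    apply: measurable_fun_pair; last exact: measurable_snd.
    by apply: measurable_funB => //; exact: measurable_fst.
  exact: (measurableT_comp mW m1).
have := @measurable_Rintegral_param _ (FT y) `]0, L]%classic g (measurable_itv _) mg.
apply: eq_measurable_fun => w _; apply: eq_Rintegral => s.
rewrite inE/= in_itv/= => /andP[s0 _].
rewrite /g /=; congr (_ * (_ - (W _ w).2)).
by rewrite min_r// ge_max y0/= gerBl ltW.
Qed.

End fractional_path.

Lemma clamp_dist_lt {R : realType} (t p q : R) : q - t < p -> p < q + t ->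
  0 <= q -> q <= 1 -> 0 < t -> `|Num.max 0 (Num.min 1 p) - q| < t.
Proof.
move=> h1 h2 q0 q1 t0; rewrite ltr_norml /Num.min; case: (ltP 1 p) => p1.
  by rewrite max_r//; apply/andP; split; lra.
by rewrite /Num.max; case: (ltP 0 p) => p0; apply/andP; split; lra.
Qed.

Lemma bijection_in_C0_increasing {R : realType} (theta : R -> R) :
  bijection_in_C0 theta -> forall s t, 0 <= s -> s < t -> theta s < theta t.
Proof.
move=> [t0 ct [tf ti _]] s t s0 st.
have I0 : (0 : R) \in `[0, +oo[ by rewrite in_itv/= lexx.
have I1 : (1 : R) \in `[0, +oo[ by rewrite in_itv/= ler01.
have ti' : {in `[0, +oo[ &, injective theta}.
  by move=> x y xI yI; apply: ti; rewrite inE.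
have t01 : theta 0 <= theta 1.
  by rewrite t0; have := tf 1 I1; rewrite /= in_itv/= andbT.
have mono := itv_continuous_inj_le _ ct ti'.
have {}mono : {in `[0, +oo[ &, {mono theta : x y / x <= y}}.
  by apply: mono; exists 0, 1; split.
rewrite !ltNge mono ?in_itv/= ?andbT ?(le_trans s0 (ltW st))// -ltNge//.
Qed.

(** * Measurability of the solution as a random time *)

Section stopping_times.
Context {R : realType} d (T : measurableType d) (P : probability T R).
Variable W : R -> {RV P >-> (R * R)%type}.
Hypothesis hW : brownian_motion2 W.
Variables (theta : R -> R) (sigma kappa v al : R).
Hypothesis hth : bijection_in_C0 theta.
Hypothesis ka0 : 0 < kappa.
Hypothesis al0 : 0 < al.
Hypothesis al2 : al < 2^-1.
Variable X : R -> {RV P >-> R}.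
Hypothesis hX : random_ivp_solution (RLH_field sigma kappa v al theta W) X.

Local Notation FT x := (g_sigma_algebraType
  (sigma_past W x `|` [set N | measurable N /\ P N = 0%E])).

Let thi := bijection_in_C0_increasing hth.
Let cth : {within `[0, +oo[%classic, continuous theta}. Proof. by case: hth. Qed.

(** The part of the field without [theta]: the full field is [speed w y + kappa * theta t], the
    shape studied along one path. *)
Definition speed (w : T) (y : R) : R :=
  sigma * frac_derivative al (fun u => (W u w).2) y - kappa * y + v.

Definition good_event (w : T) : Prop :=
  [/\ regular_path W al w, X 0 w = 0 & forall t, 0 <= t ->
    has_derivative_on_Rplus (fun s => X s w) t (speed w (X t w) + kappa * theta t)].

Lemma ae_good_event : exists N, [/\ measurable N, P N = 0%E &
  forall w, ~ N w -> good_event w].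
Proof.
have [N1 [mN1 N10 sN1]] := ae_regular_path hW al0 al2.
have [_ [N2 [mN2 N20 sN2]]] := hX.
exists (N1 `|` N2); split; first exact: measurableU.
  apply/eqP; rewrite -measure_le0; apply: le_trans (measureU2 _ mN1 mN2) _.
  by rewrite [X in (X + _)%E]N10 [X in (_ + X)%E]N20 adde0.
move=> w nw; have h1 : regular_path W al w.
  by apply: contrapT => h; apply: nw; left; exact: sN1.
have [X0 hd] : X 0 w = 0 /\ forall t, 0 <= t -> has_derivative_on_Rplus
    (fun s => X s w) t (RLH_field sigma kappa v al theta W t (X t w) w).
  by apply: contrapT => h; apply: nw; right; exact: sN2.
split => // t t0; have := hd t t0; congr has_derivative_on_Rplus.
by rewrite /RLH_field /speed; ring.
Qed.

Let X_ge0 t w : 0 <= t -> 0 <= X t w. Proof. by case: hX => h _; exact: h. Qed.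

Lemma continuous_speed w y : good_event w -> 0 <= y ->
  {within `[0, y], continuous (speed w)}.
Proof.
move=> [rw _ _] y0 z.
have ci : {within `[0, y], continuous (fun x : R => x)}.
  by apply: continuous_subspaceT => x; exact: cvg_id.
have cf := continuous_frac_derivative hW al0 al2 rw y0.
apply: cvgD; last exact: cvg_cst.
apply: cvgB.
  by apply: cvgM; [exact: cvg_cst|exact: cf].
by apply: cvgM; [exact: cvg_cst|exact: ci].
Qed.

(** The fractional derivative is identified with the Marchaud integral on regular paths only, so
    measurability is stated for a version. *)
Lemma measurable_speed y : 0 <= y -> exists2 h : T -> R,
  measurable_fun (setT : set (FT y)) h & forall w, good_event w -> speed w y = h w.
Proof.
move=> y0; pose L := (Num.truncn y).+1.
exists (fun w => sigma * ((Gamma (1 - al))^-1 * marchaud (path0 W w) al L%:R y)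
  - kappa * y + v).
  apply: measurable_funD => //; apply: measurable_funB => //.
  apply: measurable_funM => //; apply: measurable_funM => //.
  exact: measurable_marchaud.
move=> w [rw _ _]; rewrite /speed (@frac_derivativeE _ _ _ _ _ hW al al0 al2 w L y)//.
exact: truncnS_gt.
Qed.

(** This is where the augmentation enters: a measurable subset of [N] has probability 0 and belongs
    to the filtration at every time. *)
Lemma natural_filtration_ae y (A M N : set T) : measurable A -> measurable N ->
  P N = 0%E -> natural_filtration P W y M -> (forall w, ~ N w -> A w <-> M w) ->
  natural_filtration P W y A.
Proof.
move=> mA mN N0 FM AM.
have FN (B : set T) : measurable B -> B `<=` N -> natural_filtration P W y B.
  move=> mB BN; apply: sub_sigma_algebra; right; split => //.
  by apply/eqP; rewrite -measure_le0 -N0 le_measure// inE.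
have -> : A = (M `\` N) `|` (A `&` N).
  apply/seteqP; split => w.
    by move=> Aw; have [Nw|Nw] := pselect (N w); [right|left; split => //; apply/AM].
  by move=> [[Mw Nw]|[]//]; apply/AM.
rewrite natural_filtrationE; apply: measurableU.
  by apply: measurableD => //; exact: FN.
by apply: FN; [exact: measurableI|exact: subIsetr].
Qed.

Section reach_event.
Variables (y : R) (N : nat).
Hypothesis y0 : 0 < y.

Let h0 : 0 < y / N.+1%:R. Proof. by rewrite divr_gt0. Qed.

(** By continuity of the speed, the condition over a whole cell reduces to countably many of its
    points. *)
Lemma cell_event (k : nat) (a b : R) : (k < N.+1)%N ->
  exists2 M, natural_filtration P W y M & forall w, good_event w ->
  (M w <-> (forall z, k%:R * (y / N.+1%:R) <= z -> z <= k.+1%:R * (y / N.+1%:R) ->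
        y / N.+1%:R <= a * (speed w z + b))).
Proof.
move=> kN.
pose h := y / N.+1%:R.
(* A countable dense subset of the cell: [h] is an arbitrary real, so rationals parametrize the
   position relative to the cell and the clamp keeps the points inside it. *)
pose zr (r : rat) : R := (k%:R + Num.max 0 (Num.min 1 (ratr r))) * h.
have kh0 : 0 <= k%:R * h by rewrite mulr_ge0// ltW.
have zr1 r : k%:R * h <= zr r by rewrite /zr ler_pM2r// lerDl le_max lexx.
have zr2 r : zr r <= k.+1%:R * h.
  by rewrite /zr ler_pM2r// -natr1 lerD2l ge_max ler01/= ge_min lexx.
have khy : k.+1%:R * h <= y.
  by rewrite /h mulrCA ler_piMr ?(ltW y0)// ler_pdivrMr// mul1r ler_nat.
have zr0 r : 0 <= zr r by apply: le_trans (zr1 r).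
have zry r : zr r <= y by apply: le_trans (zr2 r) _.
have /choice[H HP] : forall r, exists H : T -> R,
    measurable_fun (setT : set (FT y)) H /\ forall w, good_event w -> speed w (zr r) = H w.
  move=> r; have [H mH HE] := measurable_speed (zr0 r); exists H; split => //.
  move=> _ B mB; have := mH measurableT B mB.
  exact: (sub_natural_filtration (zry r)).
pose M := \bigcap_(r : rat) [set w | h <= a * (H r w + b)].
exists M.
  rewrite natural_filtrationE -[M]setCK; apply: measurableC.
  rewrite /M setC_bigcap; apply: countable_bigcupT_measurable; first exact: countableP.
  move=> r; apply: measurableC.
  have [mH _] := HP r.
  have mf : measurable_fun (setT : set (FT y)) (fun w => a * (H r w + b)).
    by apply: measurable_funM => //; exact: measurable_funD.
  have := mf measurableT `[h, +oo[%classic (measurable_itv _).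
  rewrite setTI; congr measurable; apply/seteqP.
  by split => w /=; rewrite in_itv/= andbT.
move=> w gw; split; last first.
  by move=> hz r _ /=; have [_ <-//] := HP r; exact: hz.
move=> Mw z z1 z2; rewrite leNgt; apply/negP => hlt.
have zy : z <= y by apply: le_trans z2 khy.
have z0 : 0 <= z by apply: le_trans z1.
have /within_continuous_ballP cs := continuous_speed gw (ltW y0).
pose e := (h - a * (speed w z + b)) / (`|a| + 1).
have a1 : 0 < `|a| + 1 by rewrite ltr_wpDl.
have e0 : 0 < e by rewrite divr_gt0// subr_gt0.
have zI : `[0, y]%classic z by rewrite /= in_itv/= z0.
have [rr rr0 rP] := cs z zI e e0.
have [r rz] : exists r : rat, `|zr r - z| < rr.
  pose q := z / h - k%:R.
  have qz : z = (k%:R + q) * h by rewrite /q addrC subrK divfK ?gt_eqF.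
  have q0 : 0 <= q by rewrite /q subr_ge0 ler_pdivlMr.
  have q1 : q <= 1 by rewrite /q lerBlDr ler_pdivrMr// addrC natr1.
  have [|r] := @rat_in_itvoo R (q - rr / h) (q + rr / h).
    by rewrite ltrD2l gt0_cp// divr_gt0.
  rewrite in_itv/= => /andP[r1 r2]; exists r.
  have -> : zr r - z = (Num.max 0 (Num.min 1 (ratr r)) - q) * h.
    by rewrite /zr {1}qz -mulrBl opprD addrACA subrr add0r.
  rewrite normrM (gtr0_norm h0) -ltr_pdivlMr//.
  have rh : 0 < rr / h by rewrite divr_gt0.
  exact: clamp_dist_lt.
have /= := Mw r I; have [_ HE] := HP r; rewrite -HE// leNgt => /negP; apply.
have zrI : `[0, y]%classic (zr r) by rewrite /= in_itv/= zr0 zry.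
have hs := rP _ zrI rz.
have -> : a * (speed w (zr r) + b) =
  a * (speed w z + b) + a * (speed w (zr r) - speed w z) by ring.
rewrite -ltrBrDl; apply: le_lt_trans (ler_norm _) _; rewrite normrM.
apply: (@le_lt_trans _ _ (`|a| * e)); first by rewrite ler_wpM2l// ltW.
apply: (@lt_le_trans _ _ ((`|a| + 1) * e)); first by rewrite ltr_pM2r// ltrDl.
by rewrite /e mulrC divfK ?gt_eqF.
Qed.

Lemma reach_event (k : nat) (q : rat) : (k <= N.+1)%N ->
  exists2 M, natural_filtration P W y M & forall w, good_event w ->
  (M w <-> reach (speed w) theta kappa y N.+1 k q).
Proof.
elim: k q => [|k IH] q kN.
  exists [set w | 0 <= (ratr q : R)] => //.
  have [q0|q0] := pselect (0 <= (ratr q : R)).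
    rewrite (_ : [set w | _] = setT); first exact: (@measurableT _ (FT y)).
    by apply/seteqP; split.
  rewrite (_ : [set w | _] = set0); first exact: (@measurable0 _ (FT y)).
  by apply/seteqP; split.
have /choice[M1 M1P] : forall p : rat, exists M, natural_filtration P W y M /\
    forall w, good_event w -> (M w <-> reach (speed w) theta kappa y N.+1 k p).
  by move=> p; have [M ? ?] := IH p (ltnW kN); exists M.
have /choice[M2 M2P] : forall p : rat, exists M, natural_filtration P W y M /\
    forall w, good_event w -> (M w <-> (forall z, k%:R * (y / N.+1%:R) <= z ->
      z <= k.+1%:R * (y / N.+1%:R) ->
      y / N.+1%:R <= (ratr q - ratr p) * (speed w z + kappa * theta (ratr p)))).
  move=> p; have [M ? ?] := @cell_event k (ratr q - ratr p) (kappa * theta (ratr p)) kN.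
  by exists M.
exists (\bigcup_(p : rat) (if p < q then M1 p `&` M2 p else set0)).
  rewrite natural_filtrationE; apply: countable_bigcupT_measurable; first exact: countableP.
  move=> p; case: ifP => _; last exact: measurable0.
  by apply: measurableI; [case: (M1P p)|case: (M2P p)].
move=> w gw; split.
  move=> [p _]; case: ifP => // pq [m1 m2]; exists p; split => //.
    by have [_ h] := M1P p; apply/h.
  by have [_ h] := M2P p; apply/h.
move=> /= [p [pq m1 m2]]; exists p => //; rewrite pq; split.
  by have [_ h] := M1P p; apply/h.
by have [_ h] := M2P p; apply/h.
Qed.

End reach_event.

Lemma stopping_time t y : 0 <= t -> 0 <= y ->
  natural_filtration P W y [set w | X t w <= y].
Proof.
move=> t0 y0; have [Nn [mN N0 gN]] := ae_good_event.
have mX : measurable [set w | X t w <= y].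
  have := measurable_funPT (X t) measurableT `]-oo, y]%classic (measurable_itv _).
  by rewrite setTI.
have X_ge0' w s : 0 <= s -> 0 <= X s w by exact: X_ge0.
(* The grid on [[0, y]] degenerates at [y = 0]. There the event has probability 1 for [t = 0] and 0
   for [t > 0], since [X] starts at 0 and increases strictly. *)
have [yE|yN] := eqVneq y 0.
  have [tE|tN] := eqVneq t 0.
    apply: (@natural_filtration_ae y _ setT Nn) => //.
      exact: (@measurableT _ (FT y)).
    move=> w /gN [_ Xw _]; split => // _ /=.
    by rewrite tE Xw.
  apply: (@natural_filtration_ae y _ set0 Nn) => //.
    exact: (@measurable0 _ (FT y)).
  move=> w /gN [_ Xw dX]; split => //= Xt.
  have tp : 0 < t by rewrite lt_neqAle eq_sym tN.
  have := ode_increasing Xw (X_ge0' w) dX ka0 thi (lexx 0) tp.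
  by rewrite Xw ltNge -yE Xt.
have yp : 0 < y by rewrite lt_neqAle eq_sym yN.
have /choice[M MP] : forall Nq : nat * rat, exists M, natural_filtration P W y M /\
    forall w, good_event w ->
    (M w <-> reach (speed w) theta kappa y Nq.1.+1 Nq.1.+1 Nq.2).
  by move=> [n q]; have [M ? ?] := @reach_event y n yp n.+1 q (leqnn _); exists M.
pose U := \bigcup_(Nq : nat * rat) (if ratr Nq.2 < t then M Nq else set0).
apply: (@natural_filtration_ae y _ (~` U) Nn) => //.
  rewrite natural_filtrationE; apply: measurableC.
  apply: countable_bigcupT_measurable; first exact: countableP.
  by move=> p; case: ifP => _; [case: (MP p)|exact: measurable0].
move=> w /gN gw; have [_ Xw dX] := gw.
have hP := lt_hittingP Xw (X_ge0' w) dX ka0 thi yp (continuous_speed gw y0) cth t0.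
split.
  move=> /= Xy [[n q] _]; case: ifP => // qt Mw.
  suff : y < X t w by rewrite ltNge Xy.
  by apply/hP; exists n, q; split => //; have [_ h] := MP (n, q); apply/h.
move=> /= nU; rewrite leNgt; apply/negP => /hP[n [q [qt rq]]]; apply: nU.
by exists (n, q) => //=; rewrite qt; have [_ h] := MP (n, q); apply/h.
Qed.

Lemma le_good_event s t w : good_event w -> 0 <= s -> s <= t -> X s w <= X t w.
Proof.
move=> [_ Xw dX] s0 st.
have X_ge0' u : 0 <= u -> 0 <= X u w by exact: X_ge0.
exact: (ode_nondecreasing Xw X_ge0' dX ka0 thi s0 st).
Qed.

End stopping_times.

(** * The price process *)

Section price_process.
Context {R : realType} d (T : measurableType d) (P : probability T R).
Variable W : R -> {RV P >-> (R * R)%type}.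
Hypothesis hW : brownian_motion2 W.
Variables (theta : R -> R) (sigma kappa v al rho : R).
Hypothesis hth : bijection_in_C0 theta.
Hypothesis si0 : 0 < sigma.
Hypothesis ka0 : 0 < kappa.
Hypothesis al0 : 0 < al.
Hypothesis al2 : al < 2^-1.
Hypothesis rho1 : -1 <= rho.
Hypothesis rho2 : rho <= 1.
Variable X : R -> {RV P >-> R}.
Hypothesis hX : random_ivp_solution (RLH_field sigma kappa v al theta W) X.

Local Notation FT x := (g_sigma_algebraType
  (sigma_past W x `|` [set N | measurable N /\ P N = 0%E])).

Let al1 : al < 1. Proof. by rewrite (lt_trans al2)// invf_lt1// ltr1n. Qed.

Let ae_good := ae_good_event hW al0 al2 hX.
Let stop t y := @stopping_time _ _ _ _ _ hW _ _ _ _ _ hth ka0 al0 al2 _ hX t y.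
Let thi := bijection_in_C0_increasing hth.

Let X_ge0 t w : 0 <= t -> 0 <= X t w. Proof. by case: hX => h _; exact: h. Qed.

Let G t := events_prior (natural_filtration P W) (X t).

Let leX s t : 0 <= s -> s <= t -> exists N, [/\ measurable N, P N = 0%E &
  forall w, ~ N w -> X s w <= X t w].
Proof.
move=> s0 st; have [N [mN N0 gN]] := ae_good; exists N; split => // w /gN gw.
exact: (le_good_event hth ka0 hX gw s0 st).
Qed.

Lemma filtration_events_prior : filtration G.
Proof.
split.
- move=> t t0; split.
  + split; first exact: measurable0.
    by move=> x x0; rewrite set0I; exact: (@measurable0 _ (FT x)).
  + move=> A [mA FA]; split; first exact: measurableD.
    move=> x x0.
    have -> : (setT `\` A) `&` [set w | X t w <= x] =
        [set w | X t w <= x] `\` (A `&` [set w | X t w <= x]).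
      apply/seteqP; split => w /=.
        by move=> [[_ nA] Xw]; split => // -[].
      by move=> [Xw nA]; split => //; split => // Aw; exact: nA.
    rewrite natural_filtrationE; apply: measurableD; first exact: stop.
    exact: FA.
  + move=> A hA; split.
      by apply: bigcupT_measurable => n; have [] := hA n.
    move=> x x0; rewrite setI_bigcupl natural_filtrationE.
    by apply: bigcupT_measurable => n; have [_ h] := hA n; exact: h.
- by move=> t t0 A [].
(* Off a null set [X s <= X t], so intersecting with [X s <= x] as well does not change the event;
   that intersection is known at [x]. *)
- move=> s t s0 st A [mA FA]; split => // x x0.
  have [N [mN N0 NX]] := leX s0 st.
  have t0 : 0 <= t by apply: le_trans st.
  have FAx := FA x x0; have Fx := stop t0 x0.
  apply: (@natural_filtration_ae _ _ _ _ _ x _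
    ((A `&` [set w | X s w <= x]) `&` [set w | X t w <= x]) N) => //.
  + apply: measurableI => //; exact: natural_filtration_measurable Fx.
  + by rewrite natural_filtrationE; exact: measurableI.
  + move=> w /NX st'; split => /= [[Aw Xw]|[[Aw _] Xw]]; split => //.
    by split => //; exact: le_trans Xw.
Qed.

Let a : R := Num.sqrt (1 - rho ^+ 2).

Let ab1 : a ^+ 2 + rho ^+ 2 = 1.
Proof.
rewrite /a sqr_sqrtr ?subrK// subr_ge0 -ler_sqrt// ?sqrtr_sqr ?sqrtr1.
  by rewrite ler_norml rho1 rho2.
Qed.

Let priceE t w : RLH_price rho W X t w = exp_bm W a rho (X t w) w.
Proof.
by rewrite /RLH_price /exp_bm /correlated_bm /lin2 ab1 mul1r.
Qed.

Lemma measurable_RLH_price t : 0 <= t -> measurable_fun setT (RLH_price rho W X t).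
Proof.
move=> t0.
have := @measurable_exp_bm_comp _ _ _ _ _ hW a rho (X t) (measurable_funPT (X t)).
move=> /(_ (fun w => X_ge0 w t0)); apply: eq_measurable_fun => w _.
by rewrite priceE.
Qed.

Lemma measurable_wrt_RLH_price t : 0 <= t -> measurable_wrt (G t) (RLH_price rho W X t).
Proof.
move=> t0 A [B mB <-]; rewrite setTI; split.
  by rewrite -[X in measurable X]setTI; exact: measurable_RLH_price.
move=> x x0.
(* On [X t <= x] the price is unchanged when [X t] is replaced by [Num.min x (X t)], which is known
   at [x] and can be inserted into the clamped path. *)
have mmin : measurable_fun (setT : set (FT x)) (fun w => Num.min x (X t w)).
  apply: (measurability _ (RGenOInfty.measurableE R)) => _ [_ [y ->] <-].
  rewrite setTI.
  have [xy|yx] := leP x y.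
    rewrite (_ : _ @^-1` _ = set0); first exact: measurable0.
    apply/seteqP; split => w //=; rewrite in_itv/= andbT lt_min => /andP[yx].
    by move: xy; rewrite leNgt yx.
  have [y0|y0] := ltP y 0.
    rewrite (_ : _ @^-1` _ = setT); first exact: measurableT.
    apply/seteqP; split => w //= _; rewrite in_itv/= andbT lt_min yx.
    by rewrite (lt_le_trans y0)// X_ge0.
  rewrite (_ : _ @^-1` _ = ~` [set w | X t w <= y]).
    apply: measurableC; exact: (sub_natural_filtration (ltW yx) (stop t0 y0)).
  apply/seteqP; split => w /=; rewrite in_itv/= andbT lt_min yx/= ltNge.
    by move/negP.
  by move=> /negP.
have mj := measurableT_comp (measurable_clamped_bm hW x0 a rho)
  (measurable_fun_pair mmin (@measurable_id _ (FT x) setT)).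
have me : measurable_fun (setT : set (FT x)) (fun w => expR (lin2 a rho
    (W (Num.min x (Num.max 0 (Num.min x (X t w)))) w) - Num.min x (X t w) / 2)).
  apply: (measurableT_comp (@measurable_expR R)); apply: measurable_funB => //.
  exact: measurable_funM.
rewrite natural_filtrationE (_ : _ `&` _ = (fun w => expR (lin2 a rho
    (W (Num.min x (Num.max 0 (Num.min x (X t w)))) w) - Num.min x (X t w) / 2)) @^-1` B
    `&` [set w | X t w <= x]).
  apply: measurableI; last exact: stop.
  by rewrite -[X in measurable X]setTI; exact: me.
have E w : X t w <= x -> expR (lin2 a rho
    (W (Num.min x (Num.max 0 (Num.min x (X t w)))) w) - Num.min x (X t w) / 2) =
    RLH_price rho W X t w.
  move=> Xx; have mX : Num.min x (X t w) = X t w by apply/min_idPr.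
  by rewrite mX (max_r (X_ge0 w t0)) mX.
by apply/seteqP; split => w /= [Bw Xw]; split => //=; move: Bw; rewrite E.
Qed.

Let M (n : nat) w := exp_bm W a rho n.+1%:R w.

Let mM n : measurable_fun setT (fun w => (M n w)%:E).
Proof. by apply/measurable_EFinP; exact: measurable_exp_bm. Qed.

Let M0 n w : (0 <= (M n w)%:E)%E. Proof. by rewrite lee_fin expR_ge0. Qed.

Let leset t (x : R) : set T := [set w | X t w <= x].

Let mleset t x : measurable (leset t x).
Proof.
have := measurable_funPT (X t) measurableT `]-oo, x]%classic (measurable_itv _).
by rewrite setTI.
Qed.

(* On [X_t > x] the speed is nonnegative along [0, x]; integrating it bounds
   the fractional integral, hence the running maximum of [W^1], from below. *)
Let large_max t : 0 <= t -> exists n0 : nat, forall n w, (n0 <= n)%N ->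
  good_event W theta sigma kappa v al X w -> n.+1%:R < X t w ->
  exists u, [/\ 0 <= u, u <= n.+1%:R & 5 * n.+1%:R <= `|(W u w).2|].
Proof.
move=> t0.
pose c : R := (Gamma (1 - al))^-1.
pose m : R := kappa * theta t + v.
(* Chosen so that the bound [5 * x * p / (1 - al)] on the fractional integral, times its
   coefficient, is [kappa * x / 4] times [(D - 1) * p]; the summand 1 makes [D] positive and the
   final inequality strict. *)
pose D : R := 20 * (sigma * `|c|) / (kappa * (1 - al)) + 1.
have al1' : 0 < 1 - al by rewrite subr_gt0.
have D0 : 0 < D.
  rewrite /D ltr_wpDl// divr_ge0 ?mulr_ge0 ?normr_ge0 ?(ltW si0) ?(ltW ka0) ?(ltW al1')//.
(* Beyond the first bound [m * x] uses at most half of [kappa * x ^+ 2 / 2]; beyond the second,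
   [x ^ al > D], that is, [D * x ^ (1 - al) < x]. *)
pose x0 : R := Num.max (4 * `|m| / kappa) (D `^ al^-1).
exists (Num.truncn x0).+1 => n w nn gw Xn.
pose x : R := n.+1%:R.
have xx0 : x0 < x.
  apply: lt_le_trans (truncnS_gt _) _; rewrite ler_nat (leq_trans nn)//.
have xp : 0 < x by rewrite ltr0n.
apply: contrapT => nou.
have Wlt u : 0 <= u -> u <= x -> `|(W u w).2| <= 5 * x.
  move=> u0 ux; rewrite leNgt; apply/negP => h; apply: nou; exists u; split => //.
  exact: ltW.
have [rw Xw dX] := gw.
have X_ge0' u : 0 <= u -> 0 <= X u w by exact: X_ge0.
have sp y : 0 <= y -> y <= x -> 0 <= speed W sigma kappa v al w y + kappa * theta t.
  move=> y0 yx; apply: (ode_speed_ge0 Xw X_ge0' dX ka0 thi t0 y0).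
  exact: le_trans (ltW Xn).
pose F := frac_int W al w.
(* The antiderivative, vanishing at 0, of the field at the fixed time [t]; the mean value theorem
   gives [0 <= H x]. *)
pose H (y : R) := sigma * c * F y + m * y - kappa / 2 * y ^+ 2.
have dF y : 0 <= y -> y <= x -> is_derive y 1 F (marchaud (path0 W w) al n.+2%:R y).
  move=> y0 yx; apply: (is_derive_frac_int hW al0 al2 rw) => //.
  by rewrite in_itv/= (lt_le_trans _ y0)//= (le_lt_trans yx)// ltr_nat.
have dH y : 0 <= y -> y <= x -> is_derive y 1 H
    (speed W sigma kappa v al w y + kappa * theta t).
  move=> y0 yx.
  have h1 := is_deriveZ (sigma * c) (dF y y0 yx).
  have h2 := is_deriveZ m (is_derive_id y 1).
  have h3 := is_deriveZ (kappa / 2) (is_deriveX 2 (is_derive_id y 1)).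
  have := is_deriveB (is_deriveD h1 h2) h3.
  rewrite /H /F => h; apply: is_derive_eq h _.
  rewrite /speed (@frac_derivativeE _ _ _ _ _ hW al al0 al2 w n.+2 y)//; last first.
    by rewrite (le_lt_trans yx)// ltr_nat.
  rewrite -/c /m /= expr1; by rewrite /GRing.scale/=; field.
have H0 : H 0 = 0.
  rewrite /H /F /frac_int set_itv1 Rintegral_set1.
  by rewrite !mulr0 expr0n/= mulr0 addr0 subr0.
have Hx : 0 <= H x.
  have cH : {within `[0, x], continuous H}.
    have di : {in `[0, x], forall y, derivable H y 1}.
      by move=> z; rewrite in_itv/= => /andP[z0 zx]; have [] := dH z z0 zx.
    exact: derivable_within_continuous di.
  have dH' y : y \in `]0, x[ -> is_derive y 1 H
      (speed W sigma kappa v al w y + kappa * theta t).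
    by rewrite in_itv/= => /andP[y0 yx]; apply: dH; exact: ltW.
  have [y] := MVT xp dH' cH.
  rewrite in_itv/= => /andP[y0 yx]; rewrite H0 !subr0 => ->.
  by rewrite mulr_ge0 ?(ltW xp)// sp// ltW.
have Fb : `|F x| <= 5 * x * x `^ (1 - al) / (1 - al).
  rewrite /F frac_int_path0; apply: frac_integral_bound => //.
  - exact: continuous_path0 hW w.
  - by move=> u u0; apply: path0_le0 => //; case: rw.
  - move=> u ux; rewrite /path0; apply: Wlt; first by rewrite le_max lexx.
    by rewrite ge_max ux ltW.
have x4 : 4 * `|m| < kappa * x.
  have : 4 * `|m| / kappa < x by apply: le_lt_trans xx0; rewrite le_max lexx.
  by rewrite ltr_pdivrMr// [x * kappa]mulrC.
have xD : D < x `^ al.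
  have h1 : D `^ al^-1 < x by apply: le_lt_trans xx0; rewrite le_max lexx orbT.
  have -> : D = (D `^ al^-1) `^ al by rewrite -powRrM mulVf ?gt_eqF// powRr1// ltW.
  by apply: gt0_ltr_powR; rewrite ?nnegrE ?powR_ge0 ?(ltW xp).
have px : 0 < x `^ (1 - al) by exact: powR_gt0.
have xE : x = x `^ (1 - al) * x `^ al.
  rewrite -powRD; last by rewrite subrK oner_eq0.
  by rewrite subrK powRr1// ltW.
pose p := x `^ (1 - al).
have S1 : sigma * c * F x <= sigma * `|c| * (5 * x * p / (1 - al)).
  apply: le_trans (ler_norm _) _; rewrite !normrM (gtr0_norm si0).
  by rewrite ler_wpM2l// mulr_ge0 ?normr_ge0// ltW.
have mx : m * x <= kappa * x / 4 * x.
  rewrite ler_pM2r//; apply: le_trans (ler_norm _) _.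
  by move: x4; lra.
have : kappa * x / 4 * x <= sigma * `|c| * (5 * x * p / (1 - al)).
  move: Hx; rewrite /H; have -> : kappa / 2 * x ^+ 2 = kappa * x / 4 * x + kappa * x / 4 * x.
    by field.
  by move: S1 mx; lra.
rewrite leNgt => /negP; apply.
have : D * p < x by rewrite [ltRHS]xE mulrC ltr_pM2l.
have -> : sigma * `|c| * (5 * x * p / (1 - al)) = (kappa * x / 4) * ((D - 1) * p).
  by rewrite /D addrK; field; rewrite !gt_eqF.
move=> Dp; rewrite ltr_pM2l; last by rewrite divr_gt0// mulr_gt0.
by apply: le_lt_trans Dp; rewrite ler_pM2r// gerBl.
Qed.

(** Up to a null set the event lies in [E], where [W^1] reaches the height [5 * x] in absolute value
    before [x = n + 1]; its small probability is weighed against the second moment of [M n]. *)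
Let tail t : 0 <= t -> exists n0 : nat, forall n, (n0 <= n)%N ->
  (\int[P]_(w in ~` leset t n.+1%:R) (M n w)%:E <= (2 * expR (- n.+1%:R))%:E)%E.
Proof.
move=> t0; have [n0 n0P] := large_max t0; exists n0 => n nn.
pose x : R := n.+1%:R.
have xp : 0 < x by rewrite ltr0n.
have m1 : (-1) ^+ 2 = 1 :> R by rewrite sqrrN expr1n.
have x5 : 0 < 5 * x by rewrite mulr_gt0.
have [E1 [mE1 PE1 hE1]] := maximal_inequality hW (expr1n R 2) x5 xp.
have [E2 [mE2 PE2 hE2]] := maximal_inequality hW m1 x5 xp.
have [N [mN N0 gN]] := ae_good.
pose E := E1 `|` E2.
have mE : measurable E by exact: measurableU.
(* The height [5 * x] gives the exponent [25 / 8 * x], and [25 / 8 > 3]. *)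
have PE : (P E <= (2 * expR (- (3 * x)))%:E)%E.
  apply: le_trans (measureU2 _ mE1 mE2) _.
  have he : expR (- ((5 * x) ^+ 2 / (8 * x))) <= expR (- (3 * x)).
    rewrite ler_expR lerN2.
    have -> : (5 * x) ^+ 2 / (8 * x) = 25 / 8 * x by field; rewrite gt_eqF.
    by rewrite ler_pM2r//; lra.
  rewrite mulr_natl mulr2n EFinD; apply: leeD.
    by apply: le_trans PE1 _; rewrite lee_fin.
  by apply: le_trans PE2 _; rewrite lee_fin.
have sub : ~` leset t x `\` N `<=` E.
  move=> w [nl Nw].
  have Xw : x < X t w by rewrite ltNge; apply/negP.
  have [u [u0 ux hu]] := n0P n w nn (gN w Nw) Xw.
  move: hu; rewrite ler_normr => /orP[h|h].
    by left; apply: (hE1 u) => //; rewrite mul1r.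
  by right; apply: (hE2 u) => //; rewrite mulN1r.
have mL : measurable (~` leset t x) by apply: measurableC; exact: mleset.
rewrite (ge0_negligible_integral mN)//; last exact: measurable_funTS.
apply: (@le_trans _ _ (\int[P]_(w in E) (M n w)%:E)%E).
  by apply: ge0_subset_integral => //; [exact: measurableD|exact: measurable_funTS].
(* Young's inequality [M <= M ^ 2 / (2 k) + k / 2] on [E], where [M ^ 2] is
   [exp x] times the exponential martingale with doubled coefficients and
   [P E <= 2 exp (- 3 x)]; the choice [k = exp (2 x)] balances both terms. *)
pose k : R := expR (2 * x).
have k0 : 0 < k by exact: expR_gt0.
pose Q w : R := exp_bm W (2 * a) (2 * rho) x w.
have M2 w : M n w ^+ 2 = expR x * Q w.
  rewrite /M /Q /exp_bm -expRM_natl -expRD; congr expR.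
  have -> : (2 * a) ^+ 2 + (2 * rho) ^+ 2 = 4.
    by rewrite !exprMn -mulrDr ab1; ring.
  by rewrite ab1 /lin2 -/x; field.
have mQ : measurable_fun setT (fun w => (Q w)%:E).
  by apply/measurable_EFinP; exact: measurable_exp_bm.
have Q0 w : (0 <= (Q w)%:E)%E by rewrite lee_fin expR_ge0.
apply: (@le_trans _ _ (\int[P]_(w in E) ((expR (- x) / 2)%:E * (Q w)%:E + (k / 2)%:E))%E).
  apply: ge0_le_integral => //.
  - exact: measurable_funTS.
  - apply: emeasurable_funD => //; apply: emeasurable_funM => //; exact: measurable_funTS.
  - move=> w _; rewrite -EFinM -EFinD lee_fin.
    have -> : expR (- x) / 2 * Q w = M n w ^+ 2 / k / 2.
      have -> : expR (- x) = expR x / k.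
        by rewrite /k -expRN -expRD; congr expR; ring.
      by rewrite M2; ring.
    rewrite -mulrDl ler_pdivlMr// -(ler_pM2r k0) mulrDl divfK ?gt_eqF//.
    have := sqr_ge0 (M n w - k); rewrite sqrrB expr2 => h.
    by move: h; rewrite [k ^+ 2]expr2 mulr2n; lra.
rewrite ge0_integralD//; last 3 first.
- by move=> w _; rewrite mule_ge0// lee_fin divr_ge0// expR_ge0.
- by apply: emeasurable_funM => //; exact: measurable_funTS.
- by move=> w _; rewrite lee_fin divr_ge0// expR_ge0.
rewrite ge0_integralZl//; last exact: measurable_funTS.
rewrite integral_cst//.
have -> : 2 * expR (- x) = expR (- x) / 2 + 3 / 2 * expR (- x) by field.
rewrite EFinD; apply: leeD.
  rewrite -[leRHS]mule1 lee_wpmul2l ?lee_fin ?divr_ge0 ?expR_ge0//.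
  rewrite -(integral_exp_bm hW (2 * a) (2 * rho) (ltW xp)).
  exact: ge0_subset_integral.
apply: (@le_trans _ _ ((k / 2)%:E * (2 * expR (- (3 * x)))%:E)%E).
  by rewrite lee_wpmul2l// lee_fin divr_ge0// expR_ge0.
rewrite -EFinM lee_fin.
have -> : k / 2 * (2 * expR (- (3 * x))) = expR (- x).
  rewrite mulrA divfK// /k -expRD; congr expR; ring.
by rewrite ler_peMl ?expR_ge0//; lra.
Qed.

Let stopped t A n : 0 <= t -> G t A ->
  (\int[P]_(w in A `&` leset t n.+1%:R) (RLH_price rho W X t w)%:E =
   \int[P]_(w in A `&` leset t n.+1%:R) (M n w)%:E)%E.
Proof.
move=> t0 [mA FA].
have np : 0 < n.+1%:R :> R by rewrite ltr0n.
have := @optional_stopping _ _ _ _ _ hW (X t) A n.+1%:R (measurable_funPT (X t))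
  (fun w => X_ge0 w t0) FA np a rho.
by move=> <-; apply: eq_integral => w _; rewrite priceE.
Qed.

Let mE t : 0 <= t -> measurable_fun setT (fun w => (RLH_price rho W X t w)%:E).
Proof. by move=> t0; apply/measurable_EFinP; exact: measurable_RLH_price. Qed.

Let S0 t w : (0 <= (RLH_price rho W X t w)%:E)%E.
Proof. by rewrite lee_fin expR_ge0. Qed.

(** After optional stopping this is monotone convergence: [X t] is finite, so the events
    [X t <= n + 1] exhaust the space. *)
Let cvg_stopped t A : 0 <= t -> G t A ->
  (\int[P]_(w in A `&` leset t n.+1%:R) (M n w)%:E @[n --> \oo] -->
   \int[P]_(w in A) (RLH_price rho W X t w)%:E)%E.
Proof.
move=> t0 GA; have [mA _] := GA.
under eq_fun do rewrite -stopped//.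
have -> : (\int[P]_(w in A) (RLH_price rho W X t w)%:E =
  \int[P]_(w in \bigcup_n (A `&` leset t n.+1%:R)) (RLH_price rho W X t w)%:E)%E.
  congr (integral _ _ _); rewrite -setI_bigcupr; apply/seteqP; split => w.
    move=> Aw; split => //; exists (Num.truncn (X t w)) => //.
    exact/ltW/truncnS_gt.
  by move=> [].
apply: ge0_nondecreasing_set_cvg_integral => //.
- move=> m n mn; rewrite subsetEset => w [Aw Xw]; split => //.
  by rewrite /leset/= (le_trans Xw)// ler_nat.
- by move=> n; apply: measurableI => //; exact: mleset.
- by move=> n; apply: measurable_funTS; exact: mE.
Qed.

Let GT t : 0 <= t -> G t setT.
Proof.
move=> t0; split; first exact: measurableT.
by move=> x x0; rewrite setTI; exact: stop.
Qed.

(** The integral is the limit of masses of [M n] on subsets, each at most 1. *)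
Lemma integrable_RLH_price t : 0 <= t ->
  P.-integrable setT (EFin \o RLH_price rho W X t).
Proof.
move=> t0; apply/integrableP; split; first exact: mE.
rewrite (eq_integral (fun w => (RLH_price rho W X t w)%:E)); last first.
  by move=> w _; exact: gee0_abs (S0 t w).
apply: (@le_lt_trans _ _ 1%E); last exact: ltry.
have h := cvg_stopped t0 (GT t0).
rewrite -(cvg_lim _ h)//; apply: lime_le; first exact: cvgP h.
apply: nearW => n /=.
have np : 0 <= n.+1%:R :> R by [].
rewrite -(integral_exp_bm hW a rho np).
apply: ge0_subset_integral => //.
by apply: measurableI => //; exact: mleset.
Qed.

Lemma conditional_RLH_price s t A : 0 <= s -> s <= t -> G s A ->
  (\int[P]_(w in A) (RLH_price rho W X s w)%:E =
   \int[P]_(w in A) (RLH_price rho W X t w)%:E)%E.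
Proof.
move=> s0 st GsA; have t0 : 0 <= t by apply: le_trans st.
have [_ _ mono] := filtration_events_prior.
have GtA : G t A by exact: (mono s t s0 st).
have [mA _] := GsA.
have hs := cvg_stopped s0 GsA; have ht := cvg_stopped t0 GtA.
have [N [mN N0 NX]] := leX s0 st.
have ml r n : measurable (A `&` leset r n.+1%:R).
  by apply: measurableI => //; exact: mleset.
apply/eqP; rewrite eq_le; apply/andP; split; last first.
  (* Almost surely [X t <= n + 1] forces [X s <= n + 1], so the inequality already holds for each
     [n]. *)
  rewrite -(cvg_lim _ ht)// -(cvg_lim _ hs)//.
  apply: (lee_lim (cvgP _ ht) (cvgP _ hs)); apply: nearW => n /=.
  rewrite (ge0_negligible_integral mN)//; last exact: measurable_funTS (mM n).
  apply: ge0_subset_integral => //.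
  - exact: measurableD.
  - exact: measurable_funTS (mM n).
  - by move=> w [[Aw Xw] /NX sX]; split => //; exact: le_trans Xw.
(* Conversely, [A] with [X s <= n + 1] is covered by [A] with [X t <= n + 1] and the event
   [X t > n + 1], whose [M n]-mass is at most [e] for large [n]. *)
apply/lee_addgt0Pr => e e0.
have [n0 tailP] := tail t0.
rewrite -(cvg_lim _ hs)//; apply: lime_le; first exact: cvgP hs.
(* With [2 / e < n] the inequality [1 + z <= expR z] gives [2 * expR (- (n + 1)) <= e]. *)
exists (maxn n0 (Num.truncn (2 / e)).+1) => // n /=.
rewrite geq_max => /andP[nn ne].
have mL : measurable (~` leset t n.+1%:R) by apply: measurableC; exact: mleset.
apply: (@le_trans _ _ (\int[P]_(w in (A `&` leset t n.+1%:R) `|` ~` leset t n.+1%:R)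
    (M n w)%:E)%E).
  apply: ge0_subset_integral => //.
  - exact: measurableU.
  - exact: measurable_funTS (mM n).
  - by move=> w [Aw Xw]; have [tw|tw] := pselect (leset t n.+1%:R w); [left|right].
rewrite ge0_integral_setU//; last 2 first.
- exact: measurable_funTS (mM n).
- by apply/disj_setPS => w [[_ tw]]; exact.
apply: leeD.
  rewrite -stopped//; apply: ge0_subset_integral => //.
  exact: measurable_funTS (mE t0).
apply: le_trans (tailP n nn) _; rewrite lee_fin expRN.
have en : 2 / e < n%:R :> R.
  by apply: lt_le_trans (truncnS_gt _) _; rewrite ler_nat.
rewrite ler_pdivrMr ?expR_gt0//; rewrite ltr_pdivrMr// in en.
apply: (@le_trans _ _ (e * (1 + n.+1%:R))); last by rewrite ler_pM2l// expR_ge1Dx.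
by rewrite -natr1; move: en; lra.
Qed.

End price_process.

Theorem mainTheorem14 (R : realType) (d : measure_display)
    (T : measurableType d) (P : probability T R)
    (W : R -> {RV P >-> (R * R)%type}) (theta : R -> R)
    (sigma kappa v alpha rho : R) (X : R -> {RV P >-> R}) :
  brownian_motion2 W ->
  bijection_in_C0 theta ->
  0 < sigma -> 0 < kappa -> 0 < v ->
  0 < alpha -> alpha < 2^-1 ->
  -1 <= rho -> rho <= 1 ->
  random_ivp_solution (RLH_field sigma kappa v alpha theta W) X ->
  martingale P (fun t => events_prior (natural_filtration P W) (X t))
    (RLH_price rho W X).
Proof.
move=> hW hth si0 ka0 _ al0 al2 rho1 rho2 hX.
have mS := measurable_wrt_RLH_price hW hth ka0 al0 al2 rho1 rho2 hX.
have iS := integrable_RLH_price hW hth ka0 al0 al2 rho1 rho2 hX.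
split; [exact: (filtration_events_prior hW hth ka0 al0 al2 hX)|exact: mS|exact: iS|].
move=> s t s0 st; split; [exact: mS|exact: iS|].
by move=> A; exact: (conditional_RLH_price hW hth si0 ka0 al0 al2 rho1 rho2 hX).
Qed.
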